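(* Let $(M,\mathcal{T})$ be an ideally triangulated compact $3$-manifold with boundary, all of whose boundary components have negative Euler characteristic. For $e\in E$ let $d_e$ be the number of tetrahedra adjacent to $e$. (1) If $d_e\le 6$ for every $e\in E$, then there exists no hyper-ideal polyhedral metric on $(M,\mathcal{T})$ with zero combinatorial Ricci curvature. (2) If $d_e=d_{e'}=N>6$ for all $e,e'\in E$, then for every initial hyper-ideal polyhedral metric $l_0\in\mathcal{L}(M,\mathcal{T})$ the extended solution of the combinatorial Ricci flow, i.e. the solution $l:[0,+\infty)\to\mathbb{R}^E$ of $\frac{dl_e}{dt}=\widetilde{K}_e(l)$ $(e\in E)$ with $l(0)=l_0$, converges exponentially fast to a hyper-ideal polyhedral metric $l^*\in\mathcal{L}(M,\mathcal{T})$ with zero combinatorial Ricci curvature: $K_e(l^* )=0$ for all $e\in E$, and there are constants $C,c>0$ with $\|l(t)-l^*\|\le Ce^{-ct}$ for all $t\ge0$.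
   Context: Hyper-ideal tetrahedra. A hyper-ideal tetrahedron is a compact convex polyhedron in $\mathbb{H}^3$ diffeomorphic to a truncated Euclidean tetrahedron, with four right-angled hexagonal faces and four triangular faces (vertex triangles $\Delta_1,\dots,\Delta_4$), each triangular face being orthogonal to its three adjacent hexagonal faces. Its six edges are the pairwise intersections of hexagonal faces; $l_{ij}=l_{ji}$ is the length of the edge joining $\Delta_i$ and $\Delta_j$, and $a_{ij}\in(0,\pi)$ is the dihedral angle there. The tetrahedron is determined up to isometry by $(l_{12},\dots,l_{34})$. Let $\mathcal{L}\subset\mathbb{R}^6_{>0}$ be the (open) set of six-tuples that are the edge lengths of a nondegenerate hyper-ideal tetrahedron; $a_{ij}$ is a function on $\mathcal{L}$. Triangulations. An ideally triangulated compact $3$-manifold with boundary $(M,\mathcal{T})$ is a compact $3$-manifold $M$ with (nonempty) boundary presented as the quotient of a finite set $T$ of truncated tetrahedra by gluing their hexagonal faces in pairs, so that the vertex triangles give a triangulation of $\partial M$. $E$ is the (finite) set of edges: equivalence classes, under gluing, of the edges arising as intersections of two hexagonal faces. The number $d_e$ of tetrahedra adjacent to $e\in E$ is counted with multiplicity, i.e. it is the number of edges of tetrahedra in $T$ identified to $e$. For $l\in\mathbb{R}^E$ and $\sigma\in T$, $l_\sigma\in\mathbb{R}^6$ is the vector of values of $l$ on the six edges of $\sigma$. A hyper-ideal polyhedral metric is an $l\in\mathbb{R}^E_{>0}$ with $l_\sigma\in\mathcal{L}$ for all $\sigma\in T$; $\mathcal{L}(M,\mathcal{T})$ is the set of these.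 The combinatorial Ricci curvature of $l\in\mathcal{L}(M,\mathcal{T})$ at $e\in E$ is $K_e(l)=2\pi-(\text{sum of all dihedral angles at } e)$, the sum being over all edges of tetrahedra identified to $e$. The combinatorial Ricci flow is $\frac{dl_e}{dt}=K_e(l)$. Extension of angles. For $l\in\mathbb{R}^6_{>0}$ and $\{i,j,k,h\}=\{1,2,3,4\}$ let $\cosh x^i_{jk}=\frac{\cosh l_{ij}\cosh l_{ik}+\cosh l_{jk}}{\sinh l_{ij}\sinh l_{ik}}$ with $x^i_{jk}>0$, and $\phi_{ij}(l)=\frac{\cosh x^i_{jk}\cosh x^i_{jh}-\cosh x^i_{kh}}{\sinh x^i_{jk}\sinh x^i_{jh}}$ (this is symmetric in $i,j$). On $\mathcal{L}$, $\phi_{ij}=\cos a_{ij}$. Extend $a_{ij}$ to $\mathbb{R}^6_{>0}$ by $a_{ij}=0$ where $\phi_{ij}\ge 1$ and $a_{ij}=\pi$ where $\phi_{ij}\le -1$, and then continuously to $\mathbb{R}^6_{\ge 0}$. For $l\in\mathbb{R}^6$ put $\widetilde{a}_{ij}(l)=a_{ij}(l^+)$ with $l^+_{ij}=\max\{0,l_{ij}\}$; this is a continuous function on $\mathbb{R}^6$. (Equivalently, $\widetilde a_{ij}(l)=\arccos(\max\{-1,\min\{1,\phi_{ij}(l^+)\}\})$, where, with $c_{ab}=\cosh l_{ab}$, $\phi_{ij}=\frac{c_{ij}(c_{ik}c_{jh}+c_{jk}c_{ih})+c_{jk}c_{jh}+c_{ik}c_{ih}+c_{kh}-c_{ij}^2c_{kh}}{\sqrt{D_{ijk}D_{ijh}}}$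 and $D_{abc}=2c_{ab}c_{bc}c_{ac}+c_{ab}^2+c_{bc}^2+c_{ac}^2-1$.) For $l\in\mathbb{R}^E$ (a generalized hyper-ideal polyhedral metric), the generalized combinatorial Ricci curvature at $e\in E$ is $\widetilde{K}_e(l)=2\pi-\sum\widetilde{a}_{ij}(l_\sigma)$, summed over all edges $\{ij\}$ of tetrahedra $\sigma\in T$ identified to $e$. It extends $K_e$ continuously to $\mathbb{R}^E$. The flow $\frac{dl_e}{dt}=\widetilde K_e(l)$ on $\mathbb{R}^E$ has, for each initial value, a unique solution on $[0,+\infty)$; for initial value in $\mathcal{L}(M,\mathcal{T})$ it extends the solution of the combinatorial Ricci flow and is called the extended solution. *)

(* Defs.v *)
From HB Require Import structures.
From mathcomp Require Import all_boot all_order all_fingroup all_algebra.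
From mathcomp Require Import all_classical all_reals all_analysis.

Set Implicit Arguments.
Unset Strict Implicit.
Unset Printing Implicit Defensive.

Import Order.TTheory GRing.Theory Num.Theory.
Import numFieldNormedType.Exports.

Local Open Scope ring_scope.

(* The six edges of a tetrahedron with vertices 'I_4 are its 2-subsets;
   a six-tuple of reals is a function tet_edge -> R. *)
Record tet_edge : Type := TetEdge {
  tet_edge_set : {set 'I_4};
  _ : #|tet_edge_set| == 2%N
}.
HB.instance Definition _ := [isSub for tet_edge_set].
HB.instance Definition _ := [Finite of tet_edge by <:].

Lemma tet_edge0_proof : #|[set ord0; ord_max : 'I_4]%SET| == 2%N.
Proof. by rewrite cards2. Qed.

(* The edge {i, j}; the default value for i = j is never used. *)
Definition te (i j : 'I_4) : tet_edge :=
  insubd (TetEdge tet_edge0_proof) [set i; j]%SET.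

(* With A = {i, j}: endpt A 0 and endpt A 1 are i and j in increasing order,
   and endpt (~: A) 0, endpt (~: A) 1 are the two remaining vertices. *)
Definition endpt (A : {set 'I_4}) (m : nat) : 'I_4 := nth ord0 (enum A) m.

Section HyperbolicGeometry.
Context {R : realType}.
Implicit Types (x y : 'rV[R]_4) (l : tet_edge -> R).

Definition cosh (x : R) : R := (expR x + expR (- x)) / 2.

Definition arcosh (u : R) : R := ln (u + Num.sqrt (u ^+ 2 - 1)).

(* The hyperboloid model of H^3 in Minkowski space R^{1,3}. *)
Definition mink x y : R :=
  - (x ord0 ord0 * y ord0 ord0)
  + \sum_(a < 3) x ord0 (lift ord0 a) * y ord0 (lift ord0 a).

Definition in_H3 x : Prop := mink x x = -1 /\ 0 < x ord0 ord0.

Definition hdist x y : R := arcosh (- mink x y).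

(* A hyper-ideal tetrahedron is the convex hull in H^3 of its twelve vertices
   tet_vtx i j (i != j), where tet_vtx i j is the endpoint on the triangle
   Delta_i of the edge joining Delta_i to Delta_j (tet_vtx i i is junk).
   tri_nrm i is the outer unit normal of the plane of Delta_i, and hex_nrm k
   the one of the plane of the hexagon H_k opposite to Delta_k. The incidences
   below say that the eight planes support the polyhedron exactly along the
   faces of a truncated tetrahedron:
     Delta_i has the vertices tet_vtx i j, j != i, and
     H_k has the six vertices tet_vtx i j with i, j != k.
   An edge with end on Delta_i lies on two planes orthogonal to Delta_i, so it
   is orthogonal to Delta_i: the hexagons are right-angled. *)
Record hyperideal_tet : Type := HyperidealTet {
  tet_vtx : 'I_4 -> 'I_4 -> 'rV[R]_4;
  tri_nrm : 'I_4 -> 'rV[R]_4;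
  hex_nrm : 'I_4 -> 'rV[R]_4;
  tet_vtx_H3 : forall i j, i != j -> in_H3 (tet_vtx i j);
  tri_nrm_unit : forall i, mink (tri_nrm i) (tri_nrm i) = 1;
  hex_nrm_unit : forall k, mink (hex_nrm k) (hex_nrm k) = 1;
  tri_on : forall i j, i != j -> mink (tri_nrm i) (tet_vtx i j) = 0;
  tri_off : forall i i' j, i' != j -> i' != i ->
    mink (tri_nrm i) (tet_vtx i' j) < 0;
  hex_on : forall k i j, i != j -> i != k -> j != k ->
    mink (hex_nrm k) (tet_vtx i j) = 0;
  hex_off : forall k i j, i != j -> (i == k) || (j == k) ->
    mink (hex_nrm k) (tet_vtx i j) < 0;
  tri_hex_orthogonal : forall i k, i != k ->
    mink (tri_nrm i) (hex_nrm k) = 0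
}.

Definition tet_length (P : hyperideal_tet) (A : tet_edge) : R :=
  let i := endpt (tet_edge_set A) 0 in let j := endpt (tet_edge_set A) 1 in
  hdist (tet_vtx P i j) (tet_vtx P j i).

(* The edge {i, j} is the intersection of H_k and H_h, {i, j, k, h} = 'I_4;
   for outer unit normals, the interior angle a has cos a = - <n_k, n_h>. *)
Definition tet_angle (P : hyperideal_tet) (A : tet_edge) : R :=
  acos (- mink (hex_nrm P (endpt (~: tet_edge_set A) 0))
               (hex_nrm P (endpt (~: tet_edge_set A) 1))).

(* The set calligraphic L of edge lengths of hyper-ideal tetrahedra. *)
Definition hyperideal_lengths l : Prop :=
  exists P : hyperideal_tet, forall A, tet_length P A = l A.

(* The dihedral angle a_ij as a function of the edge lengths. The set below is
   a singleton when hyperideal_lengths l, since edge lengths determine the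
   tetrahedron up to isometry; off that set the value is junk. *)
Definition dihedral_angle l (A : tet_edge) : R :=
  xget 0 [set a : R | exists P : hyperideal_tet,
    (forall B, tet_length P B = l B) /\ a = tet_angle P A]%classic.

Definition hexD (c : tet_edge -> R) (a b d : 'I_4) : R :=
  2 * c (te a b) * c (te b d) * c (te a d)
  + c (te a b) ^+ 2 + c (te b d) ^+ 2 + c (te a d) ^+ 2 - 1.

(* phi_ij as a function of the hyperbolic cosines c of the edge lengths; on
   positive lengths it is the cosine law applied to the angles x^i_jk, with
   denominators cleared so that it also makes sense at zero lengths. *)
Definition phi (c : tet_edge -> R) (i j k h : 'I_4) : R :=
  (c (te i j) * (c (te i k) * c (te j h) + c (te j k) * c (te i h))
   + c (te j k) * c (te j h) + c (te i k) * c (te i h)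
   + c (te k h) - c (te i j) ^+ 2 * c (te k h))
  / Num.sqrt (hexD c i j k * hexD c i j h).

(* The continuous extension of the dihedral angle to all of R^6. *)
Definition ext_angle l (A : tet_edge) : R :=
  let c := fun B => cosh (Num.max 0 (l B)) in
  acos (Num.max (-1) (Num.min 1
    (phi c (endpt (tet_edge_set A) 0) (endpt (tet_edge_set A) 1)
           (endpt (~: tet_edge_set A) 0) (endpt (~: tet_edge_set A) 1)))).

End HyperbolicGeometry.

Arguments hyperideal_tet : clear implicits.

(* Face k of a tetrahedron is the hexagon opposite to vertex k. Face k of s is
   glued to a face of nbr s k by the map that sends vertex i to vmap s k i
   for i != k; vmap s k k is the number of the target face. *)
Record gluing (T : finType) : Type := Gluing {
  nbr : T -> 'I_4 -> T;
  vmap : T -> 'I_4 -> {perm 'I_4}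
}.

Section Gluing.
Context {T : finType} (G : gluing T).

(* (s, i, j) with i != j stands for the edge {i, j} of s oriented from i to j;
   equivalently, for its endpoint on Delta_i, a corner of the triangle (s, i).
   Both are preserved by the gluings across the two faces containing {i, j}. *)
Definition corner_rel : rel (T * 'I_4 * 'I_4) := fun x y =>
  let: (s, i, j) := x in
  [exists k : 'I_4, [&& k != i, k != j &
    y == (nbr G s k, vmap G s k i, vmap G s k j)]].

(* (s, i, k) with i != k stands for the side of the triangle (s, i) that lies
   on face k. *)
Definition side_rel : rel (T * 'I_4 * 'I_4) := fun x y =>
  let: (s, i, k) := x in y == (nbr G s k, vmap G s k i, vmap G s k k).

(* (s, i) is the vertex triangle Delta_i of s. *)
Definition tri_rel : rel (T * 'I_4) := fun x y =>
  let: (s, i) := x in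
  [exists k : 'I_4, (k != i) && (y == (nbr G s k, vmap G s k i))].

Definition edge_rel : rel (T * tet_edge) := fun x y =>
  [exists k : 'I_4, [&& k \notin tet_edge_set x.2, y.1 == nbr G x.1 k &
    tet_edge_set y.2 == [set vmap G x.1 k i | i in tet_edge_set x.2]%SET]].

(* The gluing is a fixed-point free involution on the set of all faces. The
   quotient is a 3-manifold with boundary iff no edge is identified with itself
   with reversed orientation (otherwise its midpoint has a projective plane as
   link). The boundary is nonempty iff T is. *)
Definition ideal_triangulation : Prop :=
  [/\ (0 < #|T|)%N,
      forall s k, nbr G (nbr G s k) (vmap G s k k) = s,
      forall s k i, vmap G (nbr G s k) (vmap G s k k) (vmap G s k i) = i,
      forall s k, (nbr G s k, vmap G s k k) != (s, k) &
      forall s i j, i != j -> ~~ connect corner_rel (s, i, j) (s, j, i)].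

Definition boundary_component (C : {set T * 'I_4}) : Prop :=
  C \in equivalence_partition (connect tri_rel) [set: T * 'I_4]%SET.

Definition distinct_pairs : {set T * 'I_4 * 'I_4} := [set x | x.1.2 != x.2]%SET.

Definition classes_on (r : rel (T * 'I_4 * 'I_4)) (C : {set T * 'I_4}) : nat :=
  #|[set B in equivalence_partition (connect r) distinct_pairs |
      [exists x in B, x.1 \in C]]%SET|.

(* Vertices minus sides plus triangles, after identifications. *)
Definition euler_char (C : {set T * 'I_4}) : int :=
  (classes_on corner_rel C)%:Z - (classes_on side_rel C)%:Z + #|C|%:Z.

Record edge : Type := Edge {
  edge_class : {set T * tet_edge};
  _ : edge_class \in
      equivalence_partition (connect edge_rel) [set: T * tet_edge]%SET
}.
HB.instance Definition _ := [isSub for edge_class].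
HB.instance Definition _ := [Finite of edge by <:].

Lemma edge_of_proof (x : T * tet_edge) :
  [set y in [set: T * tet_edge] | connect edge_rel x y]%SET
    \in equivalence_partition (connect edge_rel) [set: T * tet_edge]%SET.
Proof. by apply: imset_f; rewrite inE. Qed.

Definition edge_of (x : T * tet_edge) : edge := Edge (edge_of_proof x).

Definition edge_degree (e : edge) : nat := #|edge_class e|.

Context {R : realType}.
Implicit Types l : edge -> R.

Definition lengths_on l (s : T) : tet_edge -> R := fun A => l (edge_of (s, A)).

Definition hyperideal_metric l : Prop :=
  (forall e, 0 < l e) /\ forall s, hyperideal_lengths (lengths_on l s).

Definition curvature l (e : edge) : R :=
  2 * pi - \sum_(x in edge_class e) dihedral_angle (lengths_on l x.1) x.2.

Definition ext_curvature l (e : edge) : R :=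
  2 * pi - \sum_(x in edge_class e) ext_angle (lengths_on l x.1) x.2.

(* l is a solution on [0, +oo[; the difference quotient is restricted to times
   in [0, +oo[, so at t = 0 this is the right derivative. *)
Definition extended_flow (l : R -> edge -> R) : Prop :=
  forall (t : R) (e : edge), 0 <= t ->
    (h^-1 * (l (t + h) e - l t e)
       @[h --> within [set h : R | 0 <= t + h]%classic (dnbhs (0 : R))]
       --> ext_curvature (l t) e)%classic.

Definition edge_norm l : R := Num.sqrt (\sum_(e : edge) l e ^+ 2).

End Gluing.

Arguments edge {T} G.

(* Main.v *)
(* (1) The three dihedral angles at a vertex are the angles of a hyperbolic
   triangle, so the six angles of a tetrahedron add up to less than 2 pi. If all
   curvatures vanish, summing over the edges gives |E| < |T|, whereas
   d_e <= 6 gives 6 |T| = sum_e d_e <= 6 |E|.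

   (2) The constant metric for which every tetrahedron is regular with angle
   th = 2 pi / N < pi / 3 has zero curvature; let L be its edge length. With
   E = sum_e (l_e - L)^2, along the flow E'/2 is minus the sum over the
   tetrahedra of F(l) = sum_ij (a_ij(l) - th) (l_ij - L), so it suffices to show
   F(l) >= c |l - L|^2 on bounded sets.
   The lengths are explicit functions of the angles on the convex set of angles
   with sum < pi at each vertex. The Jacobian of this map is symmetric and
   nonsingular, and it is positive definite at regular tetrahedra, hence
   everywhere. Integrating it along segments in the space of angles gives
   sum (a_ij(l) - a_ij(l')) (l_ij - l'_ij) >= 0 for hyper-ideal l, l', and the
   strong inequality near L. As the extended angles are locally constant outside
   of the set of hyper-ideal lengths, sum_ij a_ij (l_ij - L) is nondecreasing
   along each ray from L through nonnegative lengths, which propagates the strong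
   inequality from a neighbourhood of L to bounded sets. *)

(* The set of hyper-ideal lengths is not known here to be convex, so two of its points cannot be
   joined inside it; the angle domain is cut out by linear inequalities, which is why the
   integration is over angles. On a ray the hyper-ideal parameters may form many intervals. Each
   such point is compared with the start directly, through angles, so local constancy is needed only
   beyond the supremum of these parameters. The Jacobian is nonsingular because a velocity that
   fixes the lengths fixes the normalized adjugate of the Gram matrix of the angles to first order,
   hence the matrix itself. Positivity is obtained in angles, while the strong inequality concerns
   lengths; an upper bound on the Jacobian near the regular point converts one into the other,
   without differentiating angles with respect to lengths. Negative lengths bring a separate gain:
   their angle is 0, at distance th from the target. The constant c depends on the size of the
   bounded set, so the flow must first be known to be bounded; this follows from F >= 0 alone. *)
Require Import Defs.
From mathcomp Require Import all_boot all_order all_fingroup all_algebra.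
From mathcomp Require Import all_classical all_reals all_analysis.
From mathcomp Require Import ring lra.
Set Implicit Arguments.
Unset Strict Implicit.
Unset Printing Implicit Defensive.
Import Order.TTheory GRing.Theory Num.Theory.
Import numFieldNormedType.Exports.
Local Open Scope ring_scope.

(** * Cofactors of a 4 x 4 Gram matrix *)

(* Six quantities attached to the edges of a tetrahedron i j k h are always
   listed in the order C = ij, p = ik, p' = ih, q = jk, q' = jh, t = kh. Let H be
   the symmetric matrix with diagonal 1 and H_ij = - t, H_ik = - q', and so on
   (each entry is minus the quantity at the opposite edge). Then [dt] is the
   determinant of H, [nf] its (i, j) cofactor, and [- hD C p p'] its (i, i)
   cofactor. For H_ij = - C, H_ik = - p, and so on, [dtd] is the determinant and
   [nfd] the (k, h) cofactor. *)
Section Alg.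
Context {R : comNzRingType}.
Implicit Types C p q t x y z : R.

Definition hD x y z := 2 * x * y * z + x ^+ 2 + y ^+ 2 + z ^+ 2 - 1.
Definition nf C p p' q q' t :=
  C * (p * q' + p' * q) + p * q + p' * q' + t * (1 - C ^+ 2).
Definition dt C p p' q q' t :=
  1 - (C ^+ 2 + p ^+ 2 + p' ^+ 2 + q ^+ 2 + q' ^+ 2 + t ^+ 2)
  - 2 * (C * p * p' + C * q * q' + p * q * t + p' * q' * t)
  + (C * t) ^+ 2 + (p * q') ^+ 2 + (p' * q) ^+ 2
  - 2 * (p * q' * p' * q + C * t * p' * q + C * t * p * q').
Definition nfd C p p' q q' t := nf C p q p' q' t.
Definition dtd C p p' q q' t := dt C p q p' q' t.

(** Jacobi's identity for the 2 x 2 minor of the adjugate of H on rows i, j: it is the determinant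
    times the complementary minor, which is [1 - C ^+ 2] because H_kh = - C. *)
Lemma nf_sqr C p p' q q' t :
  nf C p p' q q' t ^+ 2 - hD C p p' * hD C q q'
  = - dt C p p' q q' t * (1 - C ^+ 2).
Proof. rewrite /nf /hD /dt; ring. Qed.

Lemma nf_adj C p p' q q' t :
  (C * q' + q) * hD C p p' - nf C p p' q q' t * (C * p' + p)
  = - (1 - C ^+ 2) * nf p' C p q' t q.
Proof. rewrite /nf /hD /dt; ring. Qed.

(** Jacobi's identity for 3 x 3 minors of the adjugate: [dtd ^+ 2] times the complementary entry of
    the Gram matrix, here a diagonal entry 1. [dual_nf] is the case of an off-diagonal entry,
    [dual_pos] that of a 2 x 2 minor. They lead from the angles back to the lengths. *)
Lemma dual_hD C p p' q q' t :
 let Mij := nfd C p p' q q' t in let Mik := nfd p C p' q t q' in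
 let Mih := nfd p' C p q' t q in
 let dh := hD C p q in let dk := hD C p' q' in
 let dj := hD p p' t in
 2 * Mij * Mik * Mih + Mij ^+ 2 * dj + Mik ^+ 2 * dk + Mih ^+ 2 * dh - dj * dk * dh
 = dtd C p p' q q' t ^+ 2.
Proof. rewrite /nfd /dtd /nf /hD /dt; ring. Qed.

Lemma dual_nf C p p' q q' t :
 let Mij := nfd C p p' q q' t in let Mik := nfd p C p' q t q' in
 let Mih := nfd p' C p q' t q in let Mjk := nfd q C q' p t p' in
 let Mjh := nfd q' C q p' t p in let Mkh := nfd t p q p' q' C in
 let dh := hD C p q in let dk := hD C p' q' in
 Mij * (Mik * Mjh + Mih * Mjk) + dk * Mik * Mjk + dh * Mih * Mjh
   + Mkh * (dk * dh - Mij ^+ 2)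
 = dtd C p p' q q' t ^+ 2 * C.
Proof. rewrite /nfd /dtd /nf /hD /dt; ring. Qed.

Lemma dual_pos C p p' q q' t :
  nfd p' C p q' t q * hD C p q + nfd C p p' q q' t * nfd p C p' q t q'
  = - dtd C p p' q q' t * (C * p + q).
Proof. rewrite /nfd /dtd /nf /hD /dt; ring. Qed.

Lemma hDC x y z : hD x y z = hD y x z. Proof. rewrite /hD; ring. Qed.
Lemma hDCA x y z : hD x y z = hD y z x. Proof. rewrite /hD; ring. Qed.

(** Directional derivative of [nf] in the direction [eC], ..., [et]; likewise [dhD] for [hD] and
    [ddt] for [dt]. *)
Definition dnf C p p' q q' t eC ep ep' eq eq' et :=
  eC * (p * q' + p' * q - 2 * C * t) + ep * (C * q' + q) + ep' * (C * q + q')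
  + eq * (C * p' + p) + eq' * (C * p + p') + et * (1 - C ^+ 2).
Definition dhD x y z ex ey ez :=
  2 * (ex * (y * z + x) + ey * (x * z + y) + ez * (x * y + z)).
Definition ddt C p p' q q' t eC ep ep' eq eq' et :=
  - 2 * (C * eC + p * ep + p' * ep' + q * eq + q' * eq' + t * et)
  - 2 * (eC * p * p' + C * ep * p' + C * p * ep'
       + eC * q * q' + C * eq * q' + C * q * eq'
       + ep * q * t + p * eq * t + p * q * et
       + ep' * q' * t + p' * eq' * t + p' * q' * et)
  + 2 * (C * t * (eC * t + C * et) + p * q' * (ep * q' + p * eq')
       + p' * q * (ep' * q + p' * eq))
  - 2 * ((ep * q' + p * eq') * (p' * q) + (p * q') * (ep' * q + p' * eq)
       + (eC * t + C * et) * (p' * q + p * q')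
       + (C * t) * (ep' * q + p' * eq + ep * q' + p * eq')).

(* Entries of the product H X H, for a symmetric matrix X with diagonal
   [Xi, Xj, Xk, Xh], where H is the Gram matrix with H_ij = - y_kh. *)
Definition cong_diag C p p' q q' t Xi Xj Xk Xh Xij Xik Xih Xjk Xjh Xkh :=
  Xi + t ^+ 2 * Xj + q' ^+ 2 * Xk + q ^+ 2 * Xh
  - 2 * t * Xij - 2 * q' * Xik - 2 * q * Xih + 2 * t * q' * Xjk
  + 2 * t * q * Xjh + 2 * q' * q * Xkh.
Definition cong_diag_j C p p' q q' t Xi Xj Xk Xh Xij Xik Xih Xjk Xjh Xkh :=
  Xj + t ^+ 2 * Xi + p' ^+ 2 * Xk + p ^+ 2 * Xh
  - 2 * t * Xij - 2 * p' * Xjk - 2 * p * Xjh + 2 * t * p' * Xik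
  + 2 * t * p * Xih + 2 * p' * p * Xkh.
Definition cong_off C p p' q q' t Xi Xj Xk Xh Xij Xik Xih Xjk Xjh Xkh :=
  (- t * Xi + Xij - p' * Xik - p * Xih)
  - t * (- t * Xij + Xj - p' * Xjk - p * Xjh)
  - q' * (- t * Xik + Xjk - p' * Xk - p * Xkh)
  - q * (- t * Xih + Xjh - p' * Xkh - p * Xh).

Section Ker.
Variables (C p p' q q' t eC ep ep' eq eq' et : R).
Let Nij := nf C p p' q q' t.
Let Nik := nf p C p' q t q'.
Let Nih := nf p' C p q' t q.
Let Njk := nf q C q' p t p'.
Let Njh := nf q' C q p' t p.
Let Nkh := nf t p q p' q' C.
Let Di := hD C p p'.
Let Dj := hD C q q'.
Let Dk := hD p q t.
Let Dh := hD p' q' t.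
Let dNij := dnf C p p' q q' t eC ep ep' eq eq' et.
Let dNik := dnf p C p' q t q' ep eC ep' eq et eq'.
Let dNih := dnf p' C p q' t q ep' eC ep eq' et eq.
Let dNjk := dnf q C q' p t p' eq eC eq' ep et ep'.
Let dNjh := dnf q' C q p' t p eq' eC eq ep' et ep.
Let dNkh := dnf t p q p' q' C et ep eq ep' eq' eC.
Let dDi := dhD C p p' eC ep ep'.
Let dDj := dhD C q q' eC eq eq'.
Let dDk := dhD p q t ep eq et.
Let dDh := dhD p' q' t ep' eq' et.

(** Let A be the adjugate of H. Differentiating H A = det I gives H (dA) H = (d det) H - det (dH).
    The diagonal of the right side is d det, and its (i, j) entry, where H_ij = - t, is the one in
    [dcong_off]. *)
Lemma dcong_diag :
  cong_diag C p p' q q' t (-dDi) (-dDj) (-dDk) (-dDh) dNij dNik dNih dNjk dNjh dNkh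
  = ddt C p p' q q' t eC ep ep' eq eq' et.
Proof.
rewrite /cong_diag /dNij /dNik /dNih /dNjk /dNjh /dNkh /dDi /dDj /dDk /dDh.
rewrite /dnf /dhD /ddt; ring.
Qed.

Lemma dcong_diag_j :
  cong_diag_j C p p' q q' t (-dDi) (-dDj) (-dDk) (-dDh) dNij dNik dNih dNjk dNjh dNkh
  = ddt C p p' q q' t eC ep ep' eq eq' et.
Proof.
rewrite /cong_diag_j /dNij /dNik /dNih /dNjk /dNjh /dNkh /dDi /dDj /dDk /dDh.
rewrite /dnf /dhD /ddt; ring.
Qed.

Lemma dcong_off :
  cong_off C p p' q q' t (-dDi) (-dDj) (-dDk) (-dDh) dNij dNik dNih dNjk dNjh dNkh
  = - t * ddt C p p' q q' t eC ep ep' eq eq' et + et * dt C p p' q q' t.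
Proof.
rewrite /cong_off /dNij /dNik /dNih /dNjk /dNjh /dNkh /dDi /dDj /dDk /dDh.
rewrite /dnf /dhD /ddt /dt; ring.
Qed.

Variables (ri rj rk rh : R).
(* [ri] stands for half the logarithmic derivative of [Di], etc. *)
Let Xij := (ri + rj) * Nij.
Let Xik := (ri + rk) * Nik.
Let Xih := (ri + rh) * Nih.
Let Xjk := (rj + rk) * Njk.
Let Xjh := (rj + rh) * Njh.
Let Xkh := (rk + rh) * Nkh.

(** With D the diagonal matrix of the r's, X = D A + A D satisfies H X H = det (H D + D H), since H
    A = A H = det I. *)
Lemma rcong_diag :
  cong_diag C p p' q q' t (- (2 * ri * Di)) (- (2 * rj * Dj)) (- (2 * rk * Dk))
     (- (2 * rh * Dh)) Xij Xik Xih Xjk Xjh Xkh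
  = 2 * ri * dt C p p' q q' t.
Proof.
rewrite /cong_diag /Xij /Xik /Xih /Xjk /Xjh /Xkh.
rewrite /Nij /Nik /Nih /Njk /Njh /Nkh /Di /Dj /Dk /Dh /nf /hD /dt.
ring.
Qed.

Lemma rcong_diag_j :
  cong_diag_j C p p' q q' t (- (2 * ri * Di)) (- (2 * rj * Dj)) (- (2 * rk * Dk))
     (- (2 * rh * Dh)) Xij Xik Xih Xjk Xjh Xkh
  = 2 * rj * dt C p p' q q' t.
Proof.
rewrite /cong_diag_j /Xij /Xik /Xih /Xjk /Xjh /Xkh.
rewrite /Nij /Nik /Nih /Njk /Njh /Nkh /Di /Dj /Dk /Dh /nf /hD /dt.
ring.
Qed.

Lemma rcong_off :
  cong_off C p p' q q' t (- (2 * ri * Di)) (- (2 * rj * Dj)) (- (2 * rk * Dk))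
     (- (2 * rh * Dh)) Xij Xik Xih Xjk Xjh Xkh
  = - t * (ri + rj) * dt C p p' q q' t.
Proof.
rewrite /cong_off /Xij /Xik /Xih /Xjk /Xjh /Xkh.
rewrite /Nij /Nik /Nih /Njk /Njh /Nkh /Di /Dj /Dk /Dh /nf /hD /dt.
ring.
Qed.

Hypothesis (Eij : dNij = Xij) (Eik : dNik = Xik) (Eih : dNih = Xih)
  (Ejk : dNjk = Xjk) (Ejh : dNjh = Xjh) (Ekh : dNkh = Xkh).
Hypothesis (Ei : dDi = 2 * ri * Di) (Ej : dDj = 2 * rj * Dj)
  (Ek : dDk = 2 * rk * Dk) (Eh : dDh = 2 * rh * Dh).

(** The hypotheses say dA = D A + A D, so the two expressions for H X H agree entry by entry. *)
Lemma kernel_diag : ddt C p p' q q' t eC ep ep' eq eq' et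
  = 2 * ri * dt C p p' q q' t.
Proof.
by rewrite -rcong_diag -dcong_diag Eij Eik Eih Ejk Ejh Ekh Ei Ej Ek Eh.
Qed.

Lemma kernel_diag_j : ddt C p p' q q' t eC ep ep' eq eq' et
  = 2 * rj * dt C p p' q q' t.
Proof.
by rewrite -rcong_diag_j -dcong_diag_j Eij Eik Eih Ejk Ejh Ekh Ei Ej Ek Eh.
Qed.

Lemma kernel_off : - t * ddt C p p' q q' t eC ep ep' eq eq' et + et * dt C p p' q q' t
  = - t * (ri + rj) * dt C p p' q q' t.
Proof.
by rewrite -rcong_off -dcong_off Eij Eik Eih Ejk Ejh Ekh Ei Ej Ek Eh.
Qed.
End Ker.

End Alg.

(** * Edges of a tetrahedron *)

Definition v0 : 'I_4 := ord0.
Definition v1 : 'I_4 := lift ord0 ord0.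
Definition v2 : 'I_4 := lift ord0 (lift ord0 ord0).
Definition v3 : 'I_4 := ord_max.

Lemma enum_I4 : enum 'I_4 = [:: v0; v1; v2; v3].
Proof.
apply: (inj_map val_inj); rewrite val_enum_ord.
by [].
Qed.

Lemma I4P (P : 'I_4 -> Prop) : P v0 -> P v1 -> P v2 -> P v3 -> forall i, P i.
Proof.
move=> p0 p1 p2 p3 i; have : i \in enum 'I_4 by rewrite mem_enum.
by rewrite enum_I4 !inE => /or4P[] /eqP ->.
Qed.

Notation e01 := (te v0 v1).
Notation e02 := (te v0 v2).
Notation e03 := (te v0 v3).
Notation e12 := (te v1 v2).
Notation e13 := (te v1 v3).
Notation e23 := (te v2 v3).

Lemma teC i j : te i j = te j i.
Proof. by congr (insubd _ _); exact: finset.setUC. Qed.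

Lemma te_set i j : i != j -> tet_edge_set (te i j) = [set i; j]%SET.
Proof.
move=> ij; have := val_insubd (TetEdge tet_edge0_proof) [set i; j]%SET.
by rewrite cards2 ij.
Qed.

Lemma tet_edgeP (A : tet_edge) : exists i j, i != j /\ A = te i j.
Proof.
case: A => S hS; have /cards2P[x [y [xy SE]]] := hS.
by exists x, y; split => //; apply: val_inj; rewrite /= te_set.
Qed.

Lemma tet_edge_ind (P : tet_edge -> Prop) :
  P e01 -> P e02 -> P e03 -> P e12 -> P e13 -> P e23 -> forall A, P A.
Proof.
move=> ? ? ? ? ? ? A; have [i [j [ij ->]]] := tet_edgeP A.
move: i j ij; apply: I4P; apply: I4P => //= _; by [|rewrite teC].
Qed.

Lemma endpt_te (i j : 'I_4) : (i < j)%N ->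
  endpt (tet_edge_set (te i j)) 0 = i /\ endpt (tet_edge_set (te i j)) 1 = j.
Proof.
move=> ij; rewrite te_set; last by apply: contraTneq ij => ->; rewrite ltnn.
rewrite /endpt /enum_mem -enumT /= enum_I4 /=.
move: i j ij; apply: I4P; apply: I4P => //= _; rewrite !inE /=; by split.
Qed.

Lemma endptC_te (i j k h : 'I_4) : uniq [:: i; j; k; h] -> (k < h)%N ->
  endpt (~: tet_edge_set (te i j)) 0 = k /\ endpt (~: tet_edge_set (te i j)) 1 = h.
Proof.
rewrite /= !inE !negb_or => /and4P[/and3P[ij ik ih] /andP[jk jh] kh _] klh.
rewrite te_set // /endpt.
have -> : enum (~: [set i; j])%SET = enum [set k; h]%SET.
  apply: eq_enum => x; rewrite !inE negb_or.
  apply/idP/idP; last first.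
    by case/orP => /eqP ->; rewrite ![_ == i]eq_sym ![_ == j]eq_sym ?ik ?jk ?ih ?jh.
  clear klh; move: i j k h x ij ik ih jk jh kh.
  by do 5! apply: I4P.
by have := @endpt_te k h klh; rewrite te_set.
Qed.

Lemma sum_tet_edge (V : nmodType) (F : tet_edge -> V) :
  \sum_A F A = F e01 + F e02 + F e03 + F e12 + F e13 + F e23.
Proof.
have u : uniq [:: e01; e02; e03; e12; e13; e23].
  rewrite -(map_inj_uniq val_inj) /=.
  rewrite !te_set // /= !inE.
  by rewrite !finset.eqEsubset !finset.subUset !finset.sub1set !inE.
rewrite (perm_big [:: e01; e02; e03; e12; e13; e23]).
  by rewrite !big_cons big_nil /= addr0 !addrA.
apply: uniq_perm => //; first by rewrite index_enum_uniq.
move=> A; rewrite mem_index_enum; symmetry.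
by move: A; apply: tet_edge_ind; rewrite !inE eqxx ?orbT.
Qed.

(* [onQ F y A] applies F to the values of y at the six edges of the tetrahedron,
   in the order ij, ik, ih, jk, jh, kh with A = ij. *)
Section Quad.
Context {R X : Type}.
Definition onQ (F : R -> R -> R -> R -> R -> R -> X) (y : tet_edge -> R)
    (A : tet_edge) : X :=
  let i := endpt (tet_edge_set A) 0 in let j := endpt (tet_edge_set A) 1 in
  let k := endpt (~: tet_edge_set A) 0 in let h := endpt (~: tet_edge_set A) 1 in
  F (y (te i j)) (y (te i k)) (y (te i h)) (y (te j k)) (y (te j h)) (y (te k h)).

Lemma onQ_te F y (i j k h : 'I_4) : uniq [:: i; j; k; h] -> (i < j)%N -> (k < h)%N ->
  onQ F y (te i j) =
  F (y (te i j)) (y (te i k)) (y (te i h)) (y (te j k)) (y (te j h)) (y (te k h)).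
Proof.
move=> u ij kh; rewrite /onQ.
by have [-> ->] := endpt_te ij; have [-> ->] := endptC_te u kh.
Qed.

Lemma onQ01 F y : onQ F y e01 = F (y e01) (y e02) (y e03) (y e12) (y e13) (y e23).
Proof. by rewrite (@onQ_te _ _ _ _ v2 v3). Qed.
Lemma onQ02 F y : onQ F y e02 = F (y e02) (y e01) (y e03) (y e12) (y e23) (y e13).
Proof. by rewrite (@onQ_te _ _ _ _ v1 v3) // (teC v2 v1). Qed.
Lemma onQ03 F y : onQ F y e03 = F (y e03) (y e01) (y e02) (y e13) (y e23) (y e12).
Proof. by rewrite (@onQ_te _ _ _ _ v1 v2) // (teC v3 v1) (teC v3 v2). Qed.
Lemma onQ12 F y : onQ F y e12 = F (y e12) (y e01) (y e13) (y e02) (y e23) (y e03).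
Proof. by rewrite (@onQ_te _ _ _ _ v0 v3) // (teC v1 v0) (teC v2 v0). Qed.
Lemma onQ13 F y : onQ F y e13 = F (y e13) (y e01) (y e12) (y e03) (y e23) (y e02).
Proof. by rewrite (@onQ_te _ _ _ _ v0 v2) // (teC v1 v0) (teC v3 v0) (teC v3 v2). Qed.
Lemma onQ23 F y : onQ F y e23 = F (y e23) (y e02) (y e12) (y e03) (y e13) (y e01).
Proof.
by rewrite (@onQ_te _ _ _ _ v0 v1) // (teC v2 v0) (teC v2 v1) (teC v3 v0) (teC v3 v1).
Qed.
Definition onQE := (onQ01, onQ02, onQ03, onQ12, onQ13, onQ23).
End Quad.

(** * Trigonometric inequalities for the angles *)

Section Trig.
Context {R : realType}.
Implicit Types a b c : R.

Lemma cos_ltE a b : 0 <= a <= pi -> 0 <= b <= pi -> (cos a < cos b) = (b < a).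
Proof. by move=> ha hb; rewrite ltr_cos ?in_itv. Qed.

Lemma sin_pos a : 0 < a -> a < pi -> 0 < sin a.
Proof. by move=> a0 a1; apply: sin_gt0_pi; rewrite a0. Qed.

Lemma cosD_gt a b c : 0 < a -> 0 < b -> 0 < c -> a + b + c < pi ->
  sin a * sin b < cos c + cos a * cos b.
Proof.
move=> a0 b0 c0 abc.
have : cos (pi - (a + b)) < cos c.
  rewrite cos_ltE; lra.
rewrite cosB cospi sinpi cosD; lra.
Qed.

(** The first inequality alone also allows c < a + b - pi, the second b < a + c - pi; both together
    would force a > pi. *)
Lemma cosD_gtP a b c : 0 < a < pi -> 0 < b < pi -> 0 < c < pi ->
  sin a * sin b < cos c + cos a * cos b ->
  sin a * sin c < cos b + cos a * cos c -> a + b + c < pi.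
Proof.
move=> /andP[a0 a1] /andP[b0 b1] /andP[c0 c1] Hc Hb.
have key x y : 0 < x < pi -> 0 < y < pi -> sin a * sin x < cos y + cos a * cos x ->
   a + x < pi /\ y < pi - (a + x) \/ pi <= a + x /\ y < a + x - pi.
  move=> /andP[x0 x1] /andP[y0 y1] H.
  have [ax|ax] := ltP (a + x) pi; [left|right]; split => //.
    rewrite -cos_ltE; [|lra|lra].
    rewrite cosB cospi sinpi cosD; lra.
  rewrite -cos_ltE; [|lra|lra].
  rewrite cosB cospi sinpi cosD; lra.
have [||//|[? ?]|[? ?]] := key b c; [exact/andP|exact/andP|lra|].
have [||//|[? ?]|[? ?]] := key c b; [exact/andP|exact/andP|lra|lra].
Qed.

Lemma sinS_cos a : sin a ^+ 2 = 1 - cos a ^+ 2.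
Proof. exact: sin2cos2. Qed.

Lemma hD_factor (x y z : R) : hD x y z = (x * y + z) ^+ 2 - (1 - x ^+ 2) * (1 - y ^+ 2).
Proof. rewrite /hD; ring. Qed.

Lemma hD_cos_gt0 a b c : 0 < a -> 0 < b -> 0 < c -> a + b + c < pi ->
  0 < hD (cos a) (cos b) (cos c).
Proof.
move=> a0 b0 c0 abc; have H := cosD_gt a0 b0 c0 abc.
have sa : 0 < sin a by apply: sin_pos; lra.
have sb : 0 < sin b by apply: sin_pos; lra.
have ss := mulr_gt0 sa sb.
rewrite hD_factor -!sinS_cos subr_gt0 -exprMn ltr_pXn2r ?nnegrE //; lra.
Qed.

Lemma nf_factor (C p p' q q' t : R) :
  nf C p p' q q' t = (C * p + p') * (C * q + q') + (1 - C ^+ 2) * (p * q + t).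
Proof. rewrite /nf; ring. Qed.

Section Six.
Variables (aC ap ap' aq aq' at_ : R).
Hypotheses (hC : 0 < aC) (hp : 0 < ap) (hp' : 0 < ap') (hq : 0 < aq) (hq' : 0 < aq')
  (ht : 0 < at_).
Hypotheses (hi : aC + ap + ap' < pi) (hj : aC + aq + aq' < pi)
  (hk : ap + aq + at_ < pi).

Lemma nf_cos_gt0 : 0 < nf (cos aC) (cos ap) (cos ap') (cos aq) (cos aq') (cos at_).
Proof.
move: (hC) (hp) (hp') (hq) (hq') (ht) (hi) (hj) (hk) => cC cp cp' cq cq' ct ci cj ck.
have sC : 0 < sin aC by apply: sin_pos; lra.
have sp : 0 < sin ap by apply: sin_pos; lra.
have sq : 0 < sin aq by apply: sin_pos; lra.
have H1 := cosD_gt hC hp hp' hi.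
have H2 := cosD_gt hC hq hq' hj.
have H3 := cosD_gt hp hq ht hk.
rewrite nf_factor -sinS_cos; apply: addr_gt0; apply: mulr_gt0.
- by apply: lt_trans (mulr_gt0 sC sp) _; lra.
- by apply: lt_trans (mulr_gt0 sC sq) _; lra.
- by rewrite exprn_gt0.
- by apply: lt_trans (mulr_gt0 sp sq) _; lra.
Qed.

(** By [nf_sqr], [- dt] times the squared sine is the square of [nf] minus a product of two [hD],
    and all three factor through the vertex inequalities. *)
Lemma dt_cos_lt0 : dt (cos aC) (cos ap) (cos ap') (cos aq) (cos aq') (cos at_) < 0.
Proof.
move: (hC) (hp) (hp') (hq) (hq') (ht) (hi) (hj) (hk) => cC cp cp' cq cq' ct ci cj ck.
have sC : 0 < sin aC by apply: sin_pos; lra.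
have sp : 0 < sin ap by apply: sin_pos; lra.
have sq : 0 < sin aq by apply: sin_pos; lra.
have H1 := cosD_gt hC hp hp' hi.
have H2 := cosD_gt hC hq hq' hj.
have H3 := cosD_gt hp hq ht hk.
have sC2 : 0 < sin aC ^+ 2 by rewrite exprn_gt0.
suff H : 0 < - dt (cos aC) (cos ap) (cos ap') (cos aq) (cos aq') (cos at_) * sin aC ^+ 2.
  by move: H; rewrite pmulr_lgt0 // oppr_gt0.
rewrite sinS_cos -nf_sqr nf_factor !hD_factor -!sinS_cos.
set A := cos aC * cos ap + cos ap'; set A' := cos aC * cos aq + cos aq'.
set S := sin aC ^+ 2; set b := sin ap; set b' := sin aq.
set m := cos ap * cos aq + cos at_.
have A0 : 0 < A by apply: lt_trans (mulr_gt0 sC sp) _; rewrite /A; lra.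
have A'0 : 0 < A' by apply: lt_trans (mulr_gt0 sC sq) _; rewrite /A'; lra.
have mb : b * b' < m by rewrite /m /b /b'; lra.
have bb : 0 < b * b' by apply: mulr_gt0.
have AA : 0 < A * A' by apply: mulr_gt0.
(* Replacing m by the smaller b b' turns the difference into S (A b' + A' b)^2. *)
apply: (@lt_le_trans _ _ ((A * A' + S * (b * b')) ^+ 2 - (A ^+ 2 - S * b ^+ 2) * (A' ^+ 2 - S * b' ^+ 2))).
  rewrite [ltRHS](_ : _ = S * (A * b' + A' * b) ^+ 2); last by ring.
  by rewrite mulr_gt0 // exprn_gt0 // addr_gt0 // mulr_gt0.
rewrite lerD2r ler_pXn2r ?nnegrE ?addr_ge0 ?mulr_ge0 ?ltW //.
  by rewrite ltrD2l ltr_pM2l.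
by apply: lt_trans mb.
Qed.
End Six.

End Trig.

(** * Duality between angles and lengths *)

(* Invariance under the exchanges of i and j, and of k and h. *)
Definition quad_sym {R X : Type} (F : R -> R -> R -> R -> R -> R -> X) :=
  forall C p p' q q' t,
    F C q q' p p' t = F C p p' q q' t /\ F C p' p q' q t = F C p p' q q' t.

(* The values at the six edges of a function of one edge and its position. *)
Definition relab {R X Y : Type} (H : X -> X -> X -> X -> X -> X -> Y)
  (F : R -> R -> R -> R -> R -> R -> X) C p p' q q' t :=
  H (F C p p' q q' t) (F p C p' q t q') (F p' C p q' t q)
    (F q C q' p t p') (F q' C q p' t p) (F t p q p' q' C).

Section Comp.
Lemma onQ_onQ {R X Y : Type} (H : X -> X -> X -> X -> X -> X -> Y)
  (F : R -> R -> R -> R -> R -> R -> X) y A : quad_sym F ->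
  onQ H (onQ F y) A = onQ (relab H F) y A.
Proof.
move=> sF.
have s1 C p p' q q' t : F C q q' p p' t = F C p p' q q' t by have [] := sF C p p' q q' t.
have s2 C p p' q q' t : F C p' p q' q t = F C p p' q q' t by have [] := sF C p p' q q' t.
have s3 C p p' q q' t : F C q' q p' p t = F C p p' q q' t by rewrite s1 s2.
by move: A; apply: tet_edge_ind; rewrite !onQE /relab; congr H;
  first [reflexivity | apply: s1 | apply: s2 | apply: s3].
Qed.

Context {R : Type}.
Lemma onQ_id (y : tet_edge -> R) A : onQ (fun C _ _ _ _ _ => C) y A = y A.
Proof. by move: A; apply: tet_edge_ind; rewrite onQE. Qed.
End Comp.

Section Dual.
Context {R : realType}.
Implicit Types (C p q t : R) (c y l a : tet_edge -> R).

(* [phd] turns the hyperbolic cosines of the lengths into the cosines of the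
   angles; [phr] is its inverse. *)
Definition phr C p p' q q' t := nf C p p' q q' t / Num.sqrt (hD C p p' * hD C q q').
Definition phd C p p' q q' t := phr C p q p' q' t.
Definition detv y := dt (y e01) (y e02) (y e03) (y e12) (y e13) (y e23).
Definition detl c := dtd (c e01) (c e02) (c e03) (c e12) (c e13) (c e23).

Lemma onQ_detv y A : onQ dt y A = detv y.
Proof.
by move: A; apply: tet_edge_ind; rewrite !onQE /detv /dt; ring.
Qed.

Lemma onQ_detl c A : onQ dtd c A = detl c.
Proof.
by move: A; apply: tet_edge_ind; rewrite !onQE /detl /dtd /dt; ring.
Qed.

Lemma phd_sym : quad_sym (@phd).
Proof.
move=> C p p' q q' t; rewrite /phd /phr; split; congr (_ / Num.sqrt _); rewrite /nf /hD; ring.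
Qed.

Lemma phi_phd c A :
  phi c (endpt (tet_edge_set A) 0) (endpt (tet_edge_set A) 1)
        (endpt (~: tet_edge_set A) 0) (endpt (~: tet_edge_set A) 1)
  = onQ phd c A.
Proof.
rewrite /phi /onQ /phd /phr /nf /hD /hexD.
congr (_ / Num.sqrt _); ring.
Qed.

Lemma hD_ge1 C p q : 1 <= C -> 1 <= p -> 1 <= q -> 4 <= hD C p q.
Proof.
move=> h1 h2 h3.
have Cp : 1 <= C * p by apply: mulr_ege1.
have Cpq : 1 <= C * p * q by apply: mulr_ege1.
have C2 : 1 <= C ^+ 2 by rewrite expr2 mulr_ege1.
have p2 : 1 <= p ^+ 2 by rewrite expr2 mulr_ege1.
have q2 : 1 <= q ^+ 2 by rewrite expr2 mulr_ege1.
rewrite /hD -!mulrA mulrA; lra.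
Qed.

Section Six.
Variables (C p p' q q' t : R).
Hypotheses (hC : 1 < C) (hp : 1 < p) (hp' : 1 < p') (hq : 1 < q) (hq' : 1 < q') (ht : 1 < t).
Let dh := hD C p q.
Let dk := hD C p' q'.
Let dj := hD p p' t.
Let di := hD q q' t.
Let Mij := nfd C p p' q q' t.
Let Mik := nfd p C p' q t q'.
Let Mih := nfd p' C p q' t q.
Let Mjk := nfd q C q' p t p'.
Let Mjh := nfd q' C q p' t p.
Let Mkh := nfd t p q p' q' C.

Let dh0 : 0 < dh. Proof. by apply: lt_le_trans (hD_ge1 _ _ _); rewrite ?ltW. Qed.
Let dk0 : 0 < dk. Proof. by apply: lt_le_trans (hD_ge1 _ _ _); rewrite ?ltW. Qed.
Let dj0 : 0 < dj. Proof. by apply: lt_le_trans (hD_ge1 _ _ _); rewrite ?ltW. Qed.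
Let di0 : 0 < di. Proof. by apply: lt_le_trans (hD_ge1 _ _ _); rewrite ?ltW. Qed.

Lemma phd_sqr : 1 - phd C p p' q q' t ^+ 2
  = - dtd C p p' q q' t * (C ^+ 2 - 1) / (dh * dk).
Proof.
rewrite /phd /phr expr_div_n sqr_sqrtr; last by rewrite mulr_ge0 ?ltW.
rewrite -/dh -/dk.
have := nf_sqr C p q p' q' t; rewrite -/dh -/dk /dtd.
set N := nf _ _ _ _ _ _; set D := dt _ _ _ _ _ _ => H.
have e : N ^+ 2 = dh * dk - D * (1 - C ^+ 2) by rewrite -mulNr -H; ring.
rewrite e; field; by rewrite !gt_eqF.
Qed.

(** By [phd_sqr] the criterion is a determinant common to the six edges, so all six angles
    degenerate at once. *)
Lemma phd_lt1 : (`|phd C p p' q q' t| < 1) = (dtd C p p' q q' t < 0).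
Proof.
rewrite -(@ltr_pXn2r _ 2) ?nnegrE // expr1n real_normK ?num_real //.
rewrite -[_ ^+ 2 < 1]subr_gt0 phd_sqr.
have dd : 0 < (dh * dk)^-1 by rewrite invr_gt0 mulr_gt0.
have cc : 0 < C ^+ 2 - 1 by rewrite subr_gt0 expr_gt1 // ltW // (lt_trans _ hC).
by rewrite (pmulr_lgt0 _ dd) (pmulr_lgt0 _ cc) oppr_gt0.
Qed.

Let rh := Num.sqrt dh. Let rk := Num.sqrt dk. Let rj := Num.sqrt dj. Let ri := Num.sqrt di.
Let rh0 : rh != 0. Proof. by rewrite gt_eqF // sqrtr_gt0. Qed.
Let rk0 : rk != 0. Proof. by rewrite gt_eqF // sqrtr_gt0. Qed.
Let rj0 : rj != 0. Proof. by rewrite gt_eqF // sqrtr_gt0. Qed.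
Let ri0 : ri != 0. Proof. by rewrite gt_eqF // sqrtr_gt0. Qed.
Let rhE : rh ^+ 2 = dh. Proof. by rewrite sqr_sqrtr // ltW. Qed.
Let rkE : rk ^+ 2 = dk. Proof. by rewrite sqr_sqrtr // ltW. Qed.
Let rjE : rj ^+ 2 = dj. Proof. by rewrite sqr_sqrtr // ltW. Qed.
Let riE : ri ^+ 2 = di. Proof. by rewrite sqr_sqrtr // ltW. Qed.

Let yij : phd C p p' q q' t = Mij / (rh * rk).
Proof. by rewrite /phd /phr sqrtrM ?ltW. Qed.
Let yik : phd p C p' q t q' = Mik / (rh * rj).
Proof. by rewrite /phd /phr -/(hD _ _ _) hDC sqrtrM ?ltW. Qed.
Let yih : phd p' C p q' t q = Mih / (rk * rj).
Proof. by rewrite /phd /phr (hDC p' C) (hDC p' p) sqrtrM ?ltW. Qed.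
Let yjk : phd q C q' p t p' = Mjk / (rh * ri).
Proof. by rewrite /phd /phr (hDCA q C) sqrtrM ?ltW. Qed.
Let yjh : phd q' C q p' t p = Mjh / (rk * ri).
Proof. by rewrite /phd /phr (hDCA q' C) (hDC q' q) sqrtrM ?ltW. Qed.
Let ykh : phd t p q p' q' C = Mkh / (rj * ri).
Proof. by rewrite /phd /phr (hDCA t p) (hDCA t q) sqrtrM ?ltW. Qed.

Lemma dual_hDE : hD (phd C p p' q q' t) (phd p C p' q t q') (phd p' C p q' t q)
  = dtd C p p' q q' t ^+ 2 / (dj * dk * dh).
Proof.
rewrite -dual_hD yij yik yih -/Mij -/Mik -/Mih -/dh -/dk -/dj -rhE -rkE -rjE /hD.
by field; rewrite rh0 rk0 rj0.
Qed.

Lemma dual_hDE' : hD (phd C p p' q q' t) (phd q C q' p t p') (phd q' C q p' t p)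
  = dtd C p p' q q' t ^+ 2 / (di * dk * dh).
Proof.
have -> : dtd C p p' q q' t = dtd C q q' p p' t by rewrite /dtd /dt; ring.
rewrite -dual_hD yij yjk yjh.
have -> : nfd C q q' p p' t = Mij by rewrite /Mij /nfd /nf; ring.
rewrite -/Mjk -/Mjh.
have -> : hD C q p = dh by rewrite /dh /hD; ring.
have -> : hD C q' p' = dk by rewrite /dk /hD; ring.
by rewrite -/di -rhE -rkE -riE /hD; field; rewrite rh0 rk0 ri0.
Qed.

Hypothesis detN : dtd C p p' q q' t < 0.

(** The cosines of the angles are the adjugate of the Gram matrix of the lengths, rescaled on its
    diagonal. Taking the adjugate twice returns the matrix up to [dtd ^+ 2], which the second
    normalization removes. *)
Lemma dual_phr : relab phr phd C p p' q q' t = C.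
Proof.
rewrite /relab /phr dual_hDE dual_hDE'.
rewrite yij yik yih yjk yjh ykh.
have -> : nf (Mij / (rh * rk)) (Mik / (rh * rj)) (Mih / (rk * rj)) (Mjk / (rh * ri))
   (Mjh / (rk * ri)) (Mkh / (rj * ri)) = dtd C p p' q q' t ^+ 2 * C / (dh * dk * ri * rj).
  rewrite -dual_nf -/Mij -/Mik -/Mih -/Mjk -/Mjh -/Mkh -/dh -/dk -rhE -rkE /nf.
  by field; rewrite ?rh0 ?rk0 ?ri0 ?rj0.
have -> : dtd C p p' q q' t ^+ 2 / (dj * dk * dh) * (dtd C p p' q q' t ^+ 2 / (di * dk * dh))
   = (dtd C p p' q q' t ^+ 2 / (rj * ri * dk * dh)) ^+ 2.
  rewrite -rjE -riE; field; by rewrite ?rj0 ?ri0 ?gt_eqF.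
rewrite sqrtr_sqr ger0_norm.
  by field; rewrite ?ri0 ?rj0 /= (lt_eqF detN) !gt_eqF.
rewrite divr_ge0 ?sqr_ge0 // !mulr_ge0 ?sqrtr_ge0 // ltW //.
Qed.

Lemma dual_posE : 0 < phd p' C p q' t q + phd C p p' q q' t * phd p C p' q t q'.
Proof.
rewrite yij yik yih.
have -> : Mih / (rk * rj) + Mij / (rh * rk) * (Mik / (rh * rj)) =
   (Mih * dh + Mij * Mik) / (rk * rj * dh).
  rewrite -rhE; field; by rewrite ?rh0 ?rj0 ?rk0.
rewrite dual_pos divr_gt0 //.
  rewrite mulr_gt0 ?oppr_gt0 // addr_gt0 // ?mulr_gt0 //; apply: lt_trans ltr01 _ => //.
by rewrite !mulr_gt0 ?sqrtr_gt0.
Qed.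
End Six.
End Dual.

(** * Hyperbolic cosine and its inverse *)

Section Hyperbolic.
Context {R : realType}.
Implicit Types x u : R.

Lemma cosh_sqrB1 x : cosh x ^+ 2 - 1 = ((expR x - expR (- x)) / 2) ^+ 2.
Proof.
rewrite /cosh expRN; have := expR_gt0 x => e0.
by field; rewrite gt_eqF.
Qed.

Lemma cosh_gt0 x : 0 < cosh x.
Proof. by rewrite /cosh divr_gt0 // addr_gt0 ?expR_gt0. Qed.

Lemma cosh_ge1 x : 1 <= cosh x.
Proof.
rewrite -(@ler_pXn2r _ 2) ?nnegrE //; last exact/ltW/cosh_gt0.
by rewrite expr1n -subr_ge0 cosh_sqrB1 sqr_ge0.
Qed.

Lemma cosh_gt1 x : 0 < x -> 1 < cosh x.
Proof.
move=> x0; rewrite -(@ltr_pXn2r _ 2) ?nnegrE //; last exact/ltW/cosh_gt0.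
rewrite expr1n -subr_gt0 cosh_sqrB1 exprn_gt0 // divr_gt0 // subr_gt0 ltr_expR.
lra.
Qed.

Lemma coshK x : 0 <= x -> arcosh (cosh x) = x.
Proof.
move=> x0; rewrite /arcosh cosh_sqrB1 sqrtr_sqr ger0_norm; last first.
  by rewrite divr_ge0 // subr_ge0 ler_expR; lra.
rewrite /cosh [X in ln X](_ : _ = expR x); last by field.
by rewrite expRK.
Qed.

Lemma arcoshK u : 1 <= u -> cosh (arcosh u) = u.
Proof.
move=> u1; rewrite /arcosh /cosh expRN.
have s0 : 0 <= u ^+ 2 - 1 by rewrite subr_ge0 exprn_ege1.
have w0 : 0 < u + Num.sqrt (u ^+ 2 - 1).
  by apply: ltr_wpDr; [exact: sqrtr_ge0 | lra].
rewrite lnK ?posrE //.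
have E : Num.sqrt (u ^+ 2 - 1) ^+ 2 = u ^+ 2 - 1 by rewrite sqr_sqrtr.
move: w0 E; set w := Num.sqrt _ => w0 E.
have -> : (u + w)^-1 = u - w.
  apply: (mulfI (x := u + w)); first by rewrite gt_eqF.
  rewrite divff ?gt_eqF // [RHS](_ : _ = u ^+ 2 - w ^+ 2); last by ring.
  by rewrite E; ring.
by field.
Qed.

Lemma arcosh_gt0 u : 1 < u -> 0 < arcosh u.
Proof.
move=> u1; rewrite /arcosh ln_gt0 //.
have := sqrtr_ge0 (u ^+ 2 - 1); lra.
Qed.

End Hyperbolic.

(** * The domains of angles and of lengths *)

Section Angles.
Context {R : realType}.
Implicit Types (C p q t : R) (c y l a : tet_edge -> R).

Definition Bset a := (forall A, 0 < a A) /\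
  [/\ a e01 + a e02 + a e03 < pi, a e01 + a e12 + a e13 < pi,
      a e02 + a e12 + a e23 < pi & a e03 + a e13 + a e23 < pi].

Definition sums4 (C p p' q q' t : R) :=
  [/\ C + p + p' < pi, C + q + q' < pi, p + q + t < pi & p' + q' + t < pi].

Lemma Bset_sums a A : Bset a -> onQ sums4 a A.
Proof.
move=> [_ [h0 h1 h2 h3]].
by move: A; apply: tet_edge_ind; rewrite onQE; split; lra.
Qed.

(** Algebraic form of [hyperideal_lengths] used in the analysis: [detl] is the determinant of the
    Gram matrix of the four [tri_nrm], negative because the form has signature (1, 3).
    [hyperideal_Lset] passes from the one to the other. *)
Definition Lset l := (forall A, 0 < l A) /\ detl (fun A => cosh (l A)) < 0.

Definition ang l A := acos (onQ phd (fun A => cosh (l A)) A).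
Definition len a A := arcosh (onQ phr (fun A => cos (a A)) A).

Lemma acosK_norm x : `|x : R| < 1 -> [/\ cos (acos x) = x, 0 < acos x & acos x < pi].
Proof.
rewrite ltr_norml => /andP[x0 x1]; split.
- by rewrite acosK // in_itv /= !ltW.
- by rewrite acos_gt0 // x1 ltW.
- by rewrite acos_ltpi // x0 ltW.
Qed.

Lemma hD_gt0P (x y z : R) : 0 < sin x -> 0 < sin y -> 0 < cos z + cos x * cos y ->
  0 < hD (cos x) (cos y) (cos z) -> sin x * sin y < cos z + cos x * cos y.
Proof.
move=> sx sy h; rewrite hD_factor -!sinS_cos subr_gt0 -exprMn.
rewrite ltr_pXn2r ?nnegrE //; [lra|by rewrite mulr_ge0 ?ltW|lra].
Qed.

(** [hD] of the three cosines is positive by [dual_hDE]; [dual_posE] fixes the sign when the root is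
    taken in [hD_gt0P], and [cosD_gtP] needs the outcome for two pairs of angles. *)
Lemma dual_vertex_sum C p p' q q' t : 1 < C -> 1 < p -> 1 < p' -> 1 < q -> 1 < q' ->
  1 < t -> dtd C p p' q q' t < 0 ->
  acos (phd C p p' q q' t) + acos (phd p C p' q t q') + acos (phd p' C p q' t q) < pi.
Proof.
move=> hC hp hp' hq hq' ht dN.
have dN1 : dtd p C p' q t q' < 0 by move: dN; rewrite /dtd /dt; lra.
have dN2 : dtd p' C p q' t q < 0 by move: dN; rewrite /dtd /dt; lra.
have dN3 : dtd C p' p q' q t < 0 by move: dN; rewrite /dtd /dt; lra.
have /acosK_norm[e1 a1 b1] : `|phd C p p' q q' t| < 1 by rewrite phd_lt1.
have /acosK_norm[e2 a2 b2] : `|phd p C p' q t q'| < 1 by rewrite phd_lt1.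
have /acosK_norm[e3 a3 b3] : `|phd p' C p q' t q| < 1 by rewrite phd_lt1.
have D : hD (phd C p p' q q' t) (phd p C p' q t q') (phd p' C p q' t q) =
  dtd C p p' q q' t ^+ 2 / (hD p p' t * hD C p' q' * hD C p q) by apply: dual_hDE.
have P1 : 0 < phd p' C p q' t q + phd C p p' q q' t * phd p C p' q t q' by apply: dual_posE.
have P2 : 0 < phd p C p' q t q' + phd C p' p q' q t * phd p' C p q' t q by apply: dual_posE.
have E : phd C p' p q' q t = phd C p p' q q' t by have [] := @phd_sym R C p p' q q' t.
rewrite E in P2.
have D0 : 0 < hD (phd C p p' q q' t) (phd p C p' q t q') (phd p' C p q' t q).
  rewrite D divr_gt0 //; first by rewrite -sqrrN exprn_gt0 // oppr_gt0.
  by rewrite !mulr_gt0 //; apply: lt_le_trans (hD_ge1 _ _ _); rewrite ?ltW.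
move: (phd C p p' q q' t) (phd p C p' q t q') (phd p' C p q' t q)
  e1 a1 b1 e2 a2 b2 e3 a3 b3 P1 P2 D0 => {D E} x y z.
move: (acos x) (acos y) (acos z) => x' y' z' <- a1 b1 <- a2 b2 <- a3 b3 P1 P2 D0.
have ? := sin_pos a1 b1; have ? := sin_pos a2 b2; have ? := sin_pos a3 b3.
apply: cosD_gtP; rewrite ?a1 ?a2 ?a3 ?b1 ?b2 ?b3 //; apply: hD_gt0P => //.
by rewrite (_ : hD _ _ _ = hD (cos x') (cos y') (cos z')) // /hD; ring.
Qed.

Section L.
Variables (l : tet_edge -> R) (Ll : Lset l).
Let c := fun A => cosh (l A).
Let c1 A : 1 < c A. Proof. by apply: cosh_gt1; case: Ll. Qed.

Lemma Lset_norm A : `|onQ phd c A| < 1.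
Proof.
rewrite /onQ phd_lt1 //; case: Ll => _.
by rewrite -(onQ_detl _ A).
Qed.

Lemma Lset_cos A : cos (ang l A) = onQ phd c A.
Proof. by have [] := acosK_norm (Lset_norm A). Qed.

Lemma Lset_Bset : Bset (ang l).
Proof.
split; first by move=> A; have [] := acosK_norm (Lset_norm A).
case: Ll => _; rewrite -/c => dN.
have s1 C p p' q q' t : phd C q q' p p' t = phd C p p' q q' t.
  by have [] := @phd_sym R C p p' q q' t.
rewrite /ang !onQE.
have dE x01 x02 x03 x12 x13 x23 : dtd x01 x02 x03 x12 x13 x23 = detl c ->
   dtd x01 x02 x03 x12 x13 x23 < 0 by move=> ->.
split.
- by apply: dual_vertex_sum => //; exact: c1.
- rewrite -(s1 (cosh (l e01))); apply: dual_vertex_sum; try exact: c1.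
  apply: dE; rewrite /detl /dtd /dt /c /=.
  move: (cosh (l e01)) (cosh (l e02)) (cosh (l e03)) (cosh (l e12)) (cosh (l e13))
    (cosh (l e23)) => *; ring.
- rewrite -(s1 (cosh (l e02))) -(s1 (cosh (l e12))); apply: dual_vertex_sum; try exact: c1.
  apply: dE; rewrite /detl /dtd /dt /c /=.
  move: (cosh (l e01)) (cosh (l e02)) (cosh (l e03)) (cosh (l e12)) (cosh (l e13))
    (cosh (l e23)) => *; ring.
- rewrite -(s1 (cosh (l e03))) -(s1 (cosh (l e13))) -(s1 (cosh (l e23))).
  apply: dual_vertex_sum; try exact: c1.
  apply: dE; rewrite /detl /dtd /dt /c /=.
  move: (cosh (l e01)) (cosh (l e02)) (cosh (l e03)) (cosh (l e12)) (cosh (l e13))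
    (cosh (l e23)) => *; ring.
Qed.

Lemma len_ang A : len (ang l) A = l A.
Proof.
rewrite /len.
have -> : (fun A => cos (ang l A)) = onQ phd c.
  by apply/funext => B; exact: Lset_cos.
rewrite onQ_onQ; last exact: phd_sym.
rewrite /onQ dual_phr //; last by case: Ll => _; rewrite -(onQ_detl _ A).
have := onQ_id c A; rewrite /onQ => ->.
by rewrite coshK // ltW //; case: Ll.
Qed.
End L.

Section B.
Variables (a : tet_edge -> R) (Ba : Bset a).
Let y := fun A => cos (a A).

Lemma Bset_gt0 A : 0 < a A. Proof. by case: Ba. Qed.
Lemma Bset_ltpi A : a A < pi.
Proof.
case: (Ba) => a0 [].
by move: A; apply: tet_edge_ind;
  have := a0 e01; have := a0 e02; have := a0 e03; have := a0 e12; have := a0 e13;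
  have := a0 e23; lra.
Qed.

Lemma Bset_sin A : 0 < sin (a A).
Proof. by apply: sin_pos; [exact: Bset_gt0 | exact: Bset_ltpi]. Qed.

Lemma Bset_hD A : onQ (fun C p p' q q' t =>
  [/\ 0 < hD C p p', 0 < hD C q q', 0 < hD p q t & 0 < hD p' q' t]) y A.
Proof.
have [h1 h2 h3 h4] := Bset_sums A Ba.
by split; apply: hD_cos_gt0 => //; exact: Bset_gt0.
Qed.

Lemma Bset_nf A : 0 < onQ nf y A.
Proof.
have [h1 h2 h3 h4] := Bset_sums A Ba.
by apply: nf_cos_gt0 => //; exact: Bset_gt0.
Qed.

Lemma Bset_detv : detv y < 0.
Proof.
rewrite -(onQ_detv _ e01).
have [h1 h2 h3 h4] := Bset_sums e01 Ba.
by apply: dt_cos_lt0 => //; exact: Bset_gt0.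
Qed.
End B.

Lemma phr_sqr C p p' q q' t : 0 < hD C p p' -> 0 < hD C q q' ->
  phr C p p' q q' t ^+ 2 - 1 = - dt C p p' q q' t * (1 - C ^+ 2) / (hD C p p' * hD C q q').
Proof.
move=> d1 d2; rewrite -nf_sqr /phr expr_div_n sqr_sqrtr; last by rewrite mulr_ge0 ?ltW.
by field; rewrite !gt_eqF.
Qed.

Lemma phr_gt1 C p p' q q' t : 0 < hD C p p' -> 0 < hD C q q' ->
  0 < nf C p p' q q' t -> dt C p p' q q' t < 0 -> C ^+ 2 < 1 -> 1 < phr C p p' q q' t.
Proof.
move=> d1 d2 n d C1; rewrite -(@ltr_pXn2r _ 2) ?nnegrE //; last first.
  by rewrite /phr divr_ge0 ?sqrtr_ge0 ?ltW.
rewrite expr1n -subr_gt0 phr_sqr // divr_gt0 ?mulr_gt0 // ?oppr_gt0 //.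
by rewrite subr_gt0.
Qed.
End Angles.

(** * The Jacobian of the lengths with respect to the angles *)

(* [bfunI] at ij is sqrt (- det) times the derivative of the length of ij when
   the angles, of cosines C, p, ... and sines sC, sp, ..., move with velocity
   vC, vp, ...; Ii and Ij stand for the inverses of [hD C p p'] and [hD C q q']. *)
Section Bform.
Context {R : comNzRingType}.
Implicit Types C p q t : R.

Definition bfunI (C p p' q q' t sC sp sp' sq sq' st vC vp vp' vq vq' vt Ii Ij : R) : R :=
  (nf C p p' q q' t * ((p * p' + C) * Ii + (q * q' + C) * Ij)
     - (p * q' + p' * q - 2 * C * t)) * vC
  - sC * st * vt
  + sC * (Ii * (nf p' C p q' t q * (sp * vp) + nf p C p' q t q' * (sp' * vp'))
       +  Ij * (nf q' C q p' t p * (sq * vq) + nf q C q' p t p' * (sq' * vq'))).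

(** The inverses and the sines are independent variables here, so the symmetry d l_A / d a_B = d l_B
    / d a_A of the Jacobian is a polynomial identity. It is the integrability condition behind the
    Schlafli formula. *)
Lemma bfunI_symm (y1 y2 y3 y4 y5 y6 s1 s2 s3 s4 s5 s6 v1 v2 v3 v4 v5 v6
  w1 w2 w3 w4 w5 w6 I0 I1 I2 I3 : R) :
  w1 * bfunI y1 y2 y3 y4 y5 y6 s1 s2 s3 s4 s5 s6 v1 v2 v3 v4 v5 v6 I0 I1 +
  w2 * bfunI y2 y1 y3 y4 y6 y5 s2 s1 s3 s4 s6 s5 v2 v1 v3 v4 v6 v5 I0 I2 +
  w3 * bfunI y3 y1 y2 y5 y6 y4 s3 s1 s2 s5 s6 s4 v3 v1 v2 v5 v6 v4 I0 I3 +
  w4 * bfunI y4 y1 y5 y2 y6 y3 s4 s1 s5 s2 s6 s3 v4 v1 v5 v2 v6 v3 I1 I2 +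
  w5 * bfunI y5 y1 y4 y3 y6 y2 s5 s1 s4 s3 s6 s2 v5 v1 v4 v3 v6 v2 I1 I3 +
  w6 * bfunI y6 y2 y4 y3 y5 y1 s6 s2 s4 s3 s5 s1 v6 v2 v4 v3 v5 v1 I2 I3 =
  v1 * bfunI y1 y2 y3 y4 y5 y6 s1 s2 s3 s4 s5 s6 w1 w2 w3 w4 w5 w6 I0 I1 +
  v2 * bfunI y2 y1 y3 y4 y6 y5 s2 s1 s3 s4 s6 s5 w2 w1 w3 w4 w6 w5 I0 I2 +
  v3 * bfunI y3 y1 y2 y5 y6 y4 s3 s1 s2 s5 s6 s4 w3 w1 w2 w5 w6 w4 I0 I3 +
  v4 * bfunI y4 y1 y5 y2 y6 y3 s4 s1 s5 s2 s6 s3 w4 w1 w5 w2 w6 w3 I1 I2 +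
  v5 * bfunI y5 y1 y4 y3 y6 y2 s5 s1 s4 s3 s6 s2 w5 w1 w4 w3 w6 w2 I1 I3 +
  v6 * bfunI y6 y2 y4 y3 y5 y1 s6 s2 s4 s3 s5 s1 w6 w2 w4 w3 w5 w1 I2 I3.
Proof. rewrite /bfunI /nf; ring. Qed.
End Bform.

Section Breal.
Context {R : realFieldType}.
Implicit Types C p q t : R.

Definition bfun (C p p' q q' t sC sp sp' sq sq' st vC vp vp' vq vq' vt : R) : R :=
  bfunI C p p' q q' t sC sp sp' sq sq' st vC vp vp' vq vq' vt
    (hD C p p')^-1 (hD C q q')^-1.

(** The right side is the numerator of the derivative of [arcosh] of [phr]. The cofactors with other
    leading edges come from [nf_adj], which supplies the factor [1 - C ^+ 2], that is, [sC ^+ 2]. *)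
Lemma bfunE (C p p' q q' t sC sp sp' sq sq' st vC vp vp' vq vq' vt : R) :
  hD C p p' != 0 -> hD C q q' != 0 -> sC ^+ 2 = 1 - C ^+ 2 ->
  sC * bfun C p p' q q' t sC sp sp' sq sq' st vC vp vp' vq vq' vt =
  dnf C p p' q q' t (- sC * vC) (- sp * vp) (- sp' * vp') (- sq * vq) (- sq' * vq') (- st * vt)
  - nf C p p' q q' t * (dhD C p p' (- sC * vC) (- sp * vp) (- sp' * vp') / (2 * hD C p p')
    + dhD C q q' (- sC * vC) (- sq * vq) (- sq' * vq') / (2 * hD C q q')).
Proof.
move=> Di Dj sE; rewrite /bfun /bfunI.
have E1 := nf_adj C p p' q q' t.
have E2 := nf_adj C p' p q' q t.
have E3 := nf_adj C q q' p p' t.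
have E4 := nf_adj C q' q p' p t.
have n2 : nf C p' p q' q t = nf C p p' q q' t by rewrite /nf; ring.
have n3 : nf C q q' p p' t = nf C p p' q q' t by rewrite /nf; ring.
have n4 : nf C q' q p' p t = nf C p p' q q' t by rewrite /nf; ring.
have d2 : hD C p' p = hD C p p' by rewrite /hD; ring.
have d4 : hD C q' q = hD C q q' by rewrite /hD; ring.
rewrite n2 d2 in E2; rewrite n3 in E3; rewrite n4 d4 in E4.
move: E1 E2 E3 E4.
set N := nf C p p' q q' t; set Nih := nf p' _ _ _ _ _; set Nik := nf p _ _ _ _ _.
set Njk := nf q _ _ _ _ _; set Njh := nf q' _ _ _ _ _.
rewrite -sE => E1 E2 E3 E4.
transitivity (N * ((p * p' + C) / hD C p p' + (q * q' + C) / hD C q q') * (sC * vC)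
   - (p * q' + p' * q - 2 * C * t) * (sC * vC) - sC ^+ 2 * (st * vt)
   + (sp * vp) * (sC ^+ 2 * Nih) / hD C p p' + (sp' * vp') * (sC ^+ 2 * Nik) / hD C p p'
   + (sq * vq) * (sC ^+ 2 * Njh) / hD C q q' + (sq' * vq') * (sC ^+ 2 * Njk) / hD C q q').
  by ring.
have -> : sC ^+ 2 * Nih = N * (C * p' + p) - (C * q' + q) * hD C p p'.
  by apply: oppr_inj; rewrite opprB E1 mulNr.
have -> : sC ^+ 2 * Nik = N * (C * p + p') - (C * q + q') * hD C p p'.
  by apply: oppr_inj; rewrite opprB E2 mulNr.
have -> : sC ^+ 2 * Njh = N * (C * q' + q) - (C * p' + p) * hD C q q'.
  by apply: oppr_inj; rewrite opprB E3 mulNr.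
have -> : sC ^+ 2 * Njk = N * (C * q + q') - (C * p + p') * hD C q q'.
  by apply: oppr_inj; rewrite opprB E4 mulNr.
rewrite /dnf sE /dhD; move: (hD C p p') (hD C q q') Di Dj => I J Di Dj.
by field; rewrite Di Dj.
Qed.

End Breal.

Section Kernel.
Context {R : realFieldType}.
Implicit Types C p q t : R.

(** After multiplication by the sines, [bfunE] turns the six equations into dN = (ri + rj) N, with
    ri half the logarithmic derivative of the [hD] at i: these are the hypotheses of the kernel
    lemmas. *)
Lemma kernel_t (C p p' q q' t sC sp sp' sq sq' st vC vp vp' vq vq' vt : R) :
  0 < hD C p p' -> 0 < hD C q q' -> 0 < hD p q t -> 0 < hD p' q' t ->
  dt C p p' q q' t != 0 -> st != 0 ->
  sC ^+ 2 = 1 - C ^+ 2 -> sp ^+ 2 = 1 - p ^+ 2 -> sp' ^+ 2 = 1 - p' ^+ 2 ->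
  sq ^+ 2 = 1 - q ^+ 2 -> sq' ^+ 2 = 1 - q' ^+ 2 -> st ^+ 2 = 1 - t ^+ 2 ->
  bfun C p p' q q' t sC sp sp' sq sq' st vC vp vp' vq vq' vt = 0 ->
  bfun p C p' q t q' sp sC sp' sq st sq' vp vC vp' vq vt vq' = 0 ->
  bfun p' C p q' t q sp' sC sp sq' st sq vp' vC vp vq' vt vq = 0 ->
  bfun q C q' p t p' sq sC sq' sp st sp' vq vC vq' vp vt vp' = 0 ->
  bfun q' C q p' t p sq' sC sq sp' st sp vq' vC vq vp' vt vp = 0 ->
  bfun t p q p' q' C st sp sq sp' sq' sC vt vp vq vp' vq' vC = 0 ->
  vt = 0.
Proof.
move=> di dj dk dh d0 st0 eC ep ep' eq eq' et z1 z2 z3 z4 z5 z6.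
have := congr1 ( *%R sC) z1; have := congr1 ( *%R sp) z2.
have := congr1 ( *%R sp') z3; have := congr1 ( *%R sq) z4.
have := congr1 ( *%R sq') z5; have := congr1 ( *%R st) z6; rewrite !mulr0 => {z1 z2 z3 z4 z5 z6}.
have c1 : hD p C p' = hD C p p' by rewrite /hD; ring.
have c2 : hD p' C p = hD C p p' by rewrite /hD; ring.
have c3 : hD q C q' = hD C q q' by rewrite /hD; ring.
have c4 : hD q' C q = hD C q q' by rewrite /hD; ring.
have c5 : hD q p t = hD p q t by rewrite /hD; ring.
have c6 : hD t p q = hD p q t by rewrite /hD; ring.
have c7 : hD q' p' t = hD p' q' t by rewrite /hD; ring.
have c8 : hD t p' q' = hD p' q' t by rewrite /hD; ring.
have e1 : dhD p C p' (- sp * vp) (- sC * vC) (- sp' * vp') = dhD C p p' (- sC * vC) (- sp * vp) (- sp' * vp') by rewrite /dhD; ring.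
have e2 : dhD p' C p (- sp' * vp') (- sC * vC) (- sp * vp) = dhD C p p' (- sC * vC) (- sp * vp) (- sp' * vp') by rewrite /dhD; ring.
have e3 : dhD q C q' (- sq * vq) (- sC * vC) (- sq' * vq') = dhD C q q' (- sC * vC) (- sq * vq) (- sq' * vq') by rewrite /dhD; ring.
have e4 : dhD q' C q (- sq' * vq') (- sC * vC) (- sq * vq) = dhD C q q' (- sC * vC) (- sq * vq) (- sq' * vq') by rewrite /dhD; ring.
have e5 : dhD q p t (- sq * vq) (- sp * vp) (- st * vt) = dhD p q t (- sp * vp) (- sq * vq) (- st * vt) by rewrite /dhD; ring.
have e6 : dhD t p q (- st * vt) (- sp * vp) (- sq * vq) = dhD p q t (- sp * vp) (- sq * vq) (- st * vt) by rewrite /dhD; ring.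
have e7 : dhD q' p' t (- sq' * vq') (- sp' * vp') (- st * vt) = dhD p' q' t (- sp' * vp') (- sq' * vq') (- st * vt) by rewrite /dhD; ring.
have e8 : dhD t p' q' (- st * vt) (- sp' * vp') (- sq' * vq') = dhD p' q' t (- sp' * vp') (- sq' * vq') (- st * vt) by rewrite /dhD; ring.
rewrite !bfunE ?c1 ?c2 ?c3 ?c4 ?c5 ?c6 ?c7 ?c8 ?e1 ?e2 ?e3 ?e4 ?e5 ?e6 ?e7 ?e8 ?(gt_eqF di) ?(gt_eqF dj) ?(gt_eqF dk) ?(gt_eqF dh) //.
move=> /subr0_eq E6 /subr0_eq E5 /subr0_eq E4 /subr0_eq E3 /subr0_eq E2 /subr0_eq E1.
set ri := dhD C p p' _ _ _ / _ in E1 E2 E3.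
set rj := dhD C q q' _ _ _ / _ in E1 E4 E5.
set rk := dhD p q t _ _ _ / _ in E2 E4 E6.
set rh := dhD p' q' t _ _ _ / _ in E3 E5 E6.
have Fi : dhD C p p' (- sC * vC) (- sp * vp) (- sp' * vp') = 2 * ri * hD C p p'.
  by rewrite /ri; field; rewrite gt_eqF.
have Fj : dhD C q q' (- sC * vC) (- sq * vq) (- sq' * vq') = 2 * rj * hD C q q'.
  by rewrite /rj; field; rewrite gt_eqF.
have Fk : dhD p q t (- sp * vp) (- sq * vq) (- st * vt) = 2 * rk * hD p q t.
  by rewrite /rk; field; rewrite gt_eqF.
have Fh : dhD p' q' t (- sp' * vp') (- sq' * vq') (- st * vt) = 2 * rh * hD p' q' t.
  by rewrite /rh; field; rewrite gt_eqF.
clearbody ri rj rk rh.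
move: E1 E2 E3 E4 E5 E6.
rewrite ![nf _ _ _ _ _ _ * _]mulrC => E1 E2 E3 E4 E5 E6.
have K1 := kernel_diag E1 E2 E3 E4 E5 E6 Fi Fj Fk Fh.
have K2 := kernel_diag_j E1 E2 E3 E4 E5 E6 Fi Fj Fk Fh.
have K3 := kernel_off E1 E2 E3 E4 E5 E6 Fi Fj Fk Fh.
(* The diagonal entries force ri = rj; the off-diagonal entry then reduces to (dH_ij) det = 0, where
   t has derivative [- st * vt]. *)
have rij : ri = rj.
  apply: (mulIf d0); apply: (@mulfI _ 2) => //.
  rewrite !mulrA; exact: etrans (esym K1) K2.
rewrite K1 -rij in K3.
have : st * vt * dt C p p' q q' t = 0.
  apply: oppr_inj; rewrite oppr0 -!mulNr.
  apply: (addrI (- t * (2 * ri * dt C p p' q q' t))); rewrite K3; ring.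
by move/eqP; rewrite !mulf_eq0 (negPf d0) (negPf st0) orbF /= => /eqP.
Qed.

(* With [m] the sums and [n] the differences over opposite edges, the form is
   a positive combination of the squares of the [n]'s, of the [m]'s and of
   their total sum. *)
Lemma regular_form_gt0 (y s v1 v2 v3 v4 v5 v6 : R) : 1 / 2 < y -> y < 1 -> s ^+ 2 = 1 - y ^+ 2 ->
  [|| v1 != 0, v2 != 0, v3 != 0, v4 != 0, v5 != 0 | v6 != 0] ->
  0 < v1 * bfun y y y y y y s s s s s s v1 v2 v3 v4 v5 v6 +
  v2 * bfun y y y y y y s s s s s s v2 v1 v3 v4 v6 v5 +
  v3 * bfun y y y y y y s s s s s s v3 v1 v2 v5 v6 v4 +
  v4 * bfun y y y y y y s s s s s s v4 v1 v5 v2 v6 v3 +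
  v5 * bfun y y y y y y s s s s s s v5 v1 v4 v3 v6 v2 +
  v6 * bfun y y y y y y s s s s s s v6 v2 v4 v3 v5 v1.
Proof.
move=> y0 y1 sE nz.
have D : hD y y y = (y + 1) ^+ 2 * (2 * y - 1) by rewrite /hD; ring.
have N : nf y y y y y y = y * (y + 1) ^+ 2 by rewrite /nf; ring.
have d1 : 2 * y - 1 != 0 by rewrite gt_eqF //; lra.
have d2 : y + 1 != 0 by rewrite gt_eqF //; lra.
(* [z] is the hyperbolic cosine of the edge length of the regular tetrahedron whose angles have
   cosine [y]. *)
set z := y / (2 * y - 1).
have z0 : 0 < z by rewrite /z divr_gt0 //; lra.
pose Q m1 m2 m3 n1 n2 n3 : R :=
   2 * (1 + y) * ((z * y / 2 + (1 - y) / 4) * (n1 ^+ 2 + n2 ^+ 2 + n3 ^+ 2)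
   + (3 * y - 1) / 4 * (m1 ^+ 2 + m2 ^+ 2 + m3 ^+ 2)
   + (1 - y) * z / 2 * (m1 + m2 + m3) ^+ 2).
have E : Q (v1 + v6) (v2 + v5) (v3 + v4) (v1 - v6) (v2 - v5) (v3 - v4) =
  v1 * bfun y y y y y y s s s s s s v1 v2 v3 v4 v5 v6 +
  v2 * bfun y y y y y y s s s s s s v2 v1 v3 v4 v6 v5 +
  v3 * bfun y y y y y y s s s s s s v3 v1 v2 v5 v6 v4 +
  v4 * bfun y y y y y y s s s s s s v4 v1 v5 v2 v6 v3 +
  v5 * bfun y y y y y y s s s s s s v5 v1 v4 v3 v6 v2 +
  v6 * bfun y y y y y y s s s s s s v6 v2 v4 v3 v5 v1.
  pose b (vC vp vp' vq vq' vt : R) : R := 2 * z * y * (y + 1) * vC - (1 - y ^+ 2) * vt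
     + (1 - y ^+ 2) * z * (vp + vp' + vq + vq').
  have bE vC vp vp' vq vq' vt : bfun y y y y y y s s s s s s vC vp vp' vq vq' vt = b vC vp vp' vq vq' vt.
    rewrite /b -sE /bfun /bfunI D N /z; field; by rewrite d1 d2.
  rewrite !bE /b /Q /z; field; exact: d1.
rewrite -E /Q.
have c1 : 0 < z * y / 2 + (1 - y) / 4.
  have : 0 < z * y by apply: mulr_gt0 => //; lra.
  lra.
have c2 : 0 < (3 * y - 1) / 4 by lra.
have c3 : 0 <= (1 - y) * z / 2.
  have : 0 <= (1 - y) * z by apply: mulr_ge0; [lra|exact: ltW].
  lra.
apply: mulr_gt0; first lra.
apply: ltr_wpDr; first by rewrite mulr_ge0 // sqr_ge0.
set c := Num.min (z * y / 2 + (1 - y) / 4) ((3 * y - 1) / 4).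
have c0 : 0 < c by rewrite lt_min c1 c2.
apply: (@lt_le_trans _ _ (c * (((v1 - v6) ^+ 2 + (v2 - v5) ^+ 2 + (v3 - v4) ^+ 2) + ((v1 + v6) ^+ 2 + (v2 + v5) ^+ 2 + (v3 + v4) ^+ 2)))).
  rewrite mulr_gt0 //.
  rewrite [ltRHS](_ : _ = 2 * (v1 ^+ 2 + v2 ^+ 2 + v3 ^+ 2 + v4 ^+ 2 + v5 ^+ 2 + v6 ^+ 2)); last by ring.
  rewrite mulr_gt0 //.
  have := sqr_ge0 v1; have := sqr_ge0 v2; have := sqr_ge0 v3; have := sqr_ge0 v4.
  have := sqr_ge0 v5; have := sqr_ge0 v6.
  have nz' (x : R) : x != 0 -> 0 < x ^+ 2 by move=> x0; rewrite lt_def sqr_ge0 sqrf_eq0 x0.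
  move: nz => /orP[/nz'|/orP[/nz'|/orP[/nz'|/orP[/nz'|/orP[/nz'|/nz']]]]]; lra.
rewrite mulrDr lerD // ler_wpM2r ?addr_ge0 ?sqr_ge0 // ge_min lexx ?orbT //.
Qed.
End Kernel.

Section BilForm.
Context {R : realType}.
Implicit Types (a v w : tet_edge -> R).

(** Each edge carries the pair of its angle and its velocity, so that [onQ] permutes both together;
    [Bil] is then sqrt (- det) times the Jacobian as a bilinear form. *)
Definition bq (C p p' q q' t : R * R) : R :=
  bfun (cos C.1) (cos p.1) (cos p'.1) (cos q.1) (cos q'.1) (cos t.1)
    (sin C.1) (sin p.1) (sin p'.1) (sin q.1) (sin q'.1) (sin t.1)
    C.2 p.2 p'.2 q.2 q'.2 t.2.
Definition Bf a v A := onQ bq (fun A => (a A, v A)) A.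
Definition Bil a v w := \sum_A w A * Bf a v A.

Lemma bq_sym : quad_sym bq.
Proof.
move=> [C vC] [p vp] [p' vp'] [q vq] [q' vq'] [t vt]; rewrite /bq /=.
move: (cos C) (cos p) (cos p') (cos q) (cos q') (cos t)
  (sin C) (sin p) (sin p') (sin q) (sin q') (sin t) => {C p p' q q' t}.
move=> C p p' q q' t sC sp sp' sq sq' st.
split; rewrite /bfun /bfunI.
  by rewrite /nf; ring.
have -> : hD C p' p = hD C p p' by rewrite /hD; ring.
have -> : hD C q' q = hD C q q' by rewrite /hD; ring.
by rewrite /nf; ring.
Qed.

Lemma Bil_sym a v w : Bil a v w = Bil a w v.
Proof.
rewrite /Bil !sum_tet_edge /Bf !onQE /bq /=.
set y1 := cos (a e01); set y2 := cos (a e02); set y3 := cos (a e03).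
set y4 := cos (a e12); set y5 := cos (a e13); set y6 := cos (a e23).
rewrite /bfun.
have -> : hD y2 y1 y3 = hD y1 y2 y3 by rewrite /hD; ring.
have -> : hD y3 y1 y2 = hD y1 y2 y3 by rewrite /hD; ring.
have -> : hD y4 y1 y5 = hD y1 y4 y5 by rewrite /hD; ring.
have -> : hD y4 y2 y6 = hD y2 y4 y6 by rewrite /hD; ring.
have -> : hD y5 y1 y4 = hD y1 y4 y5 by rewrite /hD; ring.
have -> : hD y5 y3 y6 = hD y3 y5 y6 by rewrite /hD; ring.
have -> : hD y6 y2 y4 = hD y2 y4 y6 by rewrite /hD; ring.
have -> : hD y6 y3 y5 = hD y3 y5 y6 by rewrite /hD; ring.
exact: bfunI_symm.
Qed.

Lemma Bf_lin a v w k A :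
  Bf a (fun A => v A + k * w A) A = Bf a v A + k * Bf a w A.
Proof. by rewrite /Bf /onQ /bq /bfun /bfunI /=; ring. Qed.

Lemma Bil_linl a v w u k :
  Bil a (fun A => v A + k * w A) u = Bil a v u + k * Bil a w u.
Proof.
rewrite /Bil mulr_sumr -big_split /=; apply: eq_bigr => A _.
by rewrite Bf_lin; ring.
Qed.

Lemma Bil_quad a v w k : Bil a (fun A => v A + k * w A) (fun A => v A + k * w A)
  = Bil a v v + 2 * k * Bil a v w + k ^+ 2 * Bil a w w.
Proof.
rewrite Bil_linl (Bil_sym a v) (Bil_sym a w) !Bil_linl (Bil_sym a w v); ring.
Qed.

(** [kernel_t] yields the velocity at the edge opposite to A; its equations are those at all six
    edges, listed from A by [relab]. *)
Lemma Bf_kernel a v : Bset a -> (forall A, Bf a v A = 0) -> forall A, v A = 0.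
Proof.
move=> Ba z.
have H A : onQ (fun _ _ _ _ _ t : R => t) v A = 0.
  have : onQ (fun x1 x2 x3 x4 x5 x6 : R => [/\ x1 = 0, x2 = 0 & x3 = 0] /\
     [/\ x4 = 0, x5 = 0 & x6 = 0]) (Bf a v) A by rewrite /onQ !z.
  rewrite onQ_onQ; last exact: bq_sym.
  rewrite /relab {1}/onQ /= => -[[z1 z2 z3] [z4 z5 z6]].
  have [h1 h2 h3 h4] := Bset_hD Ba A.
  apply: (kernel_t h1 h2 h3 h4 _ _ _ _ _ _ _ _ z1 z2 z3 z4 z5 z6); rewrite ?sinS_cos //.
    by rewrite lt_eqF //; have := Bset_detv Ba; rewrite -(onQ_detv _ A).
  by rewrite gt_eqF // Bset_sin.
by apply: tet_edge_ind;
  [have := H e23 | have := H e13 | have := H e12 | have := H e03 | have := H e02 |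
   have := H e01]; rewrite onQE.
Qed.

Lemma Bil_delta a v A : Bil a v (fun B => (B == A)%:R) = Bf a v A.
Proof.
rewrite /Bil (bigD1 A) //= eqxx mul1r big1 ?addr0 // => B /negPf ->.
by rewrite mul0r.
Qed.

Lemma Bil_kernel a v : Bset a -> (forall w, 0 <= Bil a w w) -> Bil a v v = 0 ->
  forall A, v A = 0.
Proof.
move=> Ba pos z; apply: (Bf_kernel Ba) => A.
rewrite -Bil_delta; set w := fun B => _.
have H k : 0 <= 2 * k * Bil a v w + k ^+ 2 * Bil a w w.
  by have := pos (fun A => v A + k * w A); rewrite Bil_quad z add0r.
have bw := pos w.
set b := Bil a v w in H *; set c := Bil a w w in H bw.
(* Close to the minimizer k = - b / c of the quadratic in k; the 1 keeps the denominator positive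
   when c = 0. *)
have := H (- b / (1 + c)).
have c0 : 0 < 1 + c by lra.
have -> : 2 * (- b / (1 + c)) * b + (- b / (1 + c)) ^+ 2 * c
  = - (b ^+ 2) * ((2 + c) / (1 + c) ^+ 2) by field; rewrite gt_eqF.
rewrite mulNr oppr_ge0 pmulr_lle0; last by rewrite divr_gt0 ?exprn_gt0 //; lra.
by move=> b2; apply/eqP; rewrite -sqrf_eq0 eq_le b2 sqr_ge0.
Qed.

Lemma Bil_regular (th : R) v : 1 / 2 < cos th -> cos th < 1 ->
  (exists A, v A != 0) -> 0 < Bil (fun=> th) v v.
Proof.
move=> h1 h2 [A vA]; rewrite /Bil sum_tet_edge /Bf !onQE /bq /=.
apply: regular_form_gt0 => //; first exact: sinS_cos.
by move: A vA; apply: tet_edge_ind => ->; rewrite ?orbT.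
Qed.
End BilForm.

(** * Positive definiteness of the Jacobian *)

(** A named proposition, on whose function argument [ctn] can match syntactically. *)
Definition ctat {R : realType} {T : topologicalType} (f : T -> R) (x : T) : Prop :=
  {for x, continuous f}.

Section Ct.
Context {R : realType} {T : topologicalType}.
Implicit Types (f g : T -> R) (x : T).

Lemma ct_cst (c : R) x : ctat (fun=> c) x.
Proof. exact: cvg_cst. Qed.
Lemma ctD f g x : ctat f x -> ctat g x -> ctat (fun z => f z + g z) x.
Proof. exact: cvgD. Qed.
Lemma ctN f x : ctat f x -> ctat (fun z => - f z) x.
Proof. exact: cvgN. Qed.
Lemma ctM f g x : ctat f x -> ctat g x -> ctat (fun z => f z * g z) x.
Proof. exact: cvgM. Qed.
Lemma ctV f x : f x != 0 -> ctat f x -> ctat (fun z => (f z)^-1) x.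
Proof. exact: cvgV. Qed.
Lemma ct_comp (h : R -> R) f x : ctat h (f x) -> ctat f x ->
  ctat (fun z => h (f z)) x.
Proof. by move=> hh hf; exact: (@continuous_comp _ _ _ f h x hf hh). Qed.
Lemma ctX f n x : ctat f x -> ctat (fun z => f z ^+ n) x.
Proof. by move=> hf; apply: (@ct_comp (fun y => y ^+ n)) hf; exact: exprn_continuous. Qed.
Lemma ct_cos f x : ctat f x -> ctat (fun z => cos (f z)) x.
Proof. by move=> hf; apply: (@ct_comp (@cos R)) hf; exact: continuous_cos. Qed.
Lemma ct_sin f x : ctat f x -> ctat (fun z => sin (f z)) x.
Proof. by move=> hf; apply: (@ct_comp (@sin R)) hf; exact: continuous_sin. Qed.
Lemma ct_exp f x : ctat f x -> ctat (fun z => expR (f z)) x.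
Proof. by move=> hf; apply: (@ct_comp (@expR R)) hf; exact: continuous_expR. Qed.
Lemma ct_sqrt f x : ctat f x -> ctat (fun z => Num.sqrt (f z)) x.
Proof. by move=> hf; apply: (@ct_comp (@Num.sqrt R)) hf; exact: sqrt_continuous. Qed.
Lemma ct_norm f x : ctat f x -> ctat (fun z => `|f z|) x.
Proof. by move=> hf; apply: (@ct_comp (fun y => `|y|)) hf; exact: norm_continuous. Qed.
Lemma ct_max f g x : ctat f x -> ctat g x -> ctat (fun z => Num.max (f z) (g z)) x.
Proof.
move=> hf hg.
rewrite (_ : (fun z => _) = fun z => (f z + g z + `|f z + - g z|) * 2^-1); last first.
  by apply/funext => z; rewrite maxr_absE.
apply: ctM; last exact: ct_cst.
by apply: ctD; [exact: ctD | apply: ct_norm; apply: ctD => //; exact: ctN].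
Qed.
Lemma ct_min f g x : ctat f x -> ctat g x -> ctat (fun z => Num.min (f z) (g z)) x.
Proof.
move=> hf hg.
rewrite (_ : (fun z => _) = fun z => (f z + g z - `|f z + - g z|) * 2^-1); last first.
  by apply/funext => z; rewrite minr_absE.
apply: ctM; last exact: ct_cst.
by apply: ctD; [exact: ctD | apply: ctN; apply: ct_norm; apply: ctD => //; exact: ctN].
Qed.
Lemma ct_cosh f x : ctat f x -> ctat (fun z => cosh (f z)) x.
Proof.
move=> hf; rewrite /cosh; apply: ctM; last exact: ct_cst.
by apply: ctD; apply: ct_exp => //; exact: ctN.
Qed.
Lemma ct_sum (I : Type) (r : seq I) (F : I -> T -> R) x :
  (forall i, ctat (F i) x) -> ctat (fun z => \sum_(i <- r) F i z) x.
Proof.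
move=> h; elim: r => [|i r IH].
  rewrite (_ : (fun z => _) = fun=> 0); first exact: ct_cst.
  by apply/funext => z; rewrite big_nil.
rewrite (_ : (fun z => _) = fun z => F i z + \sum_(j <- r) F j z); first exact: ctD.
by apply/funext => z; rewrite big_cons.
Qed.
End Ct.

Lemma ct_id {R : realType} (x : R) : ctat (fun z : R => z) x.
Proof. exact: cvg_id. Qed.
Lemma ct_fst {R : realType} {T : topologicalType} (x : R * T) : ctat (fun z : R * T => z.1) x.
Proof. exact: cvg_fst. Qed.
Lemma ct_snd {R : realType} {T : topologicalType} n (x : T * 'rV[R]_n) i :
  ctat (fun z : T * 'rV[R]_n => z.2 ord0 i) x.
Proof.
apply: (@continuous_comp _ _ _ (fun z : T * 'rV[R]_n => z.2) (fun u : 'rV[R]_n => u ord0 i)).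
  exact: cvg_snd.
exact: coord_continuous.
Qed.
Lemma ct_coord {R : realType} n (x : 'rV[R]_n) i :
  ctat (fun z : 'rV[R]_n => z ord0 i) x.
Proof. exact: coord_continuous. Qed.

Ltac ctn1 := lazymatch goal with
  | |- ctat (fun _ => ?c) _ => apply: ct_cst
  | |- ctat (fun z => (@?f z + @?g z)%R) _ => refine (@ctD _ _ f g _ _ _)
  | |- ctat (fun z => (- @?f z)%R) _ => refine (@ctN _ _ f _ _)
  | |- ctat (fun z => (@?f z * @?g z)%R) _ => refine (@ctM _ _ f g _ _ _)
  | |- ctat (fun z => (@?f z ^+ ?n)%R) _ => refine (@ctX _ _ f n _ _)
  | |- ctat (fun z => (@?f z)^-1%R) _ => refine (@ctV _ _ f _ _ _)
  | |- ctat (fun z => cosh (@?f z)) _ => refine (@ct_cosh _ _ f _ _)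
  | |- ctat (fun z => cos (@?f z)) _ => refine (@ct_cos _ _ f _ _)
  | |- ctat (fun z => sin (@?f z)) _ => refine (@ct_sin _ _ f _ _)
  | |- ctat (fun z => Num.sqrt (@?f z)) _ => refine (@ct_sqrt _ _ f _ _)
  | |- ctat (fun z => Num.max (@?f z) (@?g z)) _ => refine (@ct_max _ _ f g _ _ _)
  | |- ctat (fun z => Num.min (@?f z) (@?g z)) _ => refine (@ct_min _ _ f g _ _ _)
  | |- ctat _ _ => first
    [ match goal with H : forall A, ctat (fun z => ?a z A) _ |- ctat (fun z => ?a z ?B) _ => exact (H B) end | assumption | apply: ct_id | apply: ct_fst | apply: ct_snd | apply: ct_coord ]
  end.
Ltac ctn := repeat ctn1.

Section Near.
Context {R : realType}.

Lemma ct_nbhs_lt {T : topologicalType} (f : T -> R) x c : ctat f x -> f x < c ->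
  (\forall z \near x, f z < c)%classic.
Proof. by move=> hf h; exact: (@cvgr_lt _ _ _ _ _ _ hf). Qed.

Lemma ct_nbhs_gt {T : topologicalType} (f : T -> R) x c : ctat f x -> c < f x ->
  (\forall z \near x, c < f z)%classic.
Proof. by move=> hf h; exact: (@cvgr_gt _ _ _ _ _ _ hf). Qed.

Lemma near_left_ex (s0 : R) (P : R -> Prop) : 0 < s0 -> (\forall z \near s0, P z)%classic ->
  exists s, [/\ 0 <= s, s < s0 & P s].
Proof.
move=> s00 /nbhs_ballP[e /= e0 H].
exists (Num.max 0 (s0 - e / 2)); split.
- by rewrite le_max lexx.
- by rewrite gt_max s00 /=; lra.
- apply: H; rewrite /ball /=.
  have [h|h] := leP 0 (s0 - e / 2); rewrite ger0_norm; lra.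
Qed.
End Near.

Section PD.
Context {R : realType}.
Implicit Types (a v w : tet_edge -> R).

Lemma ct_Bil {T : topologicalType} (a v w : T -> tet_edge -> R) (x : T) :
  Bset (a x) -> (forall A, ctat (fun z => a z A) x) ->
  (forall A, ctat (fun z => v z A) x) -> (forall A, ctat (fun z => w z A) x) ->
  ctat (fun z => Bil (a z) (v z) (w z)) x.
Proof.
move=> Ba ca cv cw; apply: ct_sum => A; apply: ctM => //.
have [h1 h2 _ _] := Bset_hD Ba A.
rewrite /Bf /onQ /bq /bfun /bfunI /=.
rewrite /nf /hD.
ctn.
all: by rewrite gt_eqF.
Qed.

Lemma Bil_scale a v k : Bil a (fun A => k * v A) (fun A => k * v A) = k ^+ 2 * Bil a v v.
Proof.
rewrite /Bil mulr_sumr; apply: eq_bigr => A _.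
rewrite [X in _ * X = _](_ : _ = k * Bf a v A); first ring.
rewrite /Bf /onQ /bq /bfun /bfunI /=. ring.
Qed.

Lemma Bset_path (th : R) a (s : R) : 0 < th -> 3 * th < pi -> Bset a -> 0 <= s <= 1 ->
  Bset (fun A => th + s * (a A - th)).
Proof.
move=> th0 th1 [a0 [h1 h2 h3 h4]] /andP[s0 s1].
have key (x y : R) : 0 < x -> x + s * (y - x) > 0 \/ y <= 0.
  move=> x0; have [y0|] := ltP 0 y; [left|by right].
  rewrite (_ : _ + _ = (1 - s) * x + s * y); last by ring.
  have [->|sn] := eqVneq s 0; first lra.
  by apply: ltr_wpDl; [apply: mulr_ge0; lra | apply: mulr_gt0 => //; lra].
have key2 (x : R) : x < pi -> 3 * th + s * (x - 3 * th) < pi.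
  move=> xpi; rewrite -subr_gt0.
  rewrite (_ : pi - _ = (1 - s) * (pi - 3 * th) + s * (pi - x)); last by ring.
  have [->|sn] := eqVneq s 0; first lra.
  by apply: ltr_wpDl; [apply: mulr_ge0; lra | apply: mulr_gt0; lra].
split.
  by move=> A; have [] := key th (a A) th0; [by []|have := a0 A; lra].
have := key2 _ h1; have := key2 _ h2; have := key2 _ h3; have := key2 _ h4.
by move=> k4 k3 k2 k1; split; lra.
Qed.

(* Along the segment from a regular point the form stays nondegenerate, so it
   cannot lose positivity: at the first bad parameter it would be
   positive semidefinite with a nonzero isotropic vector. *)
Lemma Bil_pd (th : R) a v : 0 < th -> 3 * th < pi -> 1 / 2 < cos th -> cos th < 1 ->
  Bset a -> (exists A, v A != 0) -> 0 < Bil a v v.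
Proof.
move=> th0 th1 c0 c1 Ba [A0 vA0]; rewrite ltNge; apply/negP => bad.
pose n := #|{: tet_edge}|.
(* Clamping keeps every [pa s] in the angle domain, so that F is continuous on the whole product
   space. *)
pose cl (s : R) := Num.max 0 (Num.min 1 s).
have cl01 s : 0 <= cl s <= 1.
  by rewrite /cl le_max lexx ge_max ler01 ge_min lexx.
have clE s : 0 <= s <= 1 -> cl s = s.
  by move=> /andP[? ?]; rewrite /cl min_r // max_r.
pose pa (s : R) (A : tet_edge) := th + cl s * (a A - th).
have Bpa s : Bset (pa s) by apply: Bset_path.
pose of_row (u : 'rV[R]_n) (A : tet_edge) := u ord0 (enum_rank A).
pose q (u : 'rV[R]_n) := \sum_A of_row u A ^+ 2.
pose F (z : R * 'rV[R]_n) := Bil (pa z.1) (of_row z.2) (of_row z.2).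
have cF z : ctat F z.
  apply: ct_Bil => // A; rewrite /pa /of_row /cl; ctn.
have cq u : ctat q u by apply: ct_sum => A; rewrite /of_row; ctn.
(* Parameters and unit vectors at which positivity fails; a point of K with least parameter is the
   first failure. *)
pose K := ((`[0, 1]%classic `*` [set u | q u = 1]) `&` [set z | F z <= 0])%classic.
have cK : compact K.
  apply: compact_closedI; last first.
    apply: (@closed_comp _ _ F [set x | x <= 0]%classic); first by move=> z _; exact: cF.
    exact: closed_le.
  apply: compact_setX; first exact: segment_compact.
  apply: bounded_closed_compact; last first.
    apply: (@closed_comp _ _ q [set x | x = 1]%classic); first by move=> z _; exact: cq.
    exact: closed_eq.
  exists 1; split; first exact: num_real.
  move=> M M1 u /= qu; rewrite [leLHS]/Num.norm /= mx_normrE.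
  apply: bigmax_le => [|[i j] _ /=]; first by lra.
  rewrite (ord1 i) -[j]enum_valK -/(of_row u _).
  apply: le_trans (ltW M1).
  rewrite -(@ler_pXn2r _ 2) ?nnegrE // expr1n real_normK ?num_real // -qu.
  rewrite /q (bigD1 (enum_val j)) //= lerDl sumr_ge0 // => B _; exact: sqr_ge0.
have unit w : (exists A, w A != 0) -> exists k u, [/\ 0 < k, q u = 1 &
    forall A, of_row u A = k * w A].
  move=> [A wA].
  have S0 : 0 < \sum_A w A ^+ 2.
    rewrite (bigD1 A) //= ltr_wpDr ?sumr_ge0 //.
      by move=> B _; exact: sqr_ge0.
    by rewrite lt_def sqr_ge0 sqrf_eq0 wA.
  pose k := (Num.sqrt (\sum_A w A ^+ 2))^-1.
  have k0 : 0 < k by rewrite invr_gt0 sqrtr_gt0.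
  exists k, (\row_i (k * w (enum_val i))); split => //.
    rewrite /q (eq_bigr (fun A => k ^+ 2 * w A ^+ 2)); last first.
      by move=> B _; rewrite /of_row mxE enum_rankK exprMn.
    rewrite -mulr_sumr /k exprVn sqr_sqrtr ?ltW // mulVf // gt_eqF //.
  by move=> B; rewrite /of_row mxE enum_rankK.
have K0 : (K !=set0)%classic.
  have [k [u [k0 qu uE]]] := unit v (ex_intro _ A0 vA0).
  exists (1, u); split; [split => //=|]; first by rewrite in_itv /= ler01 lexx.
  rewrite /= /F /=.
  have -> : of_row u = (fun A => k * v A) by apply/funext => A; exact: uE.
  have -> : pa 1 = a by apply/funext => A; rewrite /pa clE ?lexx ?ler01 //; ring.
  rewrite Bil_scale pmulr_rle0 // exprn_gt0 //.
have [|z0] := @compact_EVT_min _ R (fun z => z.1) K K0 cK.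
  apply: continuous_subspaceT => z; exact: ct_fst.
rewrite inE => -[[/= s01 qu] Fz] zmin; move: s01; rewrite in_itv /= => s01.
set s0 := z0.1 in s01 zmin.
have pos s w : 0 <= s -> s < s0 -> 0 <= Bil (pa s) w w.
  move=> s_ge0 ss; have [/existsP[A wA]|/existsPn w0] := boolP [exists A, w A != 0]; last first.
    rewrite /Bil big1 // => A _; move: (w0 A); rewrite negbK => /eqP ->.
    by rewrite mul0r.
  have [k [u [k0 qu' uE]]] := unit w (ex_intro _ A wA).
  have : 0 <= F (s, u).
    rewrite leNgt; apply/negP => Fn; have := zmin (s, u).
    rewrite inE => H; have /= := H _; rewrite leNgt ss => H'.
    suff : false by []. apply: H'; split; last exact: ltW.
    split => //=; rewrite in_itv /= s_ge0 /=; move/andP: s01 => [_ h].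
    by rewrite (le_trans (ltW ss)).
  rewrite /F /=.
  have -> : of_row u = (fun A => k * w A) by apply/funext => B; exact: uE.
  by rewrite Bil_scale pmulr_rge0 // exprn_gt0.
have unz : exists A, of_row z0.2 A != 0.
  have [/existsP //|/existsPn u0] := boolP [exists A, of_row z0.2 A != 0].
  move: qu; rewrite /= /q big1; first by move/eqP; rewrite eq_sym oner_eq0.
  by move=> A _; move: (u0 A); rewrite negbK => /eqP ->; rewrite expr0n.
have s0_gt0 : 0 < s0.
  rewrite lt_def; move/andP: (s01) => [-> _]; rewrite andbT; apply/negP => /eqP s00.
  move: Fz; rewrite /= /F -/s0 s00.
  have -> : pa 0 = fun=> th by apply/funext => A; rewrite /pa clE ?lexx ?ler01 //; ring.
  by rewrite leNgt Bil_regular.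
have pos0 w : 0 <= Bil (pa s0) w w.
  rewrite leNgt; apply/negP => neg.
  have cs : ctat (fun s : R => Bil (pa s) w w) s0.
    apply: ct_Bil => // A; rewrite /pa /cl; ctn.
  have [s [h1 h2]] := near_left_ex s0_gt0 (ct_nbhs_lt cs neg).
  by rewrite ltNge pos.
have [A] := unz; rewrite (@Bil_kernel _ (pa s0) (of_row z0.2)) ?eqxx //.
by apply/eqP; rewrite eq_le Fz pos0.
Qed.
End PD.

(** * Derivatives of the lengths along lines in the space of angles *)

Section Deriv.
Context {R : realType}.

(* A plain proposition, to keep class resolution out of [apply:]. *)
Definition dv (x : R) (f : R -> R) (d : R) : Prop := is_derive x 1 f d.

Implicit Types (f g : R -> R) (x : R).

Lemma dv_eq f x d d' : dv x f d -> d = d' -> dv x f d'.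
Proof. by move=> h <-. Qed.
Lemma dv_cst (c : R) x : dv x (fun=> c) 0.
Proof. exact: is_derive_cst. Qed.
Lemma dvD f g x df dg : dv x f df -> dv x g dg ->
  dv x (fun z => f z + g z) (df + dg).
Proof. exact: is_deriveD. Qed.
Lemma dvN f x df : dv x f df -> dv x (fun z => - f z) (- df).
Proof. exact: is_deriveN. Qed.
Lemma dvM f g x df dg : dv x f df -> dv x g dg ->
  dv x (fun z => f z * g z) (f x * dg + g x * df).
Proof. exact: is_deriveM. Qed.
Lemma dvX2 f x df : dv x f df ->
  dv x (fun z => f z ^+ 2) (2 * f x * df).
Proof. by move=> h; apply: dv_eq; [exact: (dvM h h) | ring]. Qed.
Lemma dvV f x df : f x != 0 -> dv x f df ->
  dv x (fun z => (f z)^-1) (- (f x ^- 2 * df)).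
Proof. by move=> h1 h2; apply: dv_eq; [exact: (is_deriveV h1 h2)|]; rewrite /GRing.scale /= mulNr. Qed.
Lemma dv_comp (h : R -> R) f x dh df : dv (f x) h dh -> dv x f df ->
  dv x (fun z => h (f z)) (dh * df).
Proof. exact: is_derive1_comp. Qed.
Lemma dv_id x : dv x (fun z => z) 1.
Proof. exact: is_derive_id. Qed.

Lemma dv_nf (f1 f2 f3 f4 f5 f6 : R -> R) x d1 d2 d3 d4 d5 d6 :
  dv x f1 d1 -> dv x f2 d2 -> dv x f3 d3 ->
  dv x f4 d4 -> dv x f5 d5 -> dv x f6 d6 ->
  dv x (fun z => nf (f1 z) (f2 z) (f3 z) (f4 z) (f5 z) (f6 z))
    (dnf (f1 x) (f2 x) (f3 x) (f4 x) (f5 x) (f6 x) d1 d2 d3 d4 d5 d6).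
Proof.
move=> h1 h2 h3 h4 h5 h6; rewrite /nf.
apply: dv_eq.
  apply: dvD; first apply: dvD; first apply: dvD.
  - by apply: (dvM h1); apply: dvD; [exact: (dvM h2 h5)|exact: (dvM h3 h4)].
  - exact: (dvM h2 h4).
  - exact: (dvM h3 h5).
  - apply: (dvM h6); apply: dvD; [exact: dv_cst|apply: dvN; exact: (dvX2 h1)].
by rewrite /dnf; ring.
Qed.

Lemma dv_hD (f1 f2 f3 : R -> R) x d1 d2 d3 :
  dv x f1 d1 -> dv x f2 d2 -> dv x f3 d3 ->
  dv x (fun z => hD (f1 z) (f2 z) (f3 z)) (dhD (f1 x) (f2 x) (f3 x) d1 d2 d3).
Proof.
move=> h1 h2 h3; rewrite /hD.
apply: dv_eq.
  apply: dvD; last exact: dv_cst.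
  apply: dvD; last exact: (dvX2 h3).
  apply: dvD; last exact: (dvX2 h2).
  apply: dvD; last exact: (dvX2 h1).
  by apply: dvM h3; apply: dvM h2; apply: dvM h1; exact: dv_cst.
by rewrite /dhD; ring.
Qed.

Lemma dv_arcosh u : 1 < u -> dv u (@arcosh R) (Num.sqrt (u ^+ 2 - 1))^-1.
Proof.
move=> u1; rewrite /arcosh.
have s0 : 0 < u ^+ 2 - 1 by rewrite subr_gt0 expr_gt1 // ltW // (lt_trans ltr01).
have w0 : 0 < u + Num.sqrt (u ^+ 2 - 1).
  by rewrite addr_gt0 ?sqrtr_gt0 // (lt_trans ltr01).
apply: dv_eq.
  apply: (dv_comp (h := @ln R)); first exact: is_derive1_ln.
  apply: dvD; first exact: dv_id.
  apply: (dv_comp (h := @Num.sqrt R)); first exact: is_derive1_sqrt.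
  apply: dvD; last exact: dv_cst.
  by apply: dvX2; exact: dv_id.
have : Num.sqrt (u ^+ 2 - 1) != 0 by rewrite gt_eqF // sqrtr_gt0.
move: (Num.sqrt _) w0 => w w0 wn.
by field; rewrite wn gt_eqF.
Qed.

Lemma dv_arcosh_ratio (N D1 D2 : R -> R) x dN dD1 dD2 :
  0 < D1 x -> 0 < D2 x -> 1 < N x / Num.sqrt (D1 x * D2 x) ->
  dv x N dN -> dv x D1 dD1 -> dv x D2 dD2 ->
  dv x (fun z => arcosh (N z / Num.sqrt (D1 z * D2 z)))
   ((dN - N x * (dD1 / (2 * D1 x) + dD2 / (2 * D2 x))) / Num.sqrt (N x ^+ 2 - D1 x * D2 x)).
Proof.
move=> d1 d2 z1 hN h1 h2.
have p0 : 0 < D1 x * D2 x by rewrite mulr_gt0.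
have r0 : Num.sqrt (D1 x * D2 x) != 0 by rewrite gt_eqF // sqrtr_gt0.
apply: dv_eq.
  apply: (dv_comp (h := @arcosh R)); first exact: dv_arcosh.
  apply: (dvM hN); apply: dvV => //.
  apply: (dv_comp (h := @Num.sqrt R)); first exact: is_derive1_sqrt.
  exact: (dvM h1 h2).
have rE : Num.sqrt (D1 x * D2 x) ^+ 2 = D1 x * D2 x by rewrite sqr_sqrtr // ltW.
have -> : (N x / Num.sqrt (D1 x * D2 x)) ^+ 2 - 1 =
   (N x ^+ 2 - D1 x * D2 x) / (D1 x * D2 x).
  by rewrite expr_div_n rE; field; rewrite !gt_eqF.
have q0 : 0 < N x ^+ 2 - D1 x * D2 x.
  have : 0 < (N x / Num.sqrt (D1 x * D2 x)) ^+ 2 - 1.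
    by rewrite subr_gt0 expr_gt1 // ltW // (lt_trans ltr01).
  rewrite expr_div_n rE -(pmulr_lgt0 _ p0) mulrBl mul1r -mulrA mulVf ?mulr1 //.
  by rewrite gt_eqF.
rewrite sqrtrM ?ltW // sqrtrV ?ltW //.
have : Num.sqrt (N x ^+ 2 - D1 x * D2 x) != 0 by rewrite gt_eqF // sqrtr_gt0.
move: (Num.sqrt (N x ^+ 2 - D1 x * D2 x)) => w wn.
move: (Num.sqrt (D1 x * D2 x)) rE r0 => r rE r0.
rewrite [LHS](_ : _ = w^-1 * (dN - N x * (D1 x * dD2 + D2 x * dD1) / (2 * r ^+ 2))).
  by rewrite rE; field; rewrite wn !gt_eqF.
by field; rewrite wn r0.
Qed.

(** In [dv_arcosh_ratio] the root is sin a_ij times sqrt (- det) by [nf_sqr], and the numerator is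
    sin a_ij times [Bf] by [bfunE]; the sine cancels. *)
Lemma dv_len (a v : tet_edge -> R) s A : Bset (fun B => a B + s * v B) ->
  dv s (fun r => len (fun B => a B + r * v B) A)
    (Bf (fun B => a B + s * v B) v A / Num.sqrt (- detv (fun B => cos (a B + s * v B)))).
Proof.
move=> Ba.
have dy B : dv s (fun r => cos (a B + r * v B)) (- sin (a B + s * v B) * v B).
  apply: (dv_comp (h := @cos R)); first exact: is_derive_cos.
  apply: dv_eq; first apply: dvD; first exact: dv_cst.
    by apply: dvM; [exact: dv_id | exact: dv_cst].
  by rewrite add0r mulr0 add0r mulr1.
have [h1 h2 _ _] := Bset_hD Ba A.
have hN := Bset_nf Ba A.
have hd := Bset_detv Ba.
have sA := Bset_sin Ba A.
have eC := onQ_detv (fun B => cos (a B + s * v B)) A.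
pose Y r B := cos (a B + r * v B).
pose i := endpt (tet_edge_set A) 0; pose j := endpt (tet_edge_set A) 1.
pose k := endpt (~: tet_edge_set A) 0; pose h := endpt (~: tet_edge_set A) 1.
have dN := dv_nf (dy (te i j)) (dy (te i k)) (dy (te i h)) (dy (te j k)) (dy (te j h))
  (dy (te k h)).
have dD1 := dv_hD (dy (te i j)) (dy (te i k)) (dy (te i h)).
have dD2 := dv_hD (dy (te i j)) (dy (te j k)) (dy (te j h)).
have z1 : 1 < onQ nf (Y s) A / Num.sqrt (onQ (fun C p p' _ _ _ => hD C p p') (Y s) A *
    onQ (fun C _ _ q q' _ => hD C q q') (Y s) A).
  apply: phr_gt1 => //; first by rewrite -(onQ_detv _ A) in hd.
  rewrite -subr_gt0 -sinS_cos exprn_gt0 //; exact: (Bset_sin Ba).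
apply: dv_eq.
  exact: (@dv_arcosh_ratio (fun r => onQ nf (Y r) A)
    (fun r => onQ (fun C p p' _ _ _ => hD C p p') (Y r) A)
    (fun r => onQ (fun C _ _ q q' _ => hD C q q') (Y r) A) s _ _ _ h1 h2 z1 dN dD1 dD2).
set sqrtNdet := Num.sqrt _; rewrite /Bf.
have -> : sqrtNdet = sin (onQ (fun C _ _ _ _ _ => C) (fun B => a B + s * v B) A) *
    Num.sqrt (- detv (Y s)).
  rewrite /sqrtNdet nf_sqr -(onQ_detv _ A) sqrtrM; last first.
    by rewrite oppr_ge0 ltW //; move: hd; rewrite -(onQ_detv _ A).
  by rewrite mulrC -sinS_cos sqrtr_sqr ger0_norm // ltW // (Bset_sin Ba).
rewrite [X in X / _](_ : _ = sin (onQ (fun C _ _ _ _ _ => C) (fun B => a B + s * v B) A) *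
   onQ bq (fun B => (a B + s * v B, v B)) A).
  rewrite invfM mulrACA divff ?mul1r // gt_eqF // (Bset_sin Ba) //.
rewrite /onQ /bq bfunE ?gt_eqF ?sinS_cos //.
Qed.
End Deriv.

(** * Monotonicity of the lengths *)

Section Mono.
Context {R : realType}.
Implicit Types (a v w : tet_edge -> R).

Lemma cos_pi3 : cos (pi / 3) = 1 / 2 :> R.
Proof.
have p0 := pi_gt0 R.
have c0 : 0 < cos (pi / 3) :> R by apply: cos_gt0_pihalf; lra.
have : cos (pi / 3 + (pi / 3 + pi / 3)) = -1 :> R by rewrite -cospi; congr cos; field.
rewrite !cosD sinD; have := sin2cos2 (pi / 3 : R).
move: (cos _) (sin _) c0 => c s c0 sE H.
(* cos (3 x) = -1 at x = pi / 3 reads 4 c^3 - 3 c + 1 = 0, and c > 0 excludes the root -1. *)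
have : (c + 1) * (2 * c - 1) ^+ 2 = 0.
  have -> : (c + 1) * (2 * c - 1) ^+ 2 = c * (c * c - s * s) - s * (s * c + c * s) + 1
     - 3 * c * (1 - c ^+ 2 - s ^+ 2) by ring.
  rewrite H sE; ring.
move/eqP; rewrite mulf_eq0 sqrf_eq0 => /orP[] /eqP; lra.
Qed.

Lemma cos_gt_half (th : R) : 0 < th -> 3 * th < pi -> 1 / 2 < cos th /\ cos th < 1.
Proof.
move=> th0 th1; have p0 := pi_gt0 R; split.
  by rewrite -cos_pi3 cos_ltE; lra.
by rewrite -[ltRHS]cos0 cos_ltE; lra.
Qed.

Lemma Bset_Bil_ge0 a v : Bset a -> 0 <= Bil a v v.
Proof.
move=> Ba; have p0 := pi_gt0 R.
have [/existsP ex|/existsPn v0] := boolP [exists A, v A != 0]; last first.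
  by rewrite /Bil big1 // => A _; move: (v0 A); rewrite negbK => /eqP ->; rewrite mul0r.
(* Any regular point can start the path of [Bil_pd]; pi / 6 is one. *)
have th0 : 0 < pi / 6 :> R by lra.
have th1 : 3 * (pi / 6) < pi :> R by lra.
have [c0 c1] := cos_gt_half th0 th1.
by apply: ltW; exact: (Bil_pd th0 th1).
Qed.

Lemma Bset_conv a a' s : Bset a -> Bset a' -> 0 <= s <= 1 ->
  Bset (fun A => a A + s * (a' A - a A)).
Proof.
move=> [a0 [h1 h2 h3 h4]] [b0 [k1 k2 k3 k4]] /andP[s0 s1].
have key (x y : R) : 0 < x -> 0 < y -> 0 < x + s * (y - x).
  move=> x0 y0; rewrite (_ : _ + _ = (1 - s) * x + s * y); last by ring.
  have [->|sn] := eqVneq s 0; first lra.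
  by apply: ltr_wpDl; [apply: mulr_ge0; lra | apply: mulr_gt0 => //; lra].
have key2 (x y : R) : x < pi -> y < pi -> x + s * (y - x) < pi.
  move=> xp yp; have := key (pi - x) (pi - y); rewrite !subr_gt0 => /(_ xp yp).
  by rewrite (_ : pi - y - (pi - x) = - (y - x)); [lra | ring].
split; first by move=> A; exact: key.
have := key2 _ _ h1 k1; have := key2 _ _ h2 k2; have := key2 _ _ h3 k3.
by have := key2 _ _ h4 k4 => q4 q3 q2 q1; split; lra.
Qed.

Lemma dv_continuous (f : R -> R) x d : dv x f d -> {for x, continuous f}.
Proof.
by move=> [h _]; apply: differentiable_continuous; exact/derivable1_diffP.
Qed.

Lemma dv_le (f df : R -> R) (a b : R) : a <= b ->
  (forall s, a <= s <= b -> dv s f (df s)) ->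
  (forall s, a <= s <= b -> 0 <= df s) -> f a <= f b.
Proof.
move=> ab h h0.
have [||c] := @MVT_segment R f df a b ab.
- by move=> x; rewrite in_itv /= => /andP[x0 x1]; apply: h; rewrite !ltW.
- apply: continuous_in_subspaceT => x; rewrite inE /= in_itv /= => xab.
  exact: (dv_continuous (h _ xab)).
rewrite in_itv /= => cab E; rewrite -subr_ge0 E mulr_ge0 ?subr_ge0 // h0 //.
Qed.

Lemma dv_sum (I : Type) (r : seq I) (F : I -> R -> R) (dF : I -> R) x :
  (forall i, dv x (F i) (dF i)) ->
  dv x (fun z => \sum_(i <- r) F i z) (\sum_(i <- r) dF i).
Proof.
move=> h; elim: r => [|i r IH].
  rewrite big_nil (_ : (fun z => _) = fun=> 0); first exact: dv_cst.
  by apply/funext => z; rewrite big_nil.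
rewrite big_cons (_ : (fun z => _) = fun z => F i z + \sum_(j <- r) F j z).
  exact: dvD.
by apply/funext => z; rewrite big_cons.
Qed.

Definition sqrtNdet a := Num.sqrt (- detv (fun B => cos (a B))).

Lemma sqrtNdet_gt0 a : Bset a -> 0 < sqrtNdet a.
Proof. by move=> Ba; rewrite sqrtr_gt0 oppr_gt0 Bset_detv. Qed.

Lemma dv_sum_len a v u s : Bset (fun B => a B + s * v B) ->
  dv s (fun r => \sum_A u A * len (fun B => a B + r * v B) A)
   (Bil (fun B => a B + s * v B) v u / sqrtNdet (fun B => a B + s * v B)).
Proof.
move=> Ba; rewrite /Bil mulr_suml; apply: dv_sum => A.
apply: dv_eq; first by apply: dvM; [exact: dv_cst | exact: dv_len].
by rewrite /= mulr0 addr0 mulrA.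
Qed.

Lemma len_mono a a' : Bset a -> Bset a' ->
  0 <= \sum_A (a' A - a A) * (len a' A - len a A).
Proof.
move=> Ba Ba'; pose v A := a' A - a A.
have B01 s : 0 <= s <= 1 -> Bset (fun B => a B + s * v B) by exact: Bset_conv.
have := @dv_le _ _ 0 1 ler01 (fun s hs => dv_sum_len v (B01 s hs)).
have -> : (fun B => a B + 0 * v B) = a by apply/funext => B; ring.
have -> : (fun B => a B + 1 * v B) = a' by apply/funext => B; rewrite /v; ring.
move=> H; rewrite (eq_bigr (fun A => v A * len a' A - v A * len a A)); last first.
  by move=> A _; rewrite mulrBr.
rewrite big_split /= sumrN subr_ge0; apply: H => s /B01 Bs.
by rewrite divr_ge0 ?(ltW (sqrtNdet_gt0 Bs)) // Bset_Bil_ge0.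
Qed.

(* Integrating [2 B(v, w) <= L B(v, v) + B(w, w) / L] along the segment. *)
Lemma len_cocoercive a a' (L : R) : 0 < L -> Bset a -> Bset a' ->
  (forall s w, 0 <= s <= 1 -> let b := fun B => a B + s * (a' B - a B) in
     Bil b w w / sqrtNdet b <= L * \sum_A w A ^+ 2) ->
  \sum_A (len a' A - len a A) ^+ 2 <= L * \sum_A (a' A - a A) * (len a' A - len a A).
Proof.
move=> L0 Ba Ba' HL; pose v A := a' A - a A; pose w A := len a' A - len a A.
have B01 s : 0 <= s <= 1 -> Bset (fun B => a B + s * v B) by exact: Bset_conv.
(* Completing the square: B(v, u) + B(w, w) / L^2 = B(v - w / L, v - w / L) >= 0. The summand r W /
   L added below dominates the second term, by the bound on the form. *)
pose u A := v A - 2 / L * w A.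
pose W := \sum_A w A ^+ 2.
have D s (hs : 0 <= s <= 1) : dv s
   (fun r => \sum_A u A * len (fun B => a B + r * v B) A + r * (W / L))
   (Bil (fun B => a B + s * v B) v u / sqrtNdet (fun B => a B + s * v B) + W / L).
  apply: dvD; first exact: (dv_sum_len u (B01 s hs)).
  apply: dv_eq; first by apply: dvM; [exact: dv_id|exact: dv_cst].
  by rewrite mulr0 add0r mulr1.
have := @dv_le _ _ 0 1 ler01 D.
have -> : (fun B => a B + 0 * v B) = a by apply/funext => B; ring.
have -> : (fun B => a B + 1 * v B) = a' by apply/funext => B; rewrite /v; ring.
move=> H.
have {H} : \sum_A u A * len a A + 0 * (W / L) <= \sum_A u A * len a' A + 1 * (W / L).
  apply: H => s hs; have Bs := B01 s hs; set b := fun B => a B + s * v B in Bs *.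
  have bL : Bil b w w / sqrtNdet b <= L * W by exact: HL.
  have := Bset_Bil_ge0 (fun A => v A + (- (1 / L)) * w A) Bs.
  have ub : Bil b v u = Bil b v v - 2 / L * Bil b v w.
    have -> : u = fun A => v A + (- (2 / L)) * w A by apply/funext => A; rewrite mulNr.
    by rewrite Bil_sym Bil_linl (Bil_sym b w) mulNr.
  rewrite Bil_quad ub => pos.
  have d0 := sqrtNdet_gt0 Bs.
  have E : (Bil b v v + 2 * - (1 / L) * Bil b v w + (- (1 / L)) ^+ 2 * Bil b w w) / sqrtNdet b
     = (Bil b v v - 2 / L * Bil b v w) / sqrtNdet b + (1 / L) ^+ 2 * (Bil b w w / sqrtNdet b).
    by field; rewrite !gt_eqF.
  have : 0 <= (Bil b v v - 2 / L * Bil b v w) / sqrtNdet b + (1 / L) ^+ 2 * (Bil b w w / sqrtNdet b).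
    by rewrite -E divr_ge0 // ltW.
  move=> h; apply: (le_trans h); rewrite lerD2l.
  apply: (@le_trans _ _ ((1 / L) ^+ 2 * (L * W))); first by rewrite ler_wpM2l // sqr_ge0.
  by rewrite le_eqVlt; apply/orP; left; apply/eqP; field; rewrite gt_eqF.
rewrite mul0r addr0 mul1r -lerBlDl -sumrB => H.
have : - (\sum_A u A * w A) <= W / L.
  apply: le_trans H; rewrite le_eqVlt; apply/orP; left; apply/eqP.
  by rewrite -sumrN; apply: eq_bigr => A _; rewrite /w; ring.
have -> : \sum_A u A * w A = \sum_A v A * w A - 2 / L * W.
  by rewrite /W mulr_sumr -sumrB; apply: eq_bigr => A _; rewrite /u; ring.
rewrite -/(\sum_A v A * w A); set S := \sum_A v A * w A.
move=> h.
have : W / L <= S.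
  by rewrite -subr_ge0; have : 0 <= S - W / L by [move: h; rewrite opprB -mulrA [L^-1 * W]mulrC; lra].
by rewrite ler_pdivrMr // mulrC.
Qed.
End Mono.

(** * Extended angles *)

Section Ext.
Context {R : realType}.
Implicit Types (l w : tet_edge -> R).

Definition clacos (x : R) := acos (Num.max (-1) (Num.min 1 x)).

Lemma clamp_itv (x : R) : -1 <= Num.max (-1) (Num.min 1 x) <= 1.
Proof. by rewrite le_max lexx /= ge_max ge_min lexx /= andbT; lra. Qed.

Lemma clacos_ge0 x : 0 <= clacos x. Proof. exact/acos_ge0/clamp_itv. Qed.
Lemma clacos_lepi x : clacos x <= pi. Proof. exact/acos_lepi/clamp_itv. Qed.
Lemma cos_clacos x : cos (clacos x) = Num.max (-1) (Num.min 1 x).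
Proof. by rewrite acosK // in_itv /= clamp_itv. Qed.

(** The ends of [0, pi] are covered too: as cos decreases strictly, each one-sided bound on [clacos]
    pulls back to a bound on the clamped value, and a bound outside [0, pi] holds trivially. *)
Lemma clacos_continuous x : {for x, continuous clacos}.
Proof.
pose cl (y : R) := Num.max (-1) (Num.min 1 y).
have clE y : cl y = cos (clacos y) by rewrite cos_clacos.
have ccl : ctat cl x by rewrite /cl; ctn.
apply/cvgrPdist_lt => e e0.
have near1 : (\forall y \near x, clacos y < clacos x + e)%classic.
  have [h|h] := ltP pi (clacos x + e).
    by apply: filterE => y; apply: le_lt_trans h; exact: clacos_lepi.
  have h1 : cos (clacos x + e) < cl x.
    by rewrite clE cos_ltE ?ltrDl ?clacos_ge0 ?clacos_lepi ?h ?andbT //; have := clacos_ge0 x; lra.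
  apply: filterS (ct_nbhs_gt ccl h1) => y; rewrite clE cos_ltE //.
    by have := clacos_ge0 x; rewrite h andbT; lra.
  by rewrite clacos_ge0 clacos_lepi.
have near2 : (\forall y \near x, clacos x - e < clacos y)%classic.
  have [h|h] := ltP (clacos x - e) 0.
    by apply: filterE => y; apply: lt_le_trans h _; exact: clacos_ge0.
  have h1 : cl x < cos (clacos x - e).
    by rewrite clE cos_ltE ?h ?clacos_ge0 ?clacos_lepi //; have := clacos_lepi x; lra.
  apply: filterS (ct_nbhs_lt ccl h1) => y; rewrite clE cos_ltE //.
    by rewrite clacos_ge0 clacos_lepi.
  by have := clacos_lepi x; rewrite h /=; lra.
apply: filterS2 near1 near2 => y h1 h2.
by rewrite ltr_distlC; apply/andP; split; lra.
Qed.

Lemma ext_angleE l A : ext_angle l A = clacos (onQ phd (fun B => cosh (Num.max 0 (l B))) A).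
Proof. by rewrite /ext_angle phi_phd. Qed.

Lemma clacos_id (x : R) : `|x| < 1 -> clacos x = acos x.
Proof.
rewrite ltr_norml => /andP[h1 h2]; rewrite /clacos.
by rewrite min_r ?max_r ?ltW.
Qed.

Lemma clacos_ge1 (x : R) : 1 <= x -> clacos x = 0.
Proof. by move=> h; rewrite /clacos min_l // max_r ?acos1 //; lra. Qed.

Lemma clacos_leN1 (x : R) : x <= -1 -> clacos x = pi.
Proof.
move=> h; rewrite /clacos min_r; last by lra.
by rewrite max_l // acosN1.
Qed.

Lemma ext_angle_pos l A : (forall B, 0 <= l B) ->
  ext_angle l A = clacos (onQ phd (fun B => cosh (l B)) A).
Proof.
move=> l0; rewrite ext_angleE.
rewrite (_ : (fun B => cosh (Num.max 0 (l B))) = fun B => cosh (l B)) //.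
by apply/funext => B; rewrite max_r.
Qed.

Lemma ext_angle_Lset l A : Lset l -> ext_angle l A = ang l A.
Proof.
move=> Ll; rewrite ext_angle_pos; last by move=> B; apply: ltW; case: Ll.
by rewrite clacos_id // Lset_norm.
Qed.

Lemma ct_phd {T : topologicalType} (c : T -> tet_edge -> R) x A :
  (forall B, 1 <= c x B) -> (forall B, ctat (fun z => c z B) x) ->
  ctat (fun z => onQ phd (c z) A) x.
Proof.
move=> c1 hc; rewrite /onQ /phd /phr /nf /hD; ctn.
rewrite gt_eqF // sqrtr_gt0 mulr_gt0 //; exact: lt_le_trans (hD_ge1 _ _ _).
Qed.

Lemma ct_ext {T : topologicalType} (l : T -> tet_edge -> R) x A :
  (forall B, ctat (fun z => l z B) x) -> ctat (fun z => ext_angle (l z) A) x.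
Proof.
move=> hl.
rewrite (_ : (fun z => _) = fun z => clacos (onQ phd (fun B => cosh (Num.max 0 (l z B))) A)).
  apply: (ct_comp (h := clacos)); first exact: clacos_continuous.
  apply: ct_phd => B; first exact: cosh_ge1.
  by ctn.
by apply/funext => z; rewrite ext_angleE.
Qed.

Lemma Lset_mono l0 l1 : Lset l0 -> Lset l1 ->
  0 <= \sum_A (ext_angle l1 A - ext_angle l0 A) * (l1 A - l0 A).
Proof.
move=> L0 L1; have := len_mono (Lset_Bset L0) (Lset_Bset L1).
by congr (0 <= _); apply: eq_bigr => A _; rewrite !ext_angle_Lset // !len_ang.
Qed.

Lemma ct_detl {T : topologicalType} (l : T -> tet_edge -> R) x :
  (forall B, ctat (fun z => l z B) x) ->
  ctat (fun z => detl (fun B => cosh (l z B))) x.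
Proof. move=> hl; rewrite /detl /dtd /dt; ctn. Qed.

Lemma degenerate_norm l A : (forall B, 0 < l B) -> ~~ (detl (fun B => cosh (l B)) < 0) ->
  1 <= `|onQ phd (fun B => cosh (l B)) A|.
Proof.
move=> l0 d; rewrite leNgt /onQ phd_lt1 ?cosh_gt1 //.
by rewrite -(onQ_detl _ A) in d.
Qed.

(* Outside of [Lset] every angle is 0 or pi, hence locally constant. *)
Lemma ext_mono_pos l0 l1 : Lset l0 -> (forall A, 0 < l1 A) ->
  0 <= \sum_A (ext_angle l1 A - ext_angle l0 A) * (l1 A - l0 A).
Proof.
move=> L0 p1; pose w A := l1 A - l0 A.
pose l (s : R) A := l0 A + s * w A.
have p0 A : 0 < l0 A by case: L0.
have ls0 : l 0 = l0 by apply/funext => A; rewrite /l; ring.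
have ls1 : l 1 = l1 by apply/funext => A; rewrite /l /w; ring.
have lpos s A : 0 <= s <= 1 -> 0 < l s A.
  move=> /andP[s0 s1]; rewrite /l /w (_ : _ + _ = (1 - s) * l0 A + s * l1 A); last by ring.
  have [->|sn] := eqVneq s 0; first by have := p0 A; lra.
  by apply: ltr_wpDl; [apply: mulr_ge0; [lra|exact: ltW] | apply: mulr_gt0 => //; lra].
have cl s A : ctat (fun z => l z A) s by rewrite /l; ctn.
pose f (s : R) := \sum_A ext_angle (l s) A * w A.
pose d (s : R) := detl (fun A => cosh (l s A)).
have cf s : ctat f s by apply: ct_sum => A; apply: ctM; [exact: ct_ext | exact: ct_cst].
have cd s : ctat d s by exact: ct_detl.
have Lls s : 0 <= s <= 1 -> d s < 0 -> Lset (l s) by move=> hs ds; split=> // A; exact: lpos.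
(* [Lset_mono] joins the two points in the space of angles, so the segment of lengths may leave
   [Lset] in between. *)
have fU s : 0 <= s <= 1 -> d s < 0 -> f 0 <= f s.
  move=> hs ds; have := Lset_mono L0 (Lls s hs ds).
  have [->//|sn] := eqVneq s 0.
  have -> : \sum_A (ext_angle (l s) A - ext_angle l0 A) * (l s A - l0 A) = s * (f s - f 0).
    rewrite /f -sumrB mulr_sumr; apply: eq_bigr => A _; rewrite ls0 /l; ring.
  by rewrite pmulr_rge0 ?subr_ge0 // lt_def sn; case/andP: hs.
suff : f 0 <= f 1.
  rewrite /f ls0 ls1 -subr_ge0 -sumrB.
  by congr (0 <= _); apply: eq_bigr => A _; rewrite mulrBl.
have [d1|d1] := boolP (d 1 < 0); first by apply: fU => //; rewrite ler01 lexx.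
(* At the supremum u of the hyper-ideal parameters f 0 <= f u by continuity, and from u on every
   length vector is degenerate. *)
pose U := [set s : R | 0 <= s <= 1 /\ d s < 0]%classic.
have U0 : U 0 by split; [rewrite lexx ler01 | rewrite /d ls0; case: L0].
have hU : has_sup U by split; [exists 0 | exists 1 => s [/andP[]]].
pose u := sup U.
have u0 : 0 <= u by apply: ub_le_sup => //; case: hU.
have u1 : u <= 1 by apply: ge_sup; [exists 0 | move=> s [/andP[]]].
have fu : f 0 <= f u.
  rewrite leNgt; apply/negP => neg.
  have /nbhs_ballP[e /= e0 He] := ct_nbhs_lt (cf u) neg.
  have [s Us se] := sup_adherent e0 hU.
  have su : s <= u by apply: ub_le_sup => //; case: hU.
  have : f s < f 0.
    by apply: He; rewrite /ball /= ger0_norm; rewrite -/u in se; lra.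
  by rewrite ltNge fU //; case: Us.
have du : ~~ (d u < 0).
  apply/negP => neg.
  have u1' : u < 1 by rewrite lt_def u1 andbT; apply/eqP => E; move: neg; rewrite -E (negPf d1).
  have /nbhs_ballP[e /= e0 He] := ct_nbhs_lt (cd u) neg.
  pose s := Num.min 1 (u + e / 2).
  have su : u < s by rewrite lt_min u1' /=; lra.
  have s1 : s <= 1 by rewrite ge_min lexx.
  have se : s <= u + e / 2 by rewrite ge_min lexx orbT.
  have : s <= u.
    apply: ub_le_sup; first by case: hU.
    split; first by rewrite s1 andbT (le_trans u0) // ltW.
    by apply: He; rewrite /ball /= ltr0_norm; lra.
  by rewrite leNgt su.
have dN s : u <= s <= 1 -> ~~ (d s < 0).
  move=> /andP[us s1]; move: us; rewrite le_eqVlt => /orP[/eqP <- //|us].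
  apply/negP => ds; have : s <= u.
    by apply: ub_le_sup; [case: hU | split => //; rewrite s1 andbT (le_trans u0) // ltW].
  by rewrite leNgt us.
suff -> : f 1 = f u by [].
apply: eq_bigr => A _; congr (_ * _).
pose g s := onQ phd (fun B => cosh (l s B)) A.
have cg s : ctat g s by apply: ct_phd => B; [exact: cosh_ge1 | ctn].
have g1 s : u <= s <= 1 -> 1 <= `|g s|.
  move=> hs; apply: degenerate_norm; last exact: dN.
  move=> B; apply: lpos; case/andP: hs => h1 ->; rewrite andbT; exact: le_trans h1.
have uu : u <= u <= 1 by apply/andP; split.
have u11 : u <= (1 : R) <= 1 by apply/andP; split.
rewrite !ext_angle_pos; first last.
- by move=> B; apply/ltW/lpos; rewrite lexx ler01.
- by move=> B; apply/ltW/lpos; rewrite u0.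
(* |g| >= 1 on [u, 1], so g keeps its sign there and the angle stays 0 or stays pi. *)
have noz : ~ (Num.min (g u) (g 1) <= 0 <= Num.max (g u) (g 1)).
  move=> h; have [s] := @IVT _ g u 1 0 u1 (continuous_subspaceT cg) h.
  by rewrite in_itv /= => hs gs; have := g1 s hs; rewrite gs normr0 ler10.
have := g1 _ uu; have := g1 _ u11; rewrite !ler_normr -/(g 1) -/(g u).
move=> /orP[h1|h1] /orP[h2|h2].
- by rewrite !clacos_ge1.
- exfalso; apply: noz; rewrite ge_min le_max; apply/andP; split; apply/orP; [left|right]; lra.
- exfalso; apply: noz; rewrite ge_min le_max; apply/andP; split; apply/orP; [right|left]; lra.
- by rewrite !clacos_leN1 //; lra.
Qed.

(** Points of the segment before its end have positive lengths; the inequality reaches the end by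
    continuity of the extended angles. *)
Lemma ext_mono l0 l1 : Lset l0 -> (forall A, 0 <= l1 A) ->
  0 <= \sum_A (ext_angle l1 A - ext_angle l0 A) * (l1 A - l0 A).
Proof.
move=> L0 p1; pose w A := l1 A - l0 A.
pose l (s : R) A := l0 A + s * w A.
have ls1 : l 1 = l1 by apply/funext => A; rewrite /l /w; ring.
pose f (s : R) := \sum_A (ext_angle (l s) A - ext_angle l0 A) * w A.
have cf : ctat f 1.
  apply: ct_sum => A; apply: ctM; last exact: ct_cst.
  apply: ctD; last exact: ct_cst.
  by apply: ct_ext => B; rewrite /l; ctn.
rewrite -[X in 0 <= X]/(\sum_A (ext_angle l1 A - ext_angle l0 A) * w A).
rewrite -ls1 -/(f 1) leNgt; apply/negP => neg.
have [s [s0 s1]] := near_left_ex (@ltr01 R) (ct_nbhs_lt cf neg).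
have [->|sn] := eqVneq s 0.
  rewrite /f big1 ?ltxx // => A _.
  have -> : l 0 = l0 by apply/funext => B; rewrite /l; ring.
  by rewrite subrr mul0r.
have : 0 <= \sum_A (ext_angle (l s) A - ext_angle l0 A) * (l s A - l0 A).
  apply: ext_mono_pos => // A; have p0 : 0 < l0 A by case: L0.
  rewrite /l /w (_ : _ + _ = (1 - s) * l0 A + s * l1 A); last by ring.
  by apply: ltr_wpDr; [exact: mulr_ge0 | apply: mulr_gt0 => //; lra].
have -> : \sum_A (ext_angle (l s) A - ext_angle l0 A) * (l s A - l0 A) = s * f s.
  by rewrite /f mulr_sumr; apply: eq_bigr => A _; rewrite /l; ring.
have s_gt0 : 0 < s by rewrite lt_def sn.
by rewrite pmulr_rge0 // => h; rewrite ltNge h.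
Qed.

(** [hD 1 p q] is the square of p + q, so at length zero the cosine is exactly 1 and the extended
    angle vanishes. *)
Lemma phd_1 (p p' q q' t : R) : 0 < p -> 0 < p' -> 0 < q -> 0 < q' ->
  phd 1 p p' q q' t = 1.
Proof.
move=> hp hp' hq hq'; rewrite /phd /phr.
have -> : nf 1 p q p' q' t = (p + q) * (p' + q') by rewrite /nf; ring.
have -> : hD 1 p q * hD 1 p' q' = ((p + q) * (p' + q')) ^+ 2 by rewrite /hD; ring.
rewrite sqrtr_sqr ger0_norm ?divff //; last by rewrite mulr_ge0 // addr_ge0 // ltW.
by rewrite mulf_neq0 // gt_eqF // addr_gt0.
Qed.

Lemma ext_angle_le0 l A : l A <= 0 -> ext_angle l A = 0.
Proof.
move=> lA; rewrite ext_angleE clacos_ge1 //.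
have E := onQ_id (fun B => cosh (Num.max 0 (l B))) A.
rewrite (max_l lA) /cosh oppr0 expR0 in E.
rewrite /onQ in E *; rewrite [cosh (Num.max 0 (l (te _ _)))]E.
by rewrite (_ : (1 + 1) / 2 = 1) ?phd_1 ?cosh_gt0 //; lra.
Qed.

Lemma ext_angle_max0 l : ext_angle (fun A => Num.max 0 (l A)) = ext_angle l.
Proof.
apply/funext => A; rewrite !ext_angleE.
rewrite (_ : (fun B => cosh (Num.max 0 (Num.max 0 (l B)))) =
  fun B => cosh (Num.max 0 (l B))) //.
by apply/funext => B; rewrite (max_r (_ : 0 <= Num.max 0 (l B))) // le_max lexx.
Qed.
End Ext.

(** * Strong monotonicity of the extended angles at a regular tetrahedron *)

Section Regular.
Context {R : realType}.
Variables (th : R) (th_gt0 : 0 < th) (th_ltpi3 : 3 * th < pi).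
Implicit Types (l w a v : tet_edge -> R).

Let y_gt : 1 / 2 < cos th. Proof. by have [] := cos_gt_half th_gt0 th_ltpi3. Qed.
Let y_lt : cos th < 1. Proof. by have [] := cos_gt_half th_gt0 th_ltpi3. Qed.

(** Solves cos t = C / (2 C - 1), the relation between the angle and the hyperbolic cosine C of the
    length in a regular tetrahedron; the map is an involution. *)
Definition regC (t : R) : R := cos t / (2 * cos t - 1).
Definition regL (t : R) : R := arcosh (regC t).

Lemma regC_gt1 : 1 < regC th.
Proof.
move: y_gt y_lt => h1 h2; rewrite /regC ltr_pdivlMr; lra.
Qed.

Lemma regL_gt0 : 0 < regL th.
Proof. exact/arcosh_gt0/regC_gt1. Qed.

Lemma cosh_regL : cosh (regL th) = regC th.
Proof. exact/arcoshK/ltW/regC_gt1. Qed.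

Lemma Lset_regular : Lset (fun=> regL th).
Proof.
split; first by move=> _; exact: regL_gt0.
rewrite cosh_regL /detl /dtd; have := regC_gt1; move: (regC th) => C C1.
rewrite (_ : dt _ _ _ _ _ _ = - ((1 + C) ^+ 3 * (3 * C - 1))); last by rewrite /dt; ring.
by rewrite oppr_lt0 mulr_gt0 ?exprn_gt0 //; lra.
Qed.

Lemma phd_regular : phd (regC th) (regC th) (regC th) (regC th) (regC th) (regC th) = cos th.
Proof.
have C1 := regC_gt1; rewrite /phd /phr.
have D : hD (regC th) (regC th) (regC th) = (regC th + 1) ^+ 2 * (2 * regC th - 1).
  by rewrite /hD; ring.
rewrite D -expr2 sqrtr_sqr ger0_norm; last by rewrite mulr_ge0 ?sqr_ge0 //; lra.
have -> : nf (regC th) (regC th) (regC th) (regC th) (regC th) (regC th) =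
  (regC th + 1) ^+ 2 * regC th by rewrite /nf; ring.
have h1 : regC th + 1 != 0 by rewrite gt_eqF //; lra.
have h3 : 2 * regC th - 1 = (2 * cos th - 1)^-1.
  by rewrite /regC; field; rewrite gt_eqF //; move: y_gt; lra.
rewrite -mulf_div divff ?sqrf_eq0 // mul1r h3 invrK /regC divfK //.
by rewrite gt_eqF //; move: y_gt; lra.
Qed.

Lemma th_itv : 0 <= th <= pi.
Proof. by move: th_gt0 th_ltpi3; have := pi_gt0 R; lra. Qed.

Lemma ang_regular A : ang (fun=> regL th) A = th.
Proof. by rewrite /ang /onQ cosh_regL phd_regular cosK // in_itv /= th_itv. Qed.

Lemma ext_regular A : ext_angle (fun=> regL th) A = th.
Proof. by rewrite ext_angle_Lset ?ang_regular //; exact: Lset_regular. Qed.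

Lemma Bset_regular : Bset (fun=> th).
Proof.
move: th_gt0 th_ltpi3 => h1 h2; by split => //; split; lra.
Qed.

(** Six-tuples as row vectors, whose topology supplies the neighbourhoods of the regular point. *)
Definition of_row (u : 'rV[R]_(#|{: tet_edge}|)) (A : tet_edge) : R := u ord0 (enum_rank A).

Lemma ct_of_row u A : ctat (fun z => of_row z A) u.
Proof. by rewrite /of_row; ctn. Qed.

Lemma near_const (c : R) (P : (tet_edge -> R) -> Prop) :
  (\forall u \near (const_mx c : 'rV[R]_(#|{: tet_edge}|)), P (of_row u))%classic ->
  exists2 e, 0 < e & forall l, (forall A, `|l A - c| < e) -> P l.
Proof.
move=> /nbhs_ballP[e /= e0 H]; exists e => // l hl.
have -> : l = of_row (\row_i l (enum_val i)).
  by apply/funext => A; rewrite /of_row mxE enum_rankK.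
apply: H; split=> // i j; rewrite !mxE /ball /= distrC; exact: hl.
Qed.

Definition edge_delta (B : tet_edge) : tet_edge -> R := fun A => (A == B)%:R.

Lemma Bf0 a A : Bf a (fun=> 0) A = 0.
Proof. by rewrite /Bf /onQ /bq /bfun /bfunI /=; ring. Qed.

Lemma Bf_sum (I : Type) (r : seq I) (k : I -> R) (W : I -> tet_edge -> R) a A :
  Bf a (fun B => \sum_(i <- r) k i * W i B) A = \sum_(i <- r) k i * Bf a (W i) A.
Proof.
elim: r => [|i r IH].
  by rewrite big_nil -[RHS](Bf0 a A); congr Bf; apply/funext => B; rewrite big_nil.
rewrite big_cons -IH addrC -Bf_lin; congr Bf; apply/funext => B.
by rewrite big_cons addrC.
Qed.

Lemma Bil_entries a w :
  Bil a w w = \sum_A \sum_B w A * w B * Bil a (edge_delta B) (edge_delta A).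
Proof.
rewrite /Bil; apply: eq_bigr => A _.
have -> : Bf a w A = \sum_C w C * Bf a (edge_delta C) A.
  rewrite -Bf_sum; congr Bf; apply/funext => B.
  rewrite (bigD1 B) //= /edge_delta eqxx mulr1 big1 ?addr0 // => C /negPf.
  by rewrite eq_sym => ->; rewrite mulr0.
rewrite mulr_sumr; apply: eq_bigr => B _.
by rewrite -/(Bil a (edge_delta B) (edge_delta A)) Bil_delta; ring.
Qed.

(** The sum of the absolute values of the matrix entries is continuous at the regular point, hence
    bounded nearby; 2 w_A w_B <= w_A^2 + w_B^2 then costs a factor 6, the number of edges. *)
Lemma near_Bil_bound : exists M e : R, [/\ 0 < M, 0 < e & forall b,
  (forall A, `|b A - th| < e) -> Bset b ->
  forall w, Bil b w w / sqrtNdet b <= M * \sum_A w A ^+ 2].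
Proof.
pose S b := \sum_A \sum_B `|Bil b (edge_delta B) (edge_delta A) / sqrtNdet b|.
have B0 : Bset (of_row (const_mx th)).
  rewrite (_ : of_row _ = fun=> th); first exact: Bset_regular.
  by apply/funext => A; rewrite /of_row mxE.
have cS : ctat (fun u => S (of_row u)) (const_mx th).
  apply: ct_sum => A; apply: ct_sum => B; apply: ct_norm; apply: ctM.
    apply: ct_Bil => // C; last exact: ct_cst; last exact: ct_cst; exact: ct_of_row.
  apply: ctV; first by rewrite gt_eqF // (sqrtNdet_gt0 B0).
  have cv B' := @ct_of_row (const_mx th) B'; rewrite /sqrtNdet /detv /dt; ctn.
have /(@near_const th (fun b => S b < S (of_row (const_mx th)) + 1))[e e0 H] : (\forall u \near (const_mx th : 'rV[R]_(#|{: tet_edge}|)),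
    S (of_row u) < S (of_row (const_mx th)) + 1)%classic.
  by apply: ct_nbhs_lt => //; lra.
have S0 b : 0 <= S b by apply: sumr_ge0 => A _; apply: sumr_ge0 => B _.
have M0 : 0 < S (of_row (const_mx th)) + 1 by apply: ltr_wpDl.
move: (S (of_row (const_mx th)) + 1) M0 H => M M0 H.
have n0 : 0 < #|{: tet_edge}|%:R :> R by rewrite ltr0n; apply/card_gt0P; exists e01.
exists (M * #|{: tet_edge}|%:R), e; split => //; first exact: mulr_gt0.
move=> b /H Sb Bb w; rewrite Bil_entries mulr_suml.
have ent A B : `|Bil b (edge_delta B) (edge_delta A) / sqrtNdet b| <= M.
  apply: le_trans (ltW Sb); rewrite /S (bigD1 A) //= (bigD1 B) //=.
  rewrite -addrA lerDl addr_ge0 ?sumr_ge0 // => C _; exact: sumr_ge0.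
apply: (@le_trans _ _ (\sum_A \sum_B M * ((w A ^+ 2 + w B ^+ 2) / 2))).
  apply: ler_sum => A _; rewrite mulr_suml; apply: ler_sum => B _.
  rewrite -mulrA; apply: le_trans (ler_norm _) _; rewrite normrM mulrC.
  apply: ler_pM => //.
  rewrite ler_norml; apply/andP; split.
    by have := sqr_ge0 (w A + w B); rewrite sqrrD; lra.
  by have := sqr_ge0 (w A - w B); rewrite sqrrB; lra.
rewrite (eq_bigr (fun A => M * ((#|{: tet_edge}|%:R * w A ^+ 2 + \sum_B w B ^+ 2) / 2))); last first.
  move=> A _; rewrite -mulr_sumr -mulr_suml big_split /= sumr_const.
  by rewrite [in RHS]mulr_natl.
rewrite -mulr_sumr -mulr_suml big_split /= -mulr_sumr sumr_const -[X in _ + X]mulr_natl.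
by rewrite le_eqVlt; apply/orP; left; apply/eqP; field.
Qed.

(** Near L the extended angles are near th by continuity, so the segment of angles from th stays
    where [near_Bil_bound] applies; [len_cocoercive] then gives the claim, the lengths being
    recovered by [len_ang]. *)
Lemma ext_strong_local : exists M e : R, [/\ 0 < M, 0 < e & forall l,
  (forall A, `|l A - regL th| < e) -> Lset l /\
  \sum_A (l A - regL th) ^+ 2 <=
    M * \sum_A (ext_angle l A - th) * (l A - regL th)].
Proof.
have [M [e [M0 e0 H]]] := near_Bil_bound.
have of_rowL : of_row (const_mx (regL th)) = fun=> regL th.
  by apply/funext => A; rewrite /of_row mxE.
have cv B := @ct_of_row (const_mx (regL th)) B.
pose T u := \sum_A `|ext_angle (of_row u) A - th|.
have near1 : (\forall u \near (const_mx (regL th) : 'rV[R]_(#|{: tet_edge}|)), T u < e)%classic.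
  apply: ct_nbhs_lt; last by rewrite /T of_rowL big1 // => A _; rewrite ext_regular subrr normr0.
  apply: ct_sum => A; apply: ct_norm; apply: ctD; last exact: ct_cst.
  exact: ct_ext.
have near2 : (\forall u \near (const_mx (regL th) : 'rV[R]_(#|{: tet_edge}|)),
    detl (fun A => cosh (of_row u A)) < 0)%classic.
  apply: ct_nbhs_lt; first exact: ct_detl.
  by rewrite of_rowL; case: Lset_regular.
have /(@near_const (regL th) (fun l => \sum_A `|ext_angle l A - th| < e /\
   detl (fun A => cosh (l A)) < 0))[r r0 Hr] : (\forall u \near (const_mx (regL th) : 'rV[R]_(#|{: tet_edge}|)),
   (\sum_A `|ext_angle (of_row u) A - th| < e) /\ detl (fun A => cosh (of_row u A)) < 0)%classic.
  by apply: filterS2 near1 near2 => u h1 h2; split.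
exists M, (Num.min r (regL th)); split; rewrite ?lt_min ?r0 ?regL_gt0 // => l hl.
have [h1 h2] : (\sum_A `|ext_angle l A - th| < e) /\ detl (fun A => cosh (l A)) < 0.
  by apply: Hr => A; have := hl A; rewrite lt_min => /andP[].
have Ll : Lset l.
  split=> // A; have := hl A; rewrite lt_min => /andP[_].
  by rewrite ltr_norml => /andP[+ _]; lra.
split => //.
have Ba := Lset_Bset Ll.
have lenth A : len (fun=> th) A = regL th.
  have := len_ang Lset_regular A; congr (_ = _).
  by rewrite /len /onQ !ang_regular.
have E A : (len (ang l) A - len (fun=> th) A) = l A - regL th by rewrite lenth len_ang.
have -> : \sum_A (l A - regL th) ^+ 2 = \sum_A (len (ang l) A - len (fun=> th) A) ^+ 2.
  by apply: eq_bigr => A _; rewrite E.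
have -> : \sum_A (ext_angle l A - th) * (l A - regL th) =
    \sum_A (ang l A - th) * (len (ang l) A - len (fun=> th) A).
  by apply: eq_bigr => A _; rewrite E ext_angle_Lset.
apply: (len_cocoercive M0 Bset_regular Ba).
move=> s w hs /=; apply: H; last exact: Bset_conv Bset_regular Ba hs.
move=> A; rewrite addrAC subrr add0r normrM.
apply: le_lt_trans h1; rewrite (bigD1 A) //= ext_angle_Lset //.
apply: ler_wpDr; first exact: sumr_ge0.
by rewrite ler_piMl // ger0_norm; case/andP: hs.
Qed.

Lemma ext_strong (R0 : R) : 0 < R0 -> exists2 c : R, 0 < c & forall l,
  (forall A, `|l A - regL th| <= R0) ->
  c * \sum_A (l A - regL th) ^+ 2 <=
    \sum_A (ext_angle l A - th) * (l A - regL th).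
Proof.
move=> R00; have [M [e [M0 e0 H]]] := ext_strong_local.
have L0 := regL_gt0; set L := regL th in H L0 *.
(* Scaling by r brings a deviation of size at most R0 within e; r < 1 leaves room on the ray for
   monotonicity. *)
pose r := Num.min (1 / 2) (e / (2 * R0)).
have r0 : 0 < r by rewrite lt_min; apply/andP; split; [lra | rewrite divr_gt0 //; lra].
have r1 : r < 1 by rewrite gt_min; apply/orP; left; lra.
have re : r * R0 < e.
  apply: (@le_lt_trans _ _ (e / 2)); last lra.
  apply: (@le_trans _ _ (e / (2 * R0) * R0)).
    by rewrite ler_pM2r // ge_min lexx orbT.
  by rewrite le_eqVlt; apply/orP; left; apply/eqP; field; rewrite gt_eqF.
(* The rate r / M comes from the truncated lengths, th / R0 from the negative parts. *)
pose c := Num.min (r / M) (th / R0).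
have c0 : 0 < c by rewrite lt_min !divr_gt0.
exists (c / 2); first by rewrite divr_gt0.
move=> l hl.
pose lp A := Num.max 0 (l A).
pose wp A := lp A - L.
pose wn A := lp A - l A.
have hwp A : `|wp A| <= R0.
  have := hl A; rewrite /wp /lp !ler_norml => /andP[h1 h2].
  have [h|h] := leP 0 (l A); first by rewrite h1 h2.
  by rewrite sub0r lerN2; apply/andP; split; lra.
pose lr A := L + r * wp A.
have [Llr Hlr] : Lset lr /\ \sum_A (lr A - L) ^+ 2 <= M * \sum_A (ext_angle lr A - th) * (lr A - L).
  apply: H => A; rewrite /lr addrAC subrr add0r normrM ger0_norm ?ltW //.
  by apply: le_lt_trans re; rewrite ler_pM2l.
have lp0 A : 0 <= lp A by rewrite /lp le_max lexx.
have mono := ext_mono Llr lp0.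
have step1 : \sum_A (ext_angle lr A - th) * wp A <= \sum_A (ext_angle lp A - th) * wp A.
  rewrite -subr_ge0 -sumrB.
  have E : \sum_A (ext_angle lp A - ext_angle lr A) * (lp A - lr A) =
    (1 - r) * \sum_A ((ext_angle lp A - th) * wp A - (ext_angle lr A - th) * wp A).
    by rewrite mulr_sumr; apply: eq_bigr => A _; rewrite /lr /wp; ring.
  by move: mono; rewrite E pmulr_rge0 // subr_gt0.
have step2 : r / M * \sum_A wp A ^+ 2 <= \sum_A (ext_angle lr A - th) * wp A.
  have E1 : \sum_A (lr A - L) ^+ 2 = r ^+ 2 * \sum_A wp A ^+ 2.
    by rewrite mulr_sumr; apply: eq_bigr => A _; rewrite /lr; ring.
  have E2 : \sum_A (ext_angle lr A - th) * (lr A - L) = r * \sum_A (ext_angle lr A - th) * wp A.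
    by rewrite mulr_sumr; apply: eq_bigr => A _; rewrite /lr; ring.
  move: Hlr; rewrite E1 E2 mulrCA expr2 -mulrA ler_pM2l // => h.
  by rewrite mulrAC ler_pdivrMr // [X in _ <= X]mulrC.
have step3 A : th / R0 * wn A ^+ 2 <= (ext_angle l A - th) * (l A - lp A).
  rewrite /wn; have [h|h] := leP 0 (l A).
    by rewrite /lp max_r // subrr expr0n /= !mulr0.
  rewrite (ext_angle_le0 (ltW h)) /lp (max_l (ltW h)) sub0r subr0 sub0r sqrrN.
  have hR : - R0 <= l A by have := hl A; rewrite ler_norml => /andP[h1 _]; lra.
  rewrite mulrAC ler_pdivrMr // mulNr -mulrN -mulrA ler_pM2l // expr2 -mulrNN.
  by rewrite ler_wpM2l //; lra.
have sq0 : 0 <= \sum_A wp A ^+ 2 by apply: sumr_ge0 => A _; exact: sqr_ge0.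
have key : c * (\sum_A wp A ^+ 2 + \sum_A wn A ^+ 2) <=
    \sum_A (ext_angle l A - th) * (l A - L).
  apply: (@le_trans _ _ (\sum_A (ext_angle lp A - th) * wp A + \sum_A (ext_angle l A - th) * (l A - lp A))).
    rewrite mulrDr; apply: lerD.
      apply: le_trans step1; apply: le_trans step2.
      by rewrite ler_wpM2r // ge_min lexx.
    rewrite mulr_sumr; apply: ler_sum => A _; apply: le_trans (step3 A).
    by rewrite ler_wpM2r ?sqr_ge0 // ge_min lexx orbT.
  (* The extended angles of l and lp coincide, so the two sums add up to the one for l. *)
  rewrite -big_split /= le_eqVlt; apply/orP; left; apply/eqP.
  apply: eq_bigr => A _; rewrite /lp ext_angle_max0 -/(lp A) /wp; ring.
(* The factor 1 / 2 in the constant comes from (wp - wn)^2 <= 2 (wp^2 + wn^2). *)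
apply: le_trans key; rewrite -mulrA ler_pM2l // -big_split /= mulr_sumr.
apply: ler_sum => A _; have := sqr_ge0 (wp A + wn A).
have -> : l A - L = wp A - wn A by rewrite /wp /wn; ring.
move: (wp A) (wn A) => x y; rewrite sqrrD sqrrB; lra.
Qed.
End Regular.

(** * Hyper-ideal tetrahedra in the hyperboloid model *)

Section Mink.
Context {R : realType}.
Implicit Types x y z p : 'rV[R]_4.

Lemma minkC x y : mink x y = mink y x.
Proof. by rewrite /mink mulrC; congr (_ + _); apply: eq_bigr => i _; rewrite mulrC. Qed.
Lemma minkDl x y z : mink (x + y) z = mink x z + mink y z.
Proof.
rewrite /mink !mxE mulrDl opprD addrACA -big_split /=.
by congr (_ + _); apply: eq_bigr => i _; rewrite mxE mulrDl.
Qed.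
Lemma minkZl k x z : mink (k *: x) z = k * mink x z.
Proof.
rewrite /mink !mxE mulrDr mulr_sumr mulrN mulrA.
by congr (_ + _); apply: eq_bigr => i _; rewrite mxE mulrA.
Qed.
Lemma mink0l z : mink 0 z = 0.
Proof. by rewrite -[0](scale0r 0) minkZl mul0r. Qed.
Lemma mink_suml (I : Type) (r : seq I) (F : I -> 'rV[R]_4) z :
  mink (\sum_(i <- r) F i) z = \sum_(i <- r) mink (F i) z.
Proof.
elim: r => [|i r IH]; first by rewrite !big_nil mink0l.
by rewrite !big_cons minkDl IH.
Qed.

(* Reversed Cauchy-Schwarz, only for the sign. *)
Lemma mink_future x y : in_H3 x -> in_H3 y -> mink x y < 0.
Proof.
rewrite /in_H3 /mink !big_ord_recl !big_ord0 !addr0.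
set x1 := x _ (lift _ _); set x2 := x _ (lift _ _); set x3 := x _ (lift _ _).
set y1 := y _ (lift _ _); set y2 := y _ (lift _ _); set y3 := y _ (lift _ _).
move: (x _ _) (y _ _) x1 x2 x3 y1 y2 y3 => x0 y0 x1 x2 x3 y1 y2 y3 [hx x0p] [hy y0p].
set s := x1 * y1 + (x2 * y2 + x3 * y3).
suff : `|s| < x0 * y0 by rewrite ltr_norml => /andP[_]; lra.
rewrite -(@ltr_pXn2r _ 2) ?nnegrE ?normr_ge0 ?mulr_ge0 ?ltW // real_normK ?num_real //.
have ex : x1 ^+ 2 + x2 ^+ 2 + x3 ^+ 2 = x0 ^+ 2 - 1 by rewrite !expr2; lra.
have ey : y1 ^+ 2 + y2 ^+ 2 + y3 ^+ 2 = y0 ^+ 2 - 1 by rewrite !expr2; lra.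
have : s ^+ 2 <= (x1 ^+ 2 + x2 ^+ 2 + x3 ^+ 2) * (y1 ^+ 2 + y2 ^+ 2 + y3 ^+ 2).
  rewrite -subr_ge0 /s.
  rewrite (_ : _ - _ = (x1 * y2 - x2 * y1) ^+ 2 + (x1 * y3 - x3 * y1) ^+ 2
     + (x2 * y3 - x3 * y2) ^+ 2); last by ring.
  by rewrite !addr_ge0 ?sqr_ge0.
rewrite ex ey exprMn => h; apply: le_lt_trans h _.
have h1 : 0 <= x0 ^+ 2 - 1 by rewrite -ex !addr_ge0 ?sqr_ge0.
have h2 : 0 <= y0 ^+ 2 - 1 by rewrite -ey !addr_ge0 ?sqr_ge0.
rewrite -subr_gt0 (_ : _ - _ = (x0 ^+ 2 - 1) + (y0 ^+ 2 - 1) + 1); last by ring.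
lra.
Qed.

Definition Jmx : 'M[R]_4 := diag_mx (\row_i (if i == ord0 then -1 else 1)).

Lemma mink_mx x y : mink x y = (x *m Jmx *m y^T) ord0 ord0.
Proof.
rewrite mxE big_ord_recl /mink; congr (_ + _).
  by rewrite /Jmx mul_mx_diag !mxE eqxx; ring.
by apply: eq_bigr => i _; rewrite /Jmx mul_mx_diag !mxE /=; ring.
Qed.

Section Dual.
Variables (v n : 'I_4 -> 'rV[R]_4).
Hypothesis orth : forall i k, i != k -> mink (v i) (n k) = 0.
Hypothesis nfree : forall c : 'rV[R]_4, \sum_k c ord0 k *: n k = 0 -> c = 0.
Hypothesis vnz : forall i, v i != 0.
Let d i := mink (v i) (n i).
Let V := \matrix_i v i.
Let N := \matrix_i n i.

Let N_unit : N \in unitmx.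
Proof.
rewrite -row_free_unit; apply: inj_row_free => c cN; apply: nfree.
transitivity (c *m N); last exact: cN.
by rewrite mulmx_sum_row; apply: eq_bigr => k _; rewrite rowK.
Qed.

Let VJN : V *m Jmx *m N^T = diag_mx (\row_i d i).
Proof.
apply/matrixP => i k; rewrite [RHS]mxE mxE.
have -> : \sum_j (V *m Jmx) i j * N^T j k = mink (v i) (n k).
  rewrite mink_mx mxE; apply: eq_bigr => j _; rewrite /V /N !mxE; congr (_ * _).
  by apply: eq_bigr => m _; rewrite !mxE.
have [->|ik] := eqVneq i k; first by rewrite mxE mulr1n.
by rewrite mulr0n orth.
Qed.

(** Otherwise v i would be orthogonal to the basis n, hence zero since the form is nondegenerate. *)
Lemma dual_neq0 i : d i != 0.
Proof.
apply/eqP => di.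
have vN : v i *m Jmx *m N^T = 0.
  apply/rowP => k; rewrite mxE [RHS]mxE.
  transitivity (mink (v i) (n k)).
    by rewrite mink_mx mxE; apply: eq_bigr => j _; rewrite /N !mxE.
  by have [<-|ik] := eqVneq i k; [exact: di | exact: orth].
have Ju : Jmx \in unitmx.
  rewrite unitmxE det_diag unitfE; apply/prodf_neq0 => j _; rewrite mxE.
  by case: ifP => _; rewrite ?oppr_eq0 oner_eq0.
have JN : Jmx *m N^T \in unitmx by rewrite unitmx_mul Ju unitmx_tr N_unit.
have /eqP[] := vnz i; rewrite -[v i](mulmxK JN) mulmxA vN mul0mx //.
Qed.

(** The v k / d k form the basis dual to n. *)
Lemma mink_expand p x : mink p x = \sum_k mink p (n k) * mink (v k) x / d k.
Proof.
pose D := diag_mx (\row_i d i); pose Di := diag_mx (\row_i (d i)^-1).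
have DDi : D *m Di = 1%:M.
  rewrite /D /Di mul_diag_mx; apply/matrixP => i j; rewrite !mxE.
  have [->|ij] := eqVneq i j; last by rewrite mulr0n mulr0.
  by rewrite !mulr1n divff // dual_neq0.
have E : N^T *m Di *m V *m Jmx = 1%:M.
  have : (V *m Jmx) *m (N^T *m Di) = 1%:M by rewrite mulmxA VJN DDi.
  by move/mulmx1C; rewrite !mulmxA.
rewrite mink_mx -[p *m Jmx]mulmx1 -E !mulmxA.
have -> : p *m Jmx *m N^T *m Di *m V *m Jmx *m x^T
  = (p *m Jmx *m N^T) *m Di *m (V *m Jmx *m x^T) by rewrite !mulmxA.
rewrite mxE; apply: eq_bigr => k _.
have -> : (p *m Jmx *m N^T *m Di) ord0 k = mink p (n k) / d k.
  rewrite /Di mul_mx_diag !mxE mink_mx mxE; congr (_ / _).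
  by apply: eq_bigr => j _; rewrite /N !mxE.
have -> : (V *m Jmx *m x^T) k ord0 = mink (v k) x.
  rewrite mink_mx !mxE; apply: eq_bigr => j _; congr (_ * _).
  by rewrite !mxE; apply: eq_bigr => m _; rewrite /V !mxE.
ring.
Qed.
End Dual.
End Mink.

Lemma sum_I4 (V : nmodType) (F : 'I_4 -> V) (i j k h : 'I_4) : uniq [:: i; j; k; h] ->
  \sum_m F m = F i + F j + F k + F h.
Proof.
move=> u; rewrite (perm_big [:: i; j; k; h]).
  by rewrite !big_cons big_nil /= addr0 !addrA.
apply: uniq_perm => //; first by rewrite index_enum_uniq.
move=> m; rewrite mem_index_enum; symmetry.
have /subset_cardP : #|[:: i; j; k; h]| = #|{: 'I_4}|.
  by rewrite (card_uniqP u) card_ord.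
by move=> /(_ (subset_predT _))/(_ m) ->.
Qed.

Lemma endpt_uniq (A : tet_edge) :
  let i := endpt (tet_edge_set A) 0 in let j := endpt (tet_edge_set A) 1 in
  let k := endpt (~: tet_edge_set A) 0 in let h := endpt (~: tet_edge_set A) 1 in
  [/\ uniq [:: i; j; k; h], (i < j)%N & A = te i j].
Proof.
move: A; apply: tet_edge_ind; rewrite /=.
- by have [-> ->] := @endpt_te v0 v1 isT; have [-> ->] := @endptC_te v0 v1 v2 v3 isT isT.
- by have [-> ->] := @endpt_te v0 v2 isT; have [-> ->] := @endptC_te v0 v2 v1 v3 isT isT.
- by have [-> ->] := @endpt_te v0 v3 isT; have [-> ->] := @endptC_te v0 v3 v1 v2 isT isT.
- by have [-> ->] := @endpt_te v1 v2 isT; have [-> ->] := @endptC_te v1 v2 v0 v3 isT isT.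
- by have [-> ->] := @endpt_te v1 v3 isT; have [-> ->] := @endptC_te v1 v3 v0 v2 isT isT.
- by have [-> ->] := @endpt_te v2 v3 isT; have [-> ->] := @endptC_te v2 v3 v0 v1 isT isT.
Qed.

Section Gram.
Context {R : realType}.

(* Row [k] of the adjugate of the Gram matrix G (1 on the diagonal, minus the
   [c]'s off it) times G. *)
Lemma gram_solve (C p p' q q' t X Y Z W : R) :
  (X - C * Y - p * Z - p' * W = 0) -> (- C * X + Y - q * Z - q' * W = 0) ->
  (- p * X - q * Y + Z - t * W = 0) -> (- p' * X - q' * Y - t * Z + W = 1) ->
  dtd C p p' q q' t * Z = nfd C p p' q q' t /\
  dtd C p p' q q' t * W = - hD C p q.
Proof.
move=> e1 e2 e3 e4; split.
  transitivity (nfd q' C q p' t p * (X - C * Y - p * Z - p' * W) + nfd p' C p q' t q * (- C * X + Y - q * Z - q' * W)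
    + (- hD C p' q') * (- p * X - q * Y + Z - t * W) + nfd C p p' q q' t * (- p' * X - q' * Y - t * Z + W)).
    by rewrite /nfd /nf /hD /dtd /dt; ring.
  by rewrite e1 e2 e3 e4; ring.
transitivity (nfd q C q' p t p' * (X - C * Y - p * Z - p' * W) + nfd p C p' q t q' * (- C * X + Y - q * Z - q' * W)
    + nfd C p p' q q' t * (- p * X - q * Y + Z - t * W) + (- hD C p q) * (- p' * X - q' * Y - t * Z + W)).
  by rewrite /nfd /nf /hD /dtd /dt; ring.
by rewrite e1 e2 e3 e4; ring.
Qed.
End Gram.

Section Tet.
Context {R : realType}.
Variable P : hyperideal_tet R.
Let v := tri_nrm P.
Let n := hex_nrm P.
Let x := tet_vtx P.
Let d i := mink (v i) (n i).

Let orth i k : i != k -> mink (v i) (n k) = 0.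
Proof. exact: tri_hex_orthogonal. Qed.

Let vnz i : v i != 0.
Proof.
apply/eqP => vi; have := tri_nrm_unit P i.
by rewrite -/v vi mink0l => /eqP; rewrite eq_sym oner_eq0.
Qed.

Lemma I4_third (i j : 'I_4) : i != j -> exists k h, uniq [:: i; j; k; h].
Proof.
move: i j; apply: I4P; apply: I4P => //= _;
 first [by exists v0, v1 | by exists v0, v2 | by exists v0, v3 | by exists v1, v2
   | by exists v1, v3 | by exists v2, v3].
Qed.

(** Pairing with x i j leaves only the terms of n i and n j, whose products with x i j are both
    negative, so c i and c j are both zero or of opposite signs; three indices exclude the
    latter. *)
Let nfree (c : 'rV[R]_4) : \sum_k c ord0 k *: n k = 0 -> c = 0.
Proof.
move=> c0.
have E i j : i != j -> c ord0 i * mink (n i) (x i j) + c ord0 j * mink (n j) (x i j) = 0.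
  move=> ij; have [k [h u]] := I4_third ij.
  have := congr1 (fun y => mink y (x i j)) c0.
  rewrite mink0l mink_suml (sum_I4 _ u) !minkZl.
  move: u; rewrite /= !inE !negb_or => /and4P[/and3P[_ ik ih] /andP[jk jh] kh _].
  by rewrite (hex_on P ij ik jk) (hex_on P ij ih jh) !mulr0 !addr0.
have neg i j : i != j -> (0 < c ord0 i -> c ord0 j < 0) /\ (c ord0 i < 0 -> 0 < c ord0 j).
  move=> ij.
  have ni : mink (n i) (x i j) < 0 by apply: hex_off => //; rewrite eqxx.
  have nj : mink (n j) (x i j) < 0 by apply: hex_off => //; rewrite eqxx orbT.
  have := E i j ij; split => ci.
    have : c ord0 i * mink (n i) (x i j) < 0 by rewrite pmulr_rlt0.
    move=> h1; have : 0 < c ord0 j * mink (n j) (x i j) by lra.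
    by rewrite nmulr_lgt0.
  have : 0 < c ord0 i * mink (n i) (x i j) by rewrite nmulr_rgt0.
  move=> h1; have : c ord0 j * mink (n j) (x i j) < 0 by lra.
  by rewrite nmulr_llt0.
apply/rowP => i; rewrite [RHS]mxE.
have [j ij] : exists j, i != j.
  by move: i; apply: I4P; [exists v1|exists v0|exists v0|exists v0].
have [k [h u]] := I4_third ij.
move: u; rewrite /= !inE !negb_or => /and4P[/and3P[_ ik ih] /andP[jk jh] kh _].
have [_] := neg _ _ ij; have [+ _] := neg _ _ ij.
have [_] := neg _ _ ik; have [+ _] := neg _ _ ik.
have [_] := neg _ _ jk; have [+ _] := neg _ _ jk.
move=> h1 h2 h3 h4 h5 h6.
have [ci|ci|//] := ltgtP (c ord0 i) 0.
- by have := h1 (h6 ci); have := h4 ci; lra.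
- by have := h2 (h5 ci); have := h3 ci; lra.
Qed.

Let dn0 i : d i != 0. Proof. exact: (dual_neq0 orth nfree vnz). Qed.
Let expand p y : mink p y = \sum_k mink p (n k) * mink (v k) y / d k.
Proof. exact: (mink_expand orth nfree vnz). Qed.

Let vtx_mink i j p : i != j -> mink (x i j) p =
  mink (n i) (x i j) / d i * mink (v i) p + mink (n j) (x i j) / d j * mink (v j) p.
Proof.
move=> ij; have [k [h u]] := I4_third ij.
rewrite expand (sum_I4 _ u).
move: u; rewrite /= !inE !negb_or => /and4P[/and3P[_ ik ih] /andP[jk jh] kh _].
rewrite !(minkC (x i j)) (hex_on P ij ik jk) (hex_on P ij ih jh) !mul0r !addr0.
by congr (_ + _); ring.
Qed.

(** x i j lies in the span of v i and v j. Orthogonality to v i and the norm -1 make it b (v j - g v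
    i) with b^2 (g^2 - 1) = 1, and its product with x j i is then g: the Gram matrix of the v's
    carries the edge lengths. *)
Lemma edge_gram i j : i != j ->
  [/\ mink (v i) (v j) = mink (x i j) (x j i), mink (v i) (v j) ^+ 2 > 1 & d j < 0].
Proof.
move=> ij; have ji : j != i by rewrite eq_sym.
set g := mink (v i) (v j).
have gE : mink (v j) (v i) = g by rewrite minkC.
have key i' j' : i' != j' -> mink (v i') (v j') = g ->
   exists2 b, 0 < b & [/\ b = mink (n j') (x i' j') / d j',
      mink (v j') (x i' j') = b * (1 - g ^+ 2), b ^+ 2 * (g ^+ 2 - 1) = 1 &
       mink (n i') (x i' j') / d i' = - b * g].
  move=> ne gE'; have ne' : j' != i' by rewrite eq_sym.
  set b := mink (n j') (x i' j') / d j'.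
  set a := mink (n i') (x i' j') / d i'.
  have e1 : a + b * g = 0.
    have := vtx_mink (v i') ne; rewrite minkC (tri_on P ne) tri_nrm_unit.
    by rewrite (minkC (tri_nrm P j')) gE' mulr1 => <-.
  have e2 : mink (v j') (x i' j') = a * g + b.
    have := vtx_mink (v j') ne; rewrite (tri_nrm_unit P j') mulr1 gE' => <-.
    exact: minkC.
  have aE : a = - b * g by lra.
  have m0 : mink (v j') (x i' j') < 0 by apply: tri_off => //.
  have e3 : b * mink (v j') (x i' j') = -1.
    have := vtx_mink (x i' j') ne; rewrite (tri_on P ne) mulr0 add0r => <-.
    by case: (tet_vtx_H3 P ne).
  have b0 : 0 < b by rewrite -(nmulr_llt0 _ m0) e3 ltrN10.
  have e4 : mink (v j') (x i' j') = b * (1 - g ^+ 2) by rewrite e2 aE; ring.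
  exists b => //; split => //.
  transitivity (- (b * (b * (1 - g ^+ 2)))); first by ring.
  by rewrite -e4 e3 opprK.
have [b b0 [bE e1 e2 e3]] := key i j ij (erefl _).
have [b' b'0 [bE' f1 f2 f3]] := key j i ji gE.
have g1 : 0 < g ^+ 2 - 1.
  by rewrite -(pmulr_rgt0 _ (exprn_gt0 2 b0)) e2 ltr01.
split; last first.
- have nj : mink (n j) (x i j) < 0 by apply: hex_off => //; rewrite eqxx orbT.
  move: b0; rewrite bE => h.
  have /eqP := dn0 j; case: (ltgtP (d j) 0) => // dj _.
  by move: h; rewrite ltNge ltW // pmulr_llt0 ?invr_gt0.
- lra.
(* Both are positive, and their square depends on g only. *)
have bb : b = b'.
  apply/eqP; rewrite -(@eqrXn2 _ 2) ?ltW //; apply/eqP.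
  have gn : g ^+ 2 - 1 != 0 by rewrite gt_eqF.
  by apply: (mulIf gn); rewrite e2 f2.
rewrite (vtx_mink (x j i) ij) -bE e3 (tri_on P ji) mulr0 addr0 f1 -bb.
transitivity (b ^+ 2 * (g ^+ 2 - 1) * g); first by rewrite e2 mul1r.
ring.
Qed.

Lemma hdistC (y z : 'rV[R]_4) : hdist y z = hdist z y.
Proof. by rewrite /hdist minkC. Qed.

Lemma tet_length_te i j : i != j -> tet_length P (te i j) = arcosh (- mink (v i) (v j)).
Proof.
move=> ij; have [gE _ _] := edge_gram ij.
rewrite gE /tet_length.
have [h|h|h] := ltngtP i j.
- by have [-> ->] := endpt_te h.
- by rewrite teC; have [-> ->] := endpt_te h; rewrite hdistC.
- by move/val_inj/eqP: h; rewrite (negPf ij).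
Qed.

Lemma gram_gt1 i j : i != j -> 1 < - mink (v i) (v j).
Proof.
move=> ij; have [gE g2 _] := edge_gram ij; have ji : j != i by rewrite eq_sym.
have g0 : mink (v i) (v j) < 0 by rewrite gE; apply: mink_future; exact: tet_vtx_H3.
by rewrite -(@ltr_pXn2r _ 2) ?nnegrE ?expr1n ?sqrrN //; lra.
Qed.

Lemma cosh_tet_length i j : i != j -> cosh (tet_length P (te i j)) = - mink (v i) (v j).
Proof. by move=> ij; rewrite tet_length_te // arcoshK // ltW // gram_gt1. Qed.

(** W is the inverse of the Gram matrix of the v's, and [gram_solve] computes its column h. The
    diagonal entries of W and [hD] are positive, which makes the determinant negative and fixes the
    sign of the root. *)
Lemma gram_angle i j k h : uniq [:: i; j; k; h] ->
  let c a b := - mink (v a) (v b) in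
  dtd (c i j) (c i k) (c i h) (c j k) (c j h) (c k h) < 0 /\
  - mink (n k) (n h) = phd (c i j) (c i k) (c i h) (c j k) (c j h) (c k h).
Proof.
move=> u c; have u' := u.
move: u'; rewrite /= !inE !negb_or => /and4P[/and3P[ij ik ih] /andP[jk jh] kh _].
pose W a b := mink (n a) (n b) / (d a * d b).
have row a b : (if a == b then 1 else 0) = \sum_m mink (v a) (v m) * W m b.
  have := expand (n b) (v a); rewrite minkC => E.
  have -> : \sum_m mink (v a) (v m) * W m b = mink (v a) (n b) / d b.
    rewrite E mulr_suml; apply: eq_bigr => m _; rewrite /W (minkC (n b)) (minkC (v a)).
    by field; rewrite !dn0.
  by case: eqVneq => [->|ab]; [rewrite divff // dn0 | rewrite orth // mul0r].
have g1 a : mink (v a) (v a) = 1 by exact: tri_nrm_unit.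
have cE a b : mink (v a) (v b) = - c a b by rewrite /c opprK.
have cC a b : c a b = c b a by rewrite /c minkC.
have S1 : nfd (c i j) (c i k) (c i h) (c j k) (c j h) (c k h)
    = dtd (c i j) (c i k) (c i h) (c j k) (c j h) (c k h) * W k h /\
  dtd (c i j) (c i k) (c i h) (c j k) (c j h) (c k h) * W h h = - hD (c i j) (c i k) (c j k).
  have := row i h; have := row j h; have := row k h; have := row h h.
  rewrite !(sum_I4 _ u) !g1 !mul1r eqxx (negPf ih) (negPf jh) (negPf kh) !cE.
  rewrite (cC j i) (cC k i) (cC k j) (cC h i) (cC h j) (cC h k) => r4 r3 r2 r1.
  have [|||| -> ->] := @gram_solve R (c i j) (c i k) (c i h) (c j k) (c j h) (c k h)
     (W i h) (W j h) (W k h) (W h h); [lra|lra|lra|lra|split=> //].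
(* The same with k and h exchanged, for the other diagonal entry. *)
have S2 : dtd (c i j) (c i h) (c i k) (c j h) (c j k) (c k h) * W k k
   = - hD (c i j) (c i h) (c j h).
  have := row i k; have := row j k; have := row k k; have := row h k.
  rewrite !(sum_I4 _ u) !g1 !mul1r eqxx (negPf ik) (negPf jk) (eq_sym h) (negPf kh) !cE.
  rewrite (cC j i) (cC k i) (cC k j) (cC h i) (cC h j) (cC h k) => r4 r3 r2 r1.
  have [||||_ -> //] := @gram_solve R (c i j) (c i h) (c i k) (c j h) (c j k) (c k h)
     (W i k) (W j k) (W h k) (W k k); lra.
case: S1 => S1 S3.
have dE : dtd (c i j) (c i h) (c i k) (c j h) (c j k) (c k h) =
   dtd (c i j) (c i k) (c i h) (c j k) (c j h) (c k h) by rewrite /dtd /dt; ring.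
rewrite dE in S2.
have c1 a b : a != b -> 1 < c a b by exact: gram_gt1.
have D1 : 0 < hD (c i j) (c i k) (c j k).
  by apply: lt_le_trans (hD_ge1 _ _ _); rewrite ?ltW ?c1.
have D2 : 0 < hD (c i j) (c i h) (c j h).
  by apply: lt_le_trans (hD_ge1 _ _ _); rewrite ?ltW ?c1.
have dh : d h < 0 by have [] := edge_gram kh.
have dk : d k < 0 by have [] := edge_gram jk.
have Whh : W h h = (d h ^+ 2)^-1.
  by rewrite /W (hex_nrm_unit P h) div1r expr2.
have Wkk : W k k = (d k ^+ 2)^-1.
  by rewrite /W (hex_nrm_unit P k) div1r expr2.
rewrite /phd /phr -/(nfd _ _ _ _ _ _) S1.
move: (dtd _ _ _ _ _ _) S2 S3 => E S2 S3.
have E0 : E < 0.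
  have : E * W h h < 0 by rewrite S3 oppr_lt0.
  by rewrite pmulr_llt0 // Whh invr_gt0 exprn_even_gt0 //= lt_eqF.
split => //.
have dd : 0 < d k * d h by rewrite nmulr_rgt0.
have -> : hD (c i j) (c i k) (c j k) * hD (c i j) (c i h) (c j h) = (E / (d k * d h)) ^+ 2.
  rewrite -[LHS]mulrNN -S2 -S3 Whh Wkk; field; by rewrite !dn0.
rewrite sqrtr_sqr ltr0_norm; last by rewrite pmulr_llt0 // invr_gt0.
by rewrite /W; field; rewrite !dn0 lt_eqF.
Qed.

Lemma tet_Lset : Lset (tet_length P).
Proof.
split.
  move=> A; have [i [j [ij ->]]] := tet_edgeP A.
  by rewrite tet_length_te // arcosh_gt0 // gram_gt1.
rewrite /detl !cosh_tet_length //.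
by have [] := @gram_angle v0 v1 v2 v3 isT.
Qed.

Lemma tet_angleE A : tet_angle P A = ang (tet_length P) A.
Proof.
have [u _ _] := endpt_uniq A; rewrite /tet_angle /ang /onQ.
have [_ ->] := gram_angle u.
move: u; rewrite /= !inE !negb_or => /and4P[/and3P[ij ik ih] /andP[jk jh] kh _].
by rewrite !cosh_tet_length.
Qed.
End Tet.

Section DihedralAngle.
Context {R : realType}.
Implicit Types l : tet_edge -> R.

Lemma hyperideal_Lset l : hyperideal_lengths l -> Lset l.
Proof.
by move=> [P hP]; have := tet_Lset P; congr Lset; apply/funext.
Qed.

Lemma dihedral_angleE l A : hyperideal_lengths l -> dihedral_angle l A = ang l A.
Proof.
move=> [P hP]; rewrite /dihedral_angle.
case: xgetP => [a -> [Q [hQ ->]]|/(_ (tet_angle P A)) []]; last by exists P.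
by rewrite tet_angleE (_ : tet_length Q = l) //; apply/funext.
Qed.
End DihedralAngle.

(** * Construction of regular hyper-ideal tetrahedra *)

Section RegTet.
Context {R : realType}.

(* Four vertices of a cube forming a regular tetrahedron. *)
Definition cube_sign (i : 'I_4) (c : 'I_3) : R :=
  if (i == ord0) || (i == lift ord0 c) then 1 else -1.

Definition cube_vector (a b : R) (i : 'I_4) : 'rV[R]_4 :=
  \row_m oapp (fun c => b * cube_sign i c) a (unlift ord0 m).

Lemma mink_cube_vector (a b a' b' : R) i j :
  mink (cube_vector a b i) (cube_vector a' b' j) = - (a * a') + b * b' * (if i == j then 3 else -1).
Proof.
rewrite /mink !mxE !unlift_none /=; congr (_ + _).
rewrite !big_ord_recl big_ord0 !mxE !liftK /= /cube_sign.
by move: i j; apply: I4P; apply: I4P; rewrite /= ?eqxx /=; ring.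
Qed.

Variables (C : R) (C1 : 1 < C).
(** [a] and [b] give the triangle normals norm 1 and pairwise product - C. The hexagon normals
    exchange [a] and [b] for orthogonality and are normalized by [m]. *)
Let a := Num.sqrt ((3 * C - 1) / 4).
Let b := Num.sqrt ((1 + C) / 4).
Let m := (Num.sqrt (2 * C - 1))^-1.
Let be := (Num.sqrt (C ^+ 2 - 1))^-1.
Let aE : a ^+ 2 = (3 * C - 1) / 4. Proof. by rewrite sqr_sqrtr //; move: C1; lra. Qed.
Let bE : b ^+ 2 = (1 + C) / 4. Proof. by rewrite sqr_sqrtr //; move: C1; lra. Qed.
Let C2 : 0 < C ^+ 2 - 1. Proof. by move: (C1) => h; rewrite subr_gt0 expr_gt1 //; lra. Qed.
Let mE : m ^+ 2 * (2 * C - 1) = 1.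
Proof.
rewrite /m exprVn sqr_sqrtr ?mulVf //; last by move: C1; lra.
by rewrite gt_eqF //; move: C1; lra.
Qed.
Let beE : be ^+ 2 * (C ^+ 2 - 1) = 1.
Proof. by rewrite /be exprVn sqr_sqrtr ?mulVf ?gt_eqF // ltW. Qed.
Let a0 : 0 < a. Proof. by rewrite sqrtr_gt0; move: C1; lra. Qed.
Let b0 : 0 < b. Proof. by rewrite sqrtr_gt0; move: C1; lra. Qed.
Let m0 : 0 < m. Proof. by rewrite invr_gt0 sqrtr_gt0; move: C1; lra. Qed.
Let be0 : 0 < be. Proof. by rewrite invr_gt0 sqrtr_gt0. Qed.

Let v i := cube_vector a b i.
Let n k := cube_vector (m * b) (- (m * a)) k.
(** The component of v j orthogonal to v i, normalized by [be]. *)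
Let x i j := be *: (v j + C *: v i).

Let vv i j : mink (v i) (v j) = if i == j then 1 else - C.
Proof.
by rewrite mink_cube_vector -!expr2 aE bE; case: eqP => _; lra.
Qed.

Let nv k i : mink (n k) (v i) = if k == i then - (4 * m * a * b) else 0.
Proof. by rewrite mink_cube_vector; case: eqP => _; ring. Qed.

Let xv i j p : mink (x i j) p = be * (mink (v j) p + C * mink (v i) p).
Proof. by rewrite minkZl minkDl minkZl. Qed.

Let nvN : - (4 * m * a * b) < 0.
Proof. by rewrite oppr_lt0 !mulr_gt0. Qed.

Let Cp : 0 < C. Proof. by move: C1; lra. Qed.

Let xxE i j : i != j -> mink (x i j) (x j i) = - C.
Proof.
move=> ij; have ji : j != i by rewrite eq_sym.
rewrite xv !(minkC (v _) (x _ _)) !xv !vv !eqxx (negPf ij) (negPf ji).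
transitivity (- (be ^+ 2 * (C ^+ 2 - 1)) * C); first by ring.
by rewrite beE; ring.
Qed.

Lemma regular_tet : exists P : hyperideal_tet R, forall A, tet_length P A = arcosh C.
Proof.
have h1 i j : i != j -> in_H3 (x i j).
  move=> ij; have ji : j != i by rewrite eq_sym.
  split; last first.
    rewrite /x /v !mxE !unlift_none /=; apply: mulr_gt0 => //.
    by apply: addr_gt0 => //; apply: mulr_gt0.
  rewrite xv !(minkC (v _) (x _ _)) !xv !vv !eqxx (negPf ij) (negPf ji).
  transitivity (- (be ^+ 2 * (C ^+ 2 - 1))); first by ring.
  by rewrite beE.
have h2 i : mink (v i) (v i) = 1 by rewrite vv eqxx.
have h3 k : mink (n k) (n k) = 1.
  rewrite mink_cube_vector eqxx.
  transitivity (m ^+ 2 * (3 * a ^+ 2 - b ^+ 2)); first by ring.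
  by rewrite aE bE -[RHS]mE; field.
have h4 i j : i != j -> mink (v i) (x i j) = 0.
  move=> ij; rewrite minkC xv !vv eqxx eq_sym (negPf ij); ring.
have h5 i i' j : i' != j -> i' != i -> mink (v i) (x i' j) < 0.
  move=> ij ii; rewrite minkC xv !vv (negPf ii) pmulr_rlt0 //.
  case: eqP => _; first by move: C2; rewrite mulrN -expr2; lra.
  have : 0 < C * C by exact: mulr_gt0.
  by move: Cp; lra.
have h6 k i j : i != j -> i != k -> j != k -> mink (n k) (x i j) = 0.
  move=> ij ik jk; rewrite minkC xv !(minkC (v _)) !nv !(eq_sym k) (negPf jk) (negPf ik); ring.
have h7 k i j : i != j -> (i == k) || (j == k) -> mink (n k) (x i j) < 0.
  move=> ij /orP[]/eqP h; rewrite minkC xv !(minkC (v _)) !nv h eqxx pmulr_rlt0 //.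
    by rewrite -h (negPf ij) add0r pmulr_rlt0.
  by rewrite -h eq_sym (negPf ij) mulr0 addr0.
have h8 i k : i != k -> mink (v i) (n k) = 0.
  by move=> ik; rewrite minkC nv eq_sym (negPf ik).
exists (HyperidealTet h1 h2 h3 h4 h5 h6 h7 h8) => A.
have [u _ _] := endpt_uniq A.
move: u; rewrite /= !inE !negb_or => /and4P[/and3P[ij _ _] _ _ _].
by rewrite /tet_length /hdist /= xxE // opprK.
Qed.
End RegTet.

Lemma card_tet_edge : #|{: tet_edge}| = 6%N.
Proof. by rewrite -sum1_card (sum_tet_edge (fun=> 1%N)). Qed.

(** * The curvature and the flow *)

Section Classes.
Variables (T : finType) (G : gluing T) (triG : ideal_triangulation G).

(** The gluing is an involution on faces, so the face [vmap G s k k] of the neighbour leads back. *)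
Lemma edge_rel_sym : symmetric (edge_rel G).
Proof.
case: triG => _ H1 H2 _ _.
have imp x y : edge_rel G x y -> edge_rel G y x.
  case: x y => [s A] [s' A'] /existsP[k /and3P[/= kA /eqP -> /eqP A'E]].
  apply/existsP; exists (vmap G s k k); apply/and3P; split => /=.
  - by rewrite A'E mem_imset //; exact: perm_inj.
  - by rewrite H1.
  - rewrite A'E -imset_comp; apply/eqP.
    rewrite -[LHS]imset_id; apply: eq_imset => i /=.
    by rewrite H2.
by move=> x y; apply/idP/idP; exact: imp.
Qed.

Lemma edge_classP (e : edge G) (x : T * tet_edge) : (x \in edge_class e) = (edge_of G x == e).
Proof.
have sc := sym_connect_sym edge_rel_sym.
case: e => S hS /=; have /imsetP[y _ SE] := hS.
rewrite -val_eqE /= SE inE /=.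
apply/idP/eqP => [/andP[_ xy]|E].
  apply/setP => z; rewrite !inE /=.
  by rewrite (same_connect sc xy).
have : x \in [set y in [set: T * tet_edge] | connect (edge_rel G) x y]%SET by rewrite !inE connect0.
by rewrite E !inE.
Qed.

Lemma sum_edges (V : nmodType) (F : T * tet_edge -> V) :
  \sum_(e : edge G) \sum_(x in edge_class e) F x = \sum_s \sum_A F (s, A).
Proof.
rewrite pair_big /= (partition_big (edge_of G) predT) //=.
apply: eq_bigr => e _; apply: eq_big => [x|[s A] _] //; exact: edge_classP.
Qed.
End Classes.

Section OneSided.
Context {R : realType}.

(* A solution on [0, +oo[ is continued linearly to the left of 0, where its
   derivative then becomes two-sided. *)
Lemma dv_extend_left (f : R -> R) (t d d0 : R) : 0 <= t -> (t = 0 -> d = d0) ->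
  (h^-1 * (f (t + h) - f t) @[h --> within [set h : R | 0 <= t + h] (dnbhs (0 : R))] --> d)%classic ->
  dv t (fun s => if 0 <= s then f s else f 0 + s * d0) d.
Proof.
move=> t0 td0 H; set g := fun s => _.
have E : (h^-1 *: (g (h *: 1 + t) - g t) @[h --> (0 : R)^'] --> d)%classic.
  apply/cvgrPdist_lt => e e0.
  move/cvgrPdist_lt : H => /(_ e e0) H.
  have H' : (\forall h \near dnbhs (0 : R), 0 <= t + h -> `|d - h^-1 * (f (t + h) - f t)| < e)%classic.
    exact: H.
  have Hn : (\forall h \near dnbhs (0 : R), h != 0 /\ (0 < t -> 0 <= t + h))%classic.
    have [tp|tn] := ltP 0 t.
      have : (\forall h \near (0 : R), 0 <= t + h)%classic.
        apply/nbhs_ballP; exists t => //= h; rewrite /ball /= sub0r normrN ltr_norml.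
        by move=> /andP[? _]; lra.
      move=> h1; have := (@nbhs_dnbhs_neq R 0).
      apply: filterS2; last by apply: cvg_within; exact: h1.
      by move=> h /= ? ?; split.
    apply: filterS (@nbhs_dnbhs_neq R 0) => h /= hn; split => //.
  apply: filterS2 H' Hn => h h1 [hn h2].
  rewrite /g /= /GRing.scale /= mulr1 t0 (addrC h).
  case: ifPn => [th|]; first exact: h1.
  rewrite -ltNge => th.
  have t00 : t = 0.
    by apply/eqP; rewrite eq_le t0 andbT leNgt; apply/negP => /h2; rewrite leNgt th.
  by rewrite t00 (td0 t00) [X in `|X|](_ : _ = 0) ?normr0 //; field.
split; first by apply/cvg_ex; exists d.
exact/cvg_lim.
Qed.
End OneSided.

Section Main.
Variables (R : realType) (T : finType) (G : gluing T) (triG : ideal_triangulation G).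
Implicit Types (l : edge G -> R).

Lemma metric_Lset l s : hyperideal_metric l -> Lset (lengths_on l s).
Proof. by move=> [_ h]; exact: hyperideal_Lset. Qed.

Lemma curvature_ang l e : hyperideal_metric l ->
  curvature l e = 2 * pi - \sum_(x in edge_class e) ang (lengths_on l x.1) x.2.
Proof.
move=> [_ h]; congr (_ - _); apply: eq_bigr => x _; exact: dihedral_angleE.
Qed.

Lemma Bset_sum_lt (a : tet_edge -> R) : Bset a -> \sum_A a A < 2 * pi.
Proof. by move=> [_ [h1 h2 h3 h4]]; rewrite sum_tet_edge; lra. Qed.

Lemma sum_edge_degree : (\sum_(e : edge G) edge_degree e = 6 * #|T|)%N.
Proof.
under eq_bigr do rewrite /edge_degree -sum1_card.
rewrite (sum_edges triG (fun=> 1%N)).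
under eq_bigr do rewrite sum1_card.
by rewrite sum_nat_const card_tet_edge mulnC.
Qed.

Lemma no_flat_metric l : (forall e : edge G, (edge_degree e <= 6)%N) ->
  hyperideal_metric l -> ~ (forall e, curvature l e = 0).
Proof.
move=> deg hl K0.
have T0 : (0 < #|T|)%N by case: triG.
have ET : (#|T| <= #|{: edge G}|)%N.
  rewrite -(leq_pmul2l (isT : 0 < 6)%N) -sum_edge_degree -sum1_card big_distrr /=.
  by apply: leq_sum => e _; rewrite muln1.
have : \sum_(e : edge G) curvature l e = 0 by rewrite big1.
under eq_bigr do rewrite curvature_ang //.
rewrite sumrB (sum_edges triG (fun x => ang (lengths_on l x.1) x.2)) /=.
rewrite sumr_const => /subr0_eq H.
have : \sum_s \sum_A ang (lengths_on l s) A < \sum_(s : T) 2 * pi.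
  have [s0 _] : exists s0 : T, true by case/card_gt0P: T0 => s0 _; exists s0.
  rewrite (bigD1 s0) //= [ltRHS](bigD1 s0) //=.
  apply: ltr_leD; first by apply/Bset_sum_lt/Lset_Bset/metric_Lset.
  by apply: ler_sum => s _; apply/ltW/Bset_sum_lt/Lset_Bset/metric_Lset.
rewrite -H sumr_const ltr_pMn2l; last by rewrite mulr_gt0 // pi_gt0.
by rewrite ltnNge ET.
Qed.

Section Uniform.
Variables (N : nat) (N6 : (6 < N)%N) (degN : forall e : edge G, edge_degree e = N).
Let th : R := 2 * pi / N%:R.

Let N0 : 0 < N%:R :> R. Proof. by rewrite ltr0n (leq_trans _ N6). Qed.
Let th0 : 0 < th. Proof. by rewrite divr_gt0 // mulr_gt0 // pi_gt0. Qed.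
Let th3 : 3 * th < pi.
Proof.
have N6' : 6 < N%:R :> R by rewrite ltr_nat.
rewrite /th mulrA ltr_pdivrMr // mulrA [ltRHS]mulrC ltr_pM2r ?pi_gt0 //; lra.
Qed.
Let thN : th *+ N = 2 * pi.
Proof. by rewrite -[LHS]mulr_natr /th divfK // gt_eqF. Qed.
Let L := regL th.

Lemma regular_metric : hyperideal_metric (fun _ : edge G => L).
Proof.
split; first by move=> _; exact: regL_gt0.
by move=> s; exact: regular_tet (regC_gt1 th0 th3).
Qed.

Lemma regular_curvature e : curvature (fun _ : edge G => L) e = 0.
Proof.
rewrite curvature_ang; last exact: regular_metric.
rewrite (eq_bigr (fun=> th)); last by move=> x _; rewrite /lengths_on ang_regular.
by rewrite sumr_const -/(edge_degree e) degN thN subrr.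
Qed.

Lemma energy_decay l : \sum_e (l e - L) * ext_curvature l e =
  - \sum_s \sum_A (ext_angle (lengths_on l s) A - th) * (lengths_on l s A - L).
Proof.
rewrite -(sum_edges triG (fun x => (ext_angle (lengths_on l x.1) x.2 - th) *
  (lengths_on l x.1 x.2 - L))) -sumrN.
apply: eq_bigr => e _.
(* All edges have degree N, so 2 pi splits into a share th for each tetrahedron edge in the
   class. *)
have E : \sum_(x in edge_class e) th = 2 * pi.
  by rewrite sumr_const -/(edge_degree e) degN thN.
rewrite /ext_curvature -E -sumrB mulr_sumr -sumrN; apply: eq_bigr => -[s A] /=.
by rewrite (edge_classP triG) /lengths_on => /eqP ->; ring.
Qed.

Lemma sum_sqr_edges l : \sum_s \sum_A (lengths_on l s A - L) ^+ 2 =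
  N%:R * \sum_e (l e - L) ^+ 2.
Proof.
rewrite -(sum_edges triG (fun x => (lengths_on l x.1 x.2 - L) ^+ 2)) mulr_sumr.
apply: eq_bigr => e _.
rewrite (eq_bigr (fun=> (l e - L) ^+ 2)).
  by rewrite sumr_const -/(edge_degree e) degN mulr_natl.
by move=> [s A]; rewrite (edge_classP triG) /lengths_on /= => /eqP ->.
Qed.

Lemma flow_dissipation (R0 : R) : 0 < R0 -> exists2 c, 0 < c & forall l,
  (forall e, `|l e - L| <= R0) ->
  \sum_e (l e - L) * ext_curvature l e <= - (c * \sum_e (l e - L) ^+ 2).
Proof.
move=> R00; have [c c0 H] := ext_strong th0 th3 R00.
exists (c * N%:R); first exact: mulr_gt0.
move=> l hl; rewrite energy_decay lerN2 -mulrA -sum_sqr_edges mulr_sumr.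
by apply: ler_sum => s _; apply: H => A; exact: hl.
Qed.

(** Each l lies in some ball around L; only the rate depends on the ball, not the sign. *)
Lemma flow_dissipation_le0 l : \sum_e (l e - L) * ext_curvature l e <= 0.
Proof.
have R00 : 0 < 1 + \sum_e `|l e - L| by rewrite ltr_pwDl //; exact: sumr_ge0.
have [c c0 H] := flow_dissipation R00.
apply: le_trans (H l _) _; last first.
  rewrite oppr_le0; apply: mulr_ge0; first exact: ltW.
  by apply: sumr_ge0 => e _; exact: sqr_ge0.
by move=> e; rewrite (bigD1 e) //= addrCA lerDl addr_ge0 // ?sumr_ge0.
Qed.

Section Flow.
Variables (l : R -> edge G -> R) (flow : extended_flow l).
Let lx (t : R) (e : edge G) := if 0 <= t then l t e else l 0 e + t * ext_curvature (l 0) e.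
Let E (t : R) := \sum_e (lx t e - L) ^+ 2.

Let lxE t : 0 <= t -> lx t = l t.
Proof. by move=> t0; apply/funext => e; rewrite /lx t0. Qed.

Let dv_lx t e : 0 <= t -> dv t (fun s => lx s e) (ext_curvature (l t) e).
Proof.
move=> t0; apply: (@dv_extend_left _ (fun s => l s e)) => //; first by move=> ->.
exact: flow.
Qed.

(** The energy is negated so that [dv_le], a criterion for growth, expresses its decay; the
    exponential weight absorbs the rate k. *)
Let dv_E t k : 0 <= t -> dv t (fun s => - (E s * expR (k * s)))
  (- ((k * E t + 2 * \sum_e (l t e - L) * ext_curvature (l t) e) * expR (k * t))).
Proof.
move=> t0; apply: dvN.
apply: dv_eq.
  apply: dvM.
    apply: dv_sum => e; apply: dvX2; apply: dvD; [exact: dv_lx | exact: dv_cst].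
  apply: (dv_comp (h := @expR R)); first exact: is_derive_expR.
  by apply: dvM; [exact: dv_cst | exact: dv_id].
rewrite /= (lxE t0) (eq_bigr (fun e => 2 * ((l t e - L) * ext_curvature (l t) e))); last first.
  by move=> e _; ring.
rewrite -mulr_sumr /E (lxE t0); ring.
Qed.

Let decay t k : 0 <= t ->
  (forall s, 0 <= s <= t ->
     k * E s + 2 * \sum_e (l s e - L) * ext_curvature (l s) e <= 0) ->
  E t * expR (k * t) <= E 0.
Proof.
move=> t0 H.
have : - (E 0 * expR (k * 0)) <= - (E t * expR (k * t)).
  apply: (@dv_le _ (fun s => - (E s * expR (k * s))) _ _ _ t0) => s hs.
    by apply: dv_E; case/andP: hs.
  by rewrite /= -mulNr mulr_ge0 ?expR_ge0 // oppr_ge0 H.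
by rewrite mulr0 expR0 mulr1 lerN2.
Qed.

Lemma flow_converges : exists C c : R, [/\ 0 < C, 0 < c & forall t, 0 <= t ->
  edge_norm (fun e => l t e - L) <= C * expR (- (c * t))].
Proof.
have E0 t : 0 <= E t by apply: sumr_ge0 => e _; exact: sqr_ge0.
(* The case k = 0: the energy does not increase, which confines the flow to a bounded set and so
   fixes the rate c. *)
have bnd t e : 0 <= t -> `|l t e - L| <= 1 + E 0.
  move=> t0.
  have Et : E t <= E 0.
    have := @decay t 0 t0; rewrite mul0r expR0 mulr1; apply=> s _.
    by rewrite mul0r add0r pmulr_rle0 // flow_dissipation_le0.
  have : (l t e - L) ^+ 2 <= E 0.
    apply: le_trans Et; rewrite /E (lxE t0) (bigD1 e) //= lerDl sumr_ge0 // => e' _.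
    exact: sqr_ge0.
  move=> h; have e0 := E0 0.
  rewrite -(@ler_pXn2r _ 2) ?nnegrE ?normr_ge0 //; last lra.
  rewrite real_normK ?num_real //; apply: le_trans h _.
  by rewrite sqrrD; have := sqr_ge0 (E 0); lra.
have R00 : 0 < 1 + E 0 by rewrite ltr_pwDl.
have [c c0 H] := flow_dissipation R00.
(* The 1 keeps the constant positive when the flow starts at the equilibrium. *)
exists (Num.sqrt (1 + E 0)), c; split => //; first by rewrite sqrtr_gt0.
move=> t t0.
have : E t * expR (2 * c * t) <= E 0.
  apply: decay => // s /andP[s0 _].
  have := H (l s) (fun e => bnd s e s0).
  by rewrite /E (lxE s0); lra.
rewrite /edge_norm => h.
have -> : \sum_e (l t e - L) ^+ 2 = E t by rewrite /E (lxE t0).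
have ee : Num.sqrt (1 + E 0) * expR (- (c * t)) = Num.sqrt ((1 + E 0) * expR (- (c * t)) ^+ 2).
  by rewrite sqrtrM ?ltW // sqrtr_sqr ger0_norm // expR_ge0.
rewrite ee; apply: ler_wsqrtr.
have x2 : expR (- (c * t)) ^+ 2 = (expR (2 * c * t))^-1.
  by rewrite -expRN expr2 -expRD; congr expR; ring.
rewrite x2 ler_pdivlMr ?expR_gt0 //; apply: le_trans h _; lra.
Qed.
End Flow.
End Uniform.
End Main.

Theorem corollary1p1 (R : realType) (T : finType) (G : gluing T)
    (triG : ideal_triangulation G)
    (chi_neg : forall C : {set T * 'I_4},
       boundary_component G C -> (euler_char G C < 0)%R) :
  ((forall e : edge G, (edge_degree e <= 6)%N) ->
     ~ exists l : edge G -> R,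
         hyperideal_metric l /\ (forall e : edge G, curvature l e = 0))
  /\
  (forall N : nat, (6 < N)%N -> (forall e : edge G, edge_degree e = N) ->
     forall (l0 : edge G -> R) (l : R -> edge G -> R),
       hyperideal_metric l0 -> extended_flow l -> l 0 = l0 ->
       exists lstar : edge G -> R,
         [/\ hyperideal_metric lstar,
             (forall e : edge G, curvature lstar e = 0) &
             exists C c : R, [/\ 0 < C, 0 < c &
               forall t : R, 0 <= t ->
                 edge_norm (fun e => l t e - lstar e) <= C * expR (- (c * t))]]).
Proof.
split; first by move=> deg [l [hl K0]]; exact: no_flat_metric deg hl K0.
move=> N N6 degN l0 l _ flow _.
exists (fun=> regL (2 * pi / N%:R)); split.
- exact: regular_metric.
- exact: regular_curvature.
- exact: flow_converges.
Qed.
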